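(* Consider the generic filtering algorithm described in the context, where $\big(\{U_t^n\}_{n=1}^N\big)_{t\geq 1}$ is a sequence of independent sets of $N$ independent $\mathcal{U}(0,1)^2$ random variables. Then there exists a constant $\bar C_1'\in(0,\infty)$ such that, for any $(q,\kappa)\in(0,1)^2$ and any integer $T\geq 1$, we have $$\mathbb{P}\Big(\sup_{t\in\{1,\dots,T\}}\|\hat\eta_t^N-\hat\eta_t\|\leq\kappa,\ \sup_{t\in\{1,\dots,T\}}\|\eta_t^N-\eta_t\|\leq\kappa\Big)\geq 1-q,\quad\forall N\geq N_{T,\kappa,q},$$ where $N_{T,\kappa,q}=\bar C_1'\big\{1+\log(1+\kappa^{-1})\big\}^2\kappa^{-2}\big(1+\log(T/q)\big)$.
   Context: $\mathcal{P}(\mathbb{R})$ is the set of Borel probability measures on $\mathbb{R}$. For $\pi\in\mathcal{P}(\mathbb{R})$, $F_\pi$ is its cumulative distribution function and $F_\pi^{-1}$ the generalized inverse of $F_\pi$. $\|\pi_1-\pi_2\|=\sup_{a\in\mathbb{R}}|F_{\pi_1}(a)-F_{\pi_2}(a)|$ is the Kolmogorov distance. For a measure $\pi$, function $f$ and kernel $K$ on $\mathbb{R}$: $\pi(f)=\int f\,d\pi$, $\pi K(A)=\int K(x,A)\pi(dx)$. Model. Fix $\rho\in\mathbb{R}$, $\sigma,c\in(0,\infty)$ and $\eta_1\in\mathcal{P}(\mathbb{R})$ (constants may depend on these). For $z\in\mathbb{R}$ let $M(z,dx)=\mathcal{N}(\rho z,\sigma^2)$, $G(z)=e^{-cz^2/2}$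 and $Q(z,dx)=M(z,dx)G(x)$; $Q^1=Q$ and $Q^k(x,A)=\int Q(x,dx')Q^{k-1}(x',A)$ for $k\ge2$. Define $\hat\eta_1(dx)=G(x)\eta_1(dx)/\eta_1(G)$ and, for $t\geq 2$, $\eta_t=\hat\eta_{t-1}M$ and $\hat\eta_t(dx)=\hat\eta_1Q^{t-1}(dx)/\hat\eta_1Q^{t-1}(\mathbb{R})$. Generic filtering algorithm. Given $N\ge1$ and random point sets $\{U_t^n=(U_{t,1}^n,U_{t,2}^n)\}_{n=1}^N$ in $(0,1)^2$, $t\geq 1$, all defined on a probability space $(\Omega,\mathcal{F},\mathbb{P})$: set $X_1^n=F_{\eta_1}^{-1}(U_{1,1}^n)$. For $t\geq 2$ set $\hat X_{t-1}^n=F^{-1}_{\hat\eta_{t-1}^N}(U_{t,1}^n)$ and $X_t^n=F^{-1}_{M(\hat X_{t-1}^n,dx)}(U_{t,2}^n)$. For all $t\geq 1$, $W_t^n=G(X_t^n)/\sum_{m=1}^NG(X_t^m)$, $\eta_t^N=\frac1N\sum_{n=1}^N\delta_{\{X_t^n\}}$ and $\hat\eta_t^N=\sum_{n=1}^NW_t^n\delta_{\{X_t^n\}}$. (Operations with index $n$ are performed for all $n\in\{1,\dots,N\}$.) *)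

(* Defs.v *)
From mathcomp Require Export all_boot all_order all_algebra finmap.
From mathcomp Require Export all_classical all_reals all_analysis.
Set Implicit Arguments.
Unset Strict Implicit.
Unset Printing Implicit Defensive.
Export Order.TTheory GRing.Theory Num.Theory.
Export numFieldNormedType.Exports.

Local Open Scope classical_set_scope.
Local Open Scope ring_scope.

(* The integral of the library and the definitions below only use the values
   of a measure, so measures and kernels on the real line are handled here as
   set functions [set R -> \bar R] and [R -> set R -> \bar R]; all those that
   occur below are (sub)probability measures on the Borel sets. *)
Section measures_on_the_line.
Context {R : realType}.
Implicit Types (pi : set R -> \bar R) (K : R -> set R -> \bar R).

Definition measure_cdf pi (a : R) : \bar R := pi [set` `]-oo, a]].

(* For [0 < u < 1] and [pi] a probability measure the set is nonempty and
   bounded below; [inf] is only meant to be used in this case. *)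
Definition measure_quantile pi (u : R) : R :=
  inf [set a : R | (u%:E <= measure_cdf pi a)%E].

Definition kolmogorov_dist pi1 pi2 : \bar R :=
  ereal_sup [set `|measure_cdf pi1 a - measure_cdf pi2 a|%E | a in [set: R]].

Definition measure_kernel pi K (A : set R) : \bar R :=
  (\int[pi]_x K x A)%E.

End measures_on_the_line.

Section model.
Context {R : realType}.
Variables (rho sigma c : R) (eta1 : probability R R).

Definition potential (z : R) : R := expR (- (c * z ^+ 2 / 2)).

(* The second parameter of [normal_prob] is the standard deviation. *)
Definition mutation (z : R) : set R -> \bar R := normal_prob (rho * z) sigma.

Definition feynman_kac (z : R) (A : set R) : \bar R :=
  (\int[mutation z]_(x in A) (potential x)%:E)%E.

(* [feynman_kac_pow 0] is the identity kernel and is never used below. *)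
Fixpoint feynman_kac_pow (k : nat) (z : R) (A : set R) : \bar R :=
  match k with
  | 0%N => \d_z A
  | 1%N => feynman_kac z A
  | k'.+1 => (\int[feynman_kac z]_y feynman_kac_pow k' y A)%E
  end.

Definition hat_eta1 (A : set R) : \bar R :=
  ((\int[eta1]_(x in A) (potential x)%:E) / \int[eta1]_x (potential x)%:E)%E.

(* Time starts at 1 in [hat_eta], [eta] and [particles]; the values at time 0
   are irrelevant. *)
Definition hat_eta (t : nat) (A : set R) : \bar R :=
  if (t <= 1)%N then hat_eta1 A
  else (measure_kernel hat_eta1 (feynman_kac_pow t.-1) A /
        measure_kernel hat_eta1 (feynman_kac_pow t.-1) setT)%E.

Definition eta (t : nat) (A : set R) : \bar R :=
  if (t <= 1)%N then eta1 A else measure_kernel (hat_eta t.-1) mutation A.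

Section particle_system.
Context {N : nat}.
Implicit Types x : 'I_N -> R.

Definition weight x (n : 'I_N) : R :=
  potential (x n) / \sum_(m < N) potential (x m).

Definition empirical x (A : set R) : \bar R :=
  ((N%:R^-1)%:E * \sum_(n < N) \d_(x n) A)%E.

Definition weighted_empirical x (A : set R) : \bar R :=
  (\sum_(n < N) (weight x n)%:E * \d_(x n) A)%E.

(* [u t n] is the realisation of the n-th point of the point set of time t. *)
Fixpoint particles (u : nat -> 'I_N -> R * R) (t : nat) (n : 'I_N) : R :=
  match t with
  | 0%N => 0
  | 1%N => measure_quantile eta1 (u 1%N n).1
  | t'.+1 =>
      let hat_x := measure_quantile
                     (weighted_empirical (particles u t')) (u t n).1 in
      measure_quantile (mutation hat_x) (u t n).2
  end.

Definition eta_N (u : nat -> 'I_N -> R * R) (t : nat) : set R -> \bar R :=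
  empirical (particles u t).

Definition hat_eta_N (u : nat -> 'I_N -> R * R) (t : nat) : set R -> \bar R :=
  weighted_empirical (particles u t).

End particle_system.
End model.

Section randomness.
Context {R : realType} d (Omega : measurableType d) (P : probability Omega R).

(* Mutual independence of the subfamily of [X] with indices in [D]. *)
Definition mutually_independent d' (T : measurableType d') (I : choiceType)
    (D : set I) (X : I -> {RV P >-> T}) : Prop :=
  forall (J : {fset I}) (A : I -> set T),
    [set` J] `<=` D -> (forall i, i \in J -> measurable (A i)) ->
    P (\bigcap_(i in [set` J]) (X i @^-1` A i)) =
    (\prod_(i <- J) P (X i @^-1` A i))%E.

Definition uniform_square : set (R * R) -> \bar R :=
  (uniform_prob (@ltr01 R) \x uniform_prob (@ltr01 R))%E.

Definition iid_uniform_points (N : nat)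
    (U : nat -> 'I_N -> {RV P >-> (R * R)%type}) : Prop :=
  [/\ forall t n w, (1 <= t)%N ->
        0 < (U t n w).1 < 1 /\ 0 < (U t n w).2 < 1,
      forall t n A, (1 <= t)%N -> measurable A ->
        distribution P (U t n) A = uniform_square A &
      mutually_independent [set p : nat * 'I_N | (1 <= p.1)%N]
        (fun p : nat * 'I_N => U p.1 p.2)].

End randomness.

Definition sample_size {R : realType} (C : R) (T : nat) (kappa q : R) : R :=
  C * (1 + ln (1 + kappa^-1)) ^+ 2 * kappa ^- 2 * (1 + ln (T%:R / q)).

(* Main.v *)
(* Given the past, the particles of time t are N independent draws from the
   exact prediction of the current particle approximation, so each one-step
   error is the deviation of an empirical distribution function, which
   Hoeffding's inequality and a union bound over a grid of quantiles control.
   Gaussian mutations and gaussian potentials compose to gaussian ones: k steps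
   of the unnormalised flow map f to a multiple of exp(- s_k x^2 / 2) psi_k(x),
   where s_k stays in a compact subset of ]0, +oo[ and, for f the indicator of a
   half-line and k > 0, the Lipschitz constant of psi_k decays geometrically in
   k.  Such a product has, up to an additive multiple of exp(- s_k x^2 / 2) that
   the normalisation cancels, a geometrically small variation on the whole line,
   so the Kolmogorov errors made at all previous times add up to a constant
   times the largest of them, uniformly in time. *)
From HB Require Import structures.
From mathcomp Require Import measurable_realfun giry ring lra.
Require Import Defs.
Set Implicit Arguments.
Unset Strict Implicit.
Unset Printing Implicit Defensive.
Local Open Scope classical_set_scope.
Local Open Scope ring_scope.


(** Each error estimate concerns a ratio of integrals, and the denominators are integrals against
    random measures, which nothing bounds below a priori: a particle system that has lost the target
    may have an almost vanishing normaliser. The uniform lower bound is bootstrapped. As long as all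
    one-step errors are below a fixed radius, the earlier filters are close to the exact ones; the
    Kolmogorov distance controls integrals of functions of bounded variation, in particular of the
    narrowest gaussian potential that occurs, whose integral against the exact filters is bounded
    below uniformly in time. The induction feeds nothing but these denominators, so the error
    constant does not grow with time. The radius is harmless: since [kappa < 1], the one-step
    accuracy can be taken to be [kappa / L] for a constant [L] above the inverse radius, and [L]
    only enters the constant of the sample size. The decay of the Lipschitz constants holds for
    every [rho], however large: tilting by the potentials reduces the gains of the gaussian
    kernels. *)

HB.lock Definition expect d (T : measurableType d) (R : realType)
  (mu : probability T R) (f : T -> R) : R := \int[mu]_x f x.

(** * Expectations of bounded functions *)

Section expectation.
Context d (T : measurableType d) {R : realType}.
Implicit Types (mu : probability T R) (f g : T -> R).

Definition bounded_measurable f :=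
  measurable_fun setT f /\ exists m, forall x, `|f x| <= m.

Lemma bm_integrable mu f : bounded_measurable f -> mu.-integrable setT (EFin \o f).
Proof.
move=> [mf [m fm]]; apply: measurable_bounded_integrable => //.
- by rewrite (le_lt_trans (probability_le1 _ _))// ltry.
- exists m; split; first by rewrite num_real.
  by move=> M mM x _; exact: le_trans (fm x) (ltW mM).
Qed.

Lemma expectE mu f : bounded_measurable f -> 
  (\int[mu]_x (f x)%:E)%E = (expect mu f)%:E.
Proof.
by move=> bf; rewrite expect.unlock fineK//; apply: integrable_fin_num => //; exact: bm_integrable.
Qed.

Lemma bm_cst (r : R) : bounded_measurable (fun=> r).
Proof. by split; [exact: measurable_cst | exists `|r|]. Qed.

Lemma bmD f g : bounded_measurable f -> bounded_measurable g ->
  bounded_measurable (fun x => f x + g x).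
Proof.
move=> [mf [a fa]] [mg [b gb]]; split; first exact: measurable_funD.
by exists (a + b) => x; rewrite (le_trans (ler_normD _ _))// lerD.
Qed.

Lemma bmM f g : bounded_measurable f -> bounded_measurable g ->
  bounded_measurable (fun x => f x * g x).
Proof.
move=> [mf [a fa]] [mg [b gb]]; split; first exact: measurable_funM.
by exists (a * b) => x; rewrite normrM ler_pM.
Qed.

Lemma bmB f g : bounded_measurable f -> bounded_measurable g ->
  bounded_measurable (fun x => f x - g x).
Proof.
move=> [mf [a fa]] [mg [b gb]]; split; first exact: measurable_funB.
by exists (a + b) => x; rewrite (le_trans (ler_normB _ _))// lerD.
Qed.

Lemma bm_indic (A : set T) : measurable A -> bounded_measurable (\1_A : T -> R).
Proof.
move=> mA; split; first exact: measurable_indic.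
by exists 1 => x; rewrite indicE ger0_norm ?ler0n// lern1 leq_b1.
Qed.

Lemma expect_cst mu (r : R) : expect mu (fun=> r) = r.
Proof. by rewrite !expect.unlock Rintegral_cst// [X in fine X]probability_setT mulr1. Qed.

Lemma expectD mu f g : bounded_measurable f -> bounded_measurable g ->
  expect mu (fun x => f x + g x) = expect mu f + expect mu g.
Proof. by move=> bf bg; rewrite !expect.unlock; exact: (RintegralD measurableT (bm_integrable mu bf) (bm_integrable mu bg)). Qed.

Lemma expectB mu f g : bounded_measurable f -> bounded_measurable g ->
  expect mu (fun x => f x - g x) = expect mu f - expect mu g.
Proof. by move=> bf bg; rewrite !expect.unlock; exact: (RintegralB measurableT (bm_integrable mu bf) (bm_integrable mu bg)). Qed.

Lemma expectZ mu (r : R) f : bounded_measurable f ->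
  expect mu (fun x => r * f x) = r * expect mu f.
Proof. by move=> bf; rewrite !expect.unlock; exact: (RintegralZl r measurableT (bm_integrable mu bf)). Qed.

Lemma le_expect mu f g : bounded_measurable f -> bounded_measurable g ->
  (forall x, f x <= g x) -> expect mu f <= expect mu g.
Proof.
move=> bf bg fg.
by rewrite !expect.unlock; apply: (le_Rintegral measurableT (bm_integrable mu bf) (bm_integrable mu bg)) => x _.
Qed.

Lemma expect_ge0 mu f : (forall x, 0 <= f x) -> 0 <= expect mu f.
Proof. by move=> f0; rewrite expect.unlock; apply: Rintegral_ge0 => x _. Qed.

Lemma expect_indic mu (A : set T) : measurable A ->
  expect mu (\1_A) = fine (mu A).
Proof. by move=> mA; rewrite !expect.unlock /Rintegral integral_indic// setIT. Qed.

Lemma expect_norm_le mu f (m : R) : bounded_measurable f ->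
  (forall x, `|f x| <= m) -> `|expect mu f| <= m.
Proof.
move=> bf fm; rewrite ler_norml; apply/andP; split.
- rewrite -(expect_cst mu (- m)); apply: le_expect => // [|x]; first exact: bm_cst.
  by have := fm x; rewrite ler_norml => /andP[].
- rewrite -[leRHS](expect_cst mu m); apply: le_expect => // [|x]; first exact: bm_cst.
  by have := fm x; rewrite ler_norml => /andP[].
Qed.

(** A zero integral would make [f] vanish almost everywhere; as [f] vanishes nowhere, the
    exceptional null set would be the whole space. *)
Lemma expect_gt0 mu f : bounded_measurable f -> (forall x, 0 < f x) ->
  0 < expect mu f.
Proof.
move=> bf f0; rewrite lt_def expect_ge0 ?andbT; last by move=> x; exact: ltW.
apply/eqP => E0.
have : (\int[mu]_x `|(f x)%:E| = 0)%E.
  under eq_integral do rewrite gee0_abs ?lee_fin ?ltW//.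
  by rewrite expectE// E0.
move/(ae_eq_integral_abs mu measurableT); case; last first.
  move=> B [mB B0 fB].
  have BT : B = setT.
    rewrite -subTset => x _; apply: fB => /= /(_ I) [/eqP].
    by rewrite gt_eqF.
  by move: B0; rewrite BT [X in X = _]probability_setT => /eqP; rewrite onee_eq0.
by apply/measurable_EFinP; case: bf.
Qed.

End expectation.

(** * Integrals against set functions and against densities *)

Section set_functions.
Context d (T : measurableType d) {R : realType}.
Import HBNNSimple.
Local Open Scope ereal_scope.

(** The integral is built from simple functions, hence from values on measurable sets only. This
    replaces the bare set functions of the statement by bundled probability measures. *)
Lemma eq_set_function_integral (m1 m2 : set T -> \bar R) (D : set T) (f : T -> \bar R) :
  (forall A, measurable A -> m1 A = m2 A) ->
  \int[m1]_(x in D) f x = \int[m2]_(x in D) f x.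
Proof.
move=> m12.
have E (h : {nnsfun T >-> R}) : sintegral m1 h = sintegral m2 h.
  by apply: eq_fsbigr => r _; rewrite m12.
rewrite /integral.
by congr (_ - _); congr ereal_sup; apply/seteqP; split => x [h hf <-]; exists h.
Qed.

(** On simple functions the identity is the density hypothesis applied to the fibres; monotone
    convergence on both sides gives the general case. *)
Lemma ge0_integral_density (mu nu : {measure set T -> \bar R}) (g : T -> R)
    (f : T -> \bar R) :
    measurable_fun setT g -> (forall x, 0 <= g x)%R ->
    (forall A, measurable A -> nu A = \int[mu]_(x in A) (g x)%:E) ->
    measurable_fun setT f -> (forall x, 0 <= f x) ->
  \int[nu]_x f x = \int[mu]_x (f x * (g x)%:E).
Proof.
move=> mg g0 nuE mf f0.
pose h := nnsfun_approx measurableT mf.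
pose hE := fun n => EFin \o h n.
have mhE n : measurable_fun [set: T] (hE n) by exact/measurable_EFinP.
have hE_ge0 n x : 0 <= hE n x by rewrite lee_fin.
have nd_hE x : {homo hE ^~ x : n m / (n <= m)%O >-> n <= m}.
  by move=> *; exact/lefP/nd_nnsfun_approx.
have cvh x : hE ^~ x @ \oo --> f x by exact: cvg_nnsfun_approx.
have mgE : measurable_fun setT (EFin \o g) by exact/measurable_EFinP.
have gE0 x : 0 <= (g x)%:E by rewrite lee_fin.
have step n : \int[nu]_x hE n x = \int[mu]_x (hE n x * (g x)%:E).
  rewrite integralT_nnsfun sintegralE.
  transitivity (\sum_(r \in range (h n)) \int[mu]_x (r%:E * (\1_(h n @^-1` [set r]) x)%:E * (g x)%:E)).
    apply: eq_fsbigr => r /set_mem [y _ yr].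
    rewrite nuE//; under [RHS]eq_integral do rewrite -muleA.
    rewrite ge0_integralZl//; first last.
    - by rewrite -yr lee_fin.
    - by move=> x _; rewrite mule_ge0// lee_fin.
    - by apply: emeasurable_funM => //; apply/measurable_EFinP; exact: measurable_indic.
    congr (_ * _); rewrite integral_mkcond; apply: eq_integral => x _.
    by rewrite patchE indicE; case: ifPn => _; rewrite ?mul1e ?mul0e.
  rewrite -ge0_integral_fsum//.
  - apply: eq_integral => x _.
    rewrite -ge0_mule_fsuml; last by move=> r; exact: nnfun_muleindic_ge0.
    congr (_ * _); rewrite /hE/= [X in X%:E](fimfunE (h n)) fsumEFin//.
  - by move=> r; apply: emeasurable_funM => //; apply: measurable_funeM; apply/measurable_EFinP; exact: measurable_indic.
  - by move=> r x _; apply: mule_ge0 => //; exact: nnfun_muleindic_ge0.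
transitivity (limn (fun n => \int[nu]_x hE n x)).
  rewrite -monotone_convergence//; apply: eq_integral => t _.
  by apply/esym/cvg_lim.
transitivity (limn (fun n => \int[mu]_x (hE n x * (g x)%:E))).
  by apply: congr_lim; apply/funext => n; exact: step.
rewrite -monotone_convergence//.
- apply: eq_integral => t _; apply/cvg_lim => //.
  under eq_fun do rewrite muleC; rewrite muleC; exact: cvgeZl.
- by move=> n; apply: emeasurable_funM.
- by move=> n x _; apply: mule_ge0.
- by move=> x _ n m nm; apply: lee_wpmul2r => //; exact: nd_hE.
Unshelve. all: by end_near. Qed.

End set_functions.

(** * Gaussian measures *)

Section line_measures.
Context {R : realType}.
Implicit Types (m s t : R).

Let bmeas_id : measurable_fun setT (idfun : measurableTypeR R -> R).
Proof. by move=> _ A mA; rewrite setTI. Qed.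

Lemma ge0_integral_measurableTypeR (mu : {measure set (measurableTypeR R) -> \bar R})
    (f : R -> \bar R) :
  measurable_fun setT f -> (forall x, 0 <= f x)%E ->
  (\int[mu : set R -> \bar R]_x f x = \int[mu]_(x in (setT : set (measurableTypeR R))) f x)%E.
Proof.
by move=> mf f0; have := @ge0_integral_pushforward _ _ _ _ _ _ bmeas_id mu setT f measurableT mf (fun x _ => f0 x).
Qed.

(* [lebesgue_measure] and [normal_prob] live on [measurableTypeR R], whose
   display differs from the default one of [R]; these are their copies on [R]. *)
Definition line_lebesgue : set R -> \bar R := @lebesgue_measure R.

HB.instance Definition _ := isMeasure.Build _ R R line_lebesgue
  (@measure0 _ (measurableTypeR R) R lebesgue_measure)
  (@measure_ge0 _ (measurableTypeR R) R lebesgue_measure)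
  (@measure_semi_sigma_additive _ (measurableTypeR R) R lebesgue_measure).

Section gaussian.
Variables m s : R.

Definition gaussian : set R -> \bar R := normal_prob m s.

HB.instance Definition _ := isMeasure.Build _ R R gaussian
  (@measure0 _ (measurableTypeR R) R (normal_prob m s))
  (@measure_ge0 _ (measurableTypeR R) R (normal_prob m s))
  (@measure_semi_sigma_additive _ (measurableTypeR R) R (normal_prob m s)).

HB.instance Definition _ :=
  @Measure_isProbability.Build _ R R gaussian (@probability_setT _ (measurableTypeR R) R (normal_prob m s)).

End gaussian.

(** The image of Lebesgue measure under a translation gives half-open intervals their length, and
    this characterises Lebesgue measure. *)
Lemma ge0_integral_shift m (f : R -> \bar R) :
  measurable_fun setT f -> (forall x, 0 <= f x)%E ->
  (\int[line_lebesgue]_x f (x + m)%R = \int[line_lebesgue]_x f x)%E.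
Proof.
move=> mf f0.
pose sh (x : R) : R := x + m.
have ms : measurable_fun setT sh by apply: measurable_funD.
have ms' : measurable_fun setT (sh : measurableTypeR R -> measurableTypeR R) by exact: ms.
have E A : measurable A -> line_lebesgue A = pushforward line_lebesgue sh A.
  move=> mA.
  apply: (@lebesgue_measure_unique R (measure_function_pushforward__canonical__measure_function_Measure lebesgue_measure ms')) => // X [[a b]]/= _ <-.
  rewrite /pushforward.
  have -> : sh @^-1` `]a, b] = `]a - m, b - m]%classic.
    by apply/seteqP; split => x /=; rewrite !in_itv/= ltrBlDr lerBrDr.
  rewrite !lebesgue_measure_itv/= !lte_fin ltrD2r -!EFinB.
  by have -> : b - m - (a - m) = b - a by ring.
rewrite [RHS](eq_set_function_integral _ _ E).
by rewrite ge0_integral_pushforward.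
Qed.

Lemma ge0_integral_gaussian m s (f : R -> \bar R) :
  measurable_fun setT f -> (forall x, 0 <= f x)%E ->
  (\int[gaussian m s]_x f x =
   \int[line_lebesgue]_x (f x * (normal_pdf m s x)%:E))%E.
Proof.
move=> mf f0; apply: ge0_integral_density => //.
- exact: measurable_normal_pdf.
- by move=> x; exact: normal_pdf_ge0.
- move=> A mA.
  change (gaussian m s A) with (\int[lebesgue_measure]_(x in (A : set (measurableTypeR R))) (normal_pdf m s x)%:E)%E.
  rewrite [LHS]integral_mkcond [RHS]integral_mkcond.
  rewrite (ge0_integral_measurableTypeR lebesgue_measure)//.
  + apply/(measurable_restrictT _ _).1 => //; apply/measurable_EFinP.
    by apply: measurable_funTS; exact: measurable_normal_pdf.
  + by move=> x; rewrite patchE; case: ifP => // _; rewrite lee_fin normal_pdf_ge0.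
Qed.

Lemma normal_pdf_shift m s x : s != 0 -> normal_pdf m s (x + m) = normal_pdf 0 s x.
Proof. by move=> s0; rewrite !normal_pdfE// /normal_fun addrK subr0. Qed.

Lemma ge0_integral_gaussian_shift m s (f : R -> \bar R) : s != 0 ->
  measurable_fun setT f -> (forall x, 0 <= f x)%E ->
  (\int[gaussian m s]_x f x = \int[gaussian 0 s]_x f (x + m)%R)%E.
Proof.
move=> s0 mf f0; rewrite ge0_integral_gaussian// -(ge0_integral_shift m); last 2 first.
- by apply: emeasurable_funM => //; apply/measurable_EFinP; exact: measurable_normal_pdf.
- by move=> x; rewrite mule_ge0// lee_fin normal_pdf_ge0.
have mfm : measurable_fun setT (fun x : R => f (x + m)).
  by apply: measurableT_comp => //; apply: measurable_funD.
apply: etrans (esym (ge0_integral_gaussian 0 s mfm _)); last by move=> x; exact: f0.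
by apply: eq_integral => x _; rewrite normal_pdf_shift.
Qed.

Definition gauss_potential t (x : R) : R := expR (- (t * x ^+ 2 / 2)).

(** Completing the square: the precisions [1 / s ^+ 2] and [t] add up, and the leftover factor is a
    gaussian function of the mean [m]. *)
Lemma normal_pdf_tilt m s t x : 0 < s -> 0 <= t ->
  gauss_potential t x * normal_pdf m s x =
  (Num.sqrt (1 + t * s ^+ 2))^-1 * gauss_potential (t / (1 + t * s ^+ 2)) m *
  normal_pdf (m / (1 + t * s ^+ 2)) (s / Num.sqrt (1 + t * s ^+ 2)) x.
Proof.
move=> s0 t0.
have D0 : 0 < 1 + t * s ^+ 2 by rewrite ltr_wpDr// mulr_ge0// sqr_ge0.
have q0 : 0 < Num.sqrt (1 + t * s ^+ 2) by rewrite sqrtr_gt0.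
rewrite !normal_pdfE; [|by rewrite gt_eqF// divr_gt0|by rewrite gt_eqF].
have -> : normal_peak (s / Num.sqrt (1 + t * s ^+ 2)) = Num.sqrt (1 + t * s ^+ 2) * normal_peak s.
  rewrite /normal_peak exprMn exprVn sqr_sqrtr ?(ltW D0)//.
  have -> : s ^+ 2 / (1 + t * s ^+ 2) * pi *+ 2 = (1 + t * s ^+ 2)^-1 * (s ^+ 2 * pi *+ 2).
    rewrite !mulr2n; field; exact: lt0r_neq0.
  by rewrite sqrtrM ?invr_ge0 ?(ltW D0)// invfM sqrtrV ?(ltW D0)// invrK.
set q := Num.sqrt _ in q0 *; set p := normal_peak s.
rewrite [LHS]mulrCA [RHS](_ : _ = p * (gauss_potential (t / (1 + t * s ^+ 2)) m *
  normal_fun (m / (1 + t * s ^+ 2)) (s / q) x)); last first.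
  by field; exact: lt0r_neq0.
congr (_ * _).
rewrite /gauss_potential /normal_fun -!expRD; congr expR.
rewrite exprMn exprVn /q sqr_sqrtr ?(ltW D0)//.
have sn : s != 0 by rewrite gt_eqF.
have Dn : 1 + t * s ^+ 2 != 0 by rewrite gt_eqF.
field.
by rewrite sn Dn.
Qed.

Lemma ge0_integral_gaussian_tilt m s t (f : R -> R) : 0 < s -> 0 <= t ->
  measurable_fun setT f -> (forall x, 0 <= f x) ->
  (\int[gaussian m s]_x (gauss_potential t x * f x)%:E =
   ((Num.sqrt (1 + t * s ^+ 2))^-1 * gauss_potential (t / (1 + t * s ^+ 2)) m)%:E *
   \int[gaussian (m / (1 + t * s ^+ 2)) (s / Num.sqrt (1 + t * s ^+ 2))]_x (f x)%:E)%E.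
Proof.
move=> s0 t0 mf f0.
have mgp : measurable_fun setT (gauss_potential t).
  apply: measurableT_comp => //; apply: measurableT_comp => //.
  by apply: measurable_funM => //; apply: measurable_funM => //.
rewrite ge0_integral_gaussian; last 2 first.
- by apply/measurable_EFinP; exact: measurable_funM.
- by move=> x; rewrite lee_fin mulr_ge0// expR_ge0.
rewrite ge0_integral_gaussian; last 2 first.
- exact/measurable_EFinP.
- by move=> x; rewrite lee_fin.
rewrite -ge0_integralZl//.
- apply: eq_integral => x _; rewrite -!EFinM mulrAC normal_pdf_tilt//.
  by congr (_%:E); rewrite -!mulrA; do 2 congr (_ * _); rewrite mulrC.
- by apply: emeasurable_funM; apply/measurable_EFinP => //; exact: measurable_normal_pdf.
- by move=> x _; rewrite mule_ge0// lee_fin// normal_pdf_ge0.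
- by rewrite lee_fin mulr_ge0// ?invr_ge0// expR_ge0.
Qed.

End line_measures.

HB.lock Definition gauss (R : realType) (m s : R) : probability R R := gaussian m s.

Section gaussian_expectation.
Context {R : realType}.
Implicit Types (m s t : R) (f : R -> R).

Lemma bm_gauss_potential t : 0 <= t -> bounded_measurable (gauss_potential t).
Proof.
move=> t0; split.
  apply: measurableT_comp => //; apply: measurableT_comp => //.
  by apply: measurable_funM => //; apply: measurable_funM => //.
exists 1 => x; rewrite ger0_norm ?expR_ge0// -[leRHS]expR0 ler_expR oppr_le0.
by rewrite divr_ge0// mulr_ge0// sqr_ge0.
Qed.

Lemma bm_comp_shift m f : bounded_measurable f -> bounded_measurable (fun x : R => f (x + m)).
Proof.
move=> [mf [b fb]]; split; last by exists b => x.
by apply: measurableT_comp => //; apply: measurable_funD.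
Qed.

(* A bounded function becomes nonnegative after adding a constant. *)
Lemma bm_ind (Phi Psi : (R -> R) -> R) :
  (forall f r, bounded_measurable f -> Phi (fun x => f x - r) = Phi f - r * Phi (fun=> 1)) ->
  (forall f r, bounded_measurable f -> Psi (fun x => f x - r) = Psi f - r * Psi (fun=> 1)) ->
  (forall f, bounded_measurable f -> (forall x, 0 <= f x) -> Phi f = Psi f) ->
  forall f, bounded_measurable f -> Phi f = Psi f.
Proof.
move=> PhiB PsiB H f bf; case: (bf) => _ [b fb].
have E1 : Phi (fun=> 1) = Psi (fun=> 1) by apply: H => //; exact: bm_cst.
have bfb : bounded_measurable (fun x => f x + b) by apply: bmD => //; exact: bm_cst.
have fbE : f = (fun x => (f x + b) - b) by apply/funext => x; rewrite addrK.
rewrite fbE PhiB// PsiB// E1 H// => x.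
by have := fb x; rewrite ler_norml -lerBlDr sub0r => /andP[].
Qed.

Lemma expect_gaussian_shift m s f : s != 0 -> bounded_measurable f ->
  expect (gauss m s) f = expect (gauss 0 s) (fun x => f (x + m)).
Proof.
move=> s0; apply: (bm_ind (Phi := expect (gauss m s))
  (Psi := fun f => expect (gauss 0 s) (fun x : R => f (x + m)))) => {}f.
- by move=> r bf; rewrite expectB ?expect_cst ?mulr1//; exact: bm_cst.
- move=> r bf; rewrite (@expectB _ _ _ _ (fun x : R => f (x + m)) (fun=> r)).
  + by rewrite !expect_cst mulr1.
  + exact: bm_comp_shift.
  + exact: bm_cst.
- move=> bf f0; have mf : measurable_fun setT (EFin \o f).
    by apply/measurable_EFinP; case: bf.
  apply: EFin_inj; rewrite -expectE; last exact: bf.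
  rewrite -expectE; last exact: bm_comp_shift.
  rewrite !gauss.unlock.
  by apply: (@ge0_integral_gaussian_shift _ m s (EFin \o f)) => // x; rewrite lee_fin.
Qed.

Lemma expect_gaussian_tilt m s t f : 0 < s -> 0 <= t -> bounded_measurable f ->
  expect (gauss m s) (fun x => gauss_potential t x * f x) =
  (Num.sqrt (1 + t * s ^+ 2))^-1 * gauss_potential (t / (1 + t * s ^+ 2)) m *
   expect (gauss (m / (1 + t * s ^+ 2)) (s / Num.sqrt (1 + t * s ^+ 2))) f.
Proof.
move=> s0 t0; apply: (bm_ind (Phi := fun f => expect (gauss m s) (fun x : R => gauss_potential t x * f x))
  (Psi := fun f => _ * _ * expect (gauss _ _) f)) => {}f.
- move=> r bf.
  have -> : (fun x => gauss_potential t x * (f x - r)) =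
      (fun x => gauss_potential t x * f x - r * (gauss_potential t x * 1)).
    by apply/funext => x; ring.
  have bg1 : bounded_measurable (fun x : R => gauss_potential t x * 1).
    by apply: bmM; [exact: bm_gauss_potential|exact: bm_cst].
  rewrite expectB ?expectZ//; last by apply: bmM => //; exact: bm_cst.
  by apply: bmM => //; exact: bm_gauss_potential.
- move=> r bf; rewrite expectB//; last exact: bm_cst.
  by rewrite !expect_cst mulr1 mulrBr; congr (_ - _); rewrite mulrC.
- move=> bf f0; apply: EFin_inj; rewrite EFinM -expectE; last first.
    by apply: bmM => //; exact: bm_gauss_potential.
  rewrite -expectE; last exact: bf.
  rewrite !gauss.unlock.
  apply: ge0_integral_gaussian_tilt; [exact: s0|exact: t0| |exact: f0].
  by case: bf.
Qed.

Lemma gaussian_itv_le m s (a b : R) : s != 0 -> a <= b ->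
  (gauss m s `]a, b]%classic <= (normal_peak s * (b - a))%:E)%E.
Proof.
move=> s0 ab; rewrite gauss.unlock; change (gaussian m s) with (normal_prob m s); rewrite /normal_prob.
apply: (@le_trans _ _ (\int[lebesgue_measure]_(x in `]a, b]) (normal_peak s)%:E)%E).
  apply: ge0_le_integral => //=.
  - by move=> x _; rewrite lee_fin normal_pdf_ge0.
  - by apply/measurable_EFinP; apply: measurable_funTS; exact: measurable_normal_pdf.
  - by move=> x xab; rewrite lee_fin normal_pdf_ub.
rewrite integral_cst//= lebesgue_measure_itv/= lte_fin.
case: ltP => ba; first by rewrite -EFinB -EFinM.
by rewrite mule0 lee_fin mulr_ge0 ?normal_peak_ge0// subr_ge0.
Qed.

End gaussian_expectation.

(** * Probability measures obtained by tilting, finite sums and mutation *)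

Section constructions.
Context d (T : measurableType d) {R : realType}.

Section of_measure.
Variables (m : {measure set T -> \bar R}) (m1 : m setT = 1%E).

Let of_measure (A : set T) : \bar R := m A.

HB.instance Definition _ := Measure.copy of_measure m.
HB.instance Definition _ := @Measure_isProbability.Build _ T R of_measure m1.

Lemma probability_of_measure : exists P : probability T R, forall A, P A = m A.
Proof. by exists (of_measure : probability T R). Qed.

End of_measure.

(** Of the linearity of [L] only the subtraction of constants is required, because a bounded
    function plus a constant is nonnegative. *)
Lemma expect_eqP (P : probability T R) (L : (T -> R) -> R) :
  (forall f r, bounded_measurable f -> L (fun x => f x - r) = L f - r * L (fun=> 1)) ->
  (forall f, bounded_measurable f -> (forall x, 0 <= f x) ->
    (\int[P]_x (f x)%:E = (L f)%:E)%E) ->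
  forall f, bounded_measurable f -> expect P f = L f.
Proof.
move=> LB H f bf; case: (bf) => _ [b fb].
have E1 : L (fun=> 1) = 1.
  by apply: EFin_inj; rewrite -H// ?expectE ?expect_cst//; exact: bm_cst.
have bfb : bounded_measurable (fun x => f x + b) by apply: bmD => //; exact: bm_cst.
have fbE : f = (fun x => (f x + b) - b) by apply/funext => x; rewrite addrK.
rewrite fbE expectB//; last exact: bm_cst.
rewrite LB// E1 mulr1 expect_cst; congr (_ - _).
apply: EFin_inj; rewrite -H ?expectE// => x.
by have := fb x; rewrite ler_norml -lerBlDr sub0r => /andP[].
Qed.

(** The update step of the filter. The values on sets serve the comparison with the definitions of
    the statement, the expectations serve all later estimates. *)
Lemma tilt_ex (mu : probability T R) (G : T -> R) :
  bounded_measurable G -> (forall x, 0 < G x) ->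
  exists nu : probability T R,
    (forall A, measurable A -> nu A = (\int[mu]_(x in A) (G x)%:E / \int[mu]_x (G x)%:E)%E) /\
    forall f, bounded_measurable f ->
      expect nu f = expect mu (fun x => G x * f x) / expect mu G.
Proof.
move=> bG G0.
have [mG _] := bG.
have mGE : measurable_fun setT (EFin \o G) by exact/measurable_EFinP.
have g0 : 0 < (expect mu G)^-1 by rewrite invr_gt0 expect_gt0.
have GE0 x : (0 <= (G x)%:E)%E by rewrite lee_fin ltW.
pose nu A := (((expect mu G)^-1)%:E * \int[mu]_(x in A) (G x)%:E)%E.
have nu0 : nu set0 = 0%E by rewrite /nu integral_set0 mule0.
have nu_ge0 A : (0 <= nu A)%E.
  by rewrite /nu mule_ge0//; [rewrite lee_fin ltW|exact: integral_ge0].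
have nu_sig : semi_sigma_additive nu.
  move=> F mF tF mUF; rewrite /nu/= integral_bigcup//=; last first.
    by apply: (integrableS measurableT) => //; exact: (bm_integrable mu bG).
  rewrite [X in X @ _ --> _](_ : _ = (fun n => ((expect mu G)^-1)%:E *
    \sum_(0 <= i < n) \int[mu]_(x in F i) (G x)%:E)%E); last first.
    by apply/funext => n; rewrite ge0_sume_distrr// => i _; exact: integral_ge0.
    apply: cvgeZl => //.
  apply: is_cvg_ereal_nneg_natsum_cond => n _ _.
  by apply: integral_ge0.
pose nuM : {measure set T -> \bar R} :=
  HB.pack nu (isMeasure.Build _ T R nu nu0 nu_ge0 nu_sig).
have nuT : nuM setT = 1%E.
  by rewrite /nuM/= /nu expectE// -EFinM mulVf// gt_eqF// -invr_gt0.
have [P PE] := probability_of_measure nuT.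
have PG A : measurable A -> P A = (\int[mu]_(x in A) (((expect mu G)^-1 * G x))%:E)%E.
  move=> mA; rewrite PE/= /nu -ge0_integralZl//; last by rewrite lee_fin ltW.
  exact: measurable_funTS.
exists P; split.
  move=> A mA; rewrite PE/= /nu expectE// muleC inver.
  by rewrite ifN// gt_eqF// expect_gt0.
apply: expect_eqP.
  move=> f r bf; rewrite mulrA -mulrBl; congr (_ / _).
  have -> : (fun x => G x * (f x - r)) = (fun x => G x * f x - r * (G x * 1)).
    by apply/funext => x; ring.
  have bG1 : bounded_measurable (fun x => G x * 1) by apply: bmM => //; exact: bm_cst.
  rewrite expectB ?expectZ//; last by apply: bmM => //; exact: bm_cst.
  exact: bmM.
move=> f bf f0; have [mf _] := bf.
rewrite (ge0_integral_density (mu := mu) (g := fun x => (expect mu G)^-1 * G x))//.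
- rewrite mulrC EFinM -expectE; last exact: bmM.
  rewrite -ge0_integralZl//.
  + by apply: eq_integral => x _; rewrite -!EFinM; congr EFin; ring.
  + by apply/measurable_EFinP; exact: measurable_funM.
  + by move=> x _; rewrite lee_fin mulr_ge0// ltW.
  + by rewrite lee_fin ltW.
- exact: measurable_funM.
- by move=> x; rewrite mulr_ge0// ltW.
- exact/measurable_EFinP.
Qed.

Lemma weighted_sum_ex (I : Type) (s : seq I) (w : I -> R) (x : I -> T) :
  (forall i, 0 <= w i) ->
  exists m : {measure set T -> \bar R},
    (forall A, m A = \sum_(i <- s) (w i)%:E * \d_(x i) A)%E /\
    forall f : T -> R, measurable_fun setT f -> (forall x, 0 <= f x) ->
      (\int[m]_x (f x)%:E = \sum_(i <- s) (w i * f (x i))%:E)%E.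
Proof.
move=> w0; elim: s => [|i s [m [mE mI]]].
  exists mzero; split => [A|f mf f0]; rewrite big_nil//.
  by rewrite integral_measure_zero.
exists (measure_add (mscale (NngNum (w0 i)) \d_(x i)) m); split => [A|f mf f0].
  by rewrite [LHS]measure_addE big_cons mE.
have mfE : measurable_fun setT (EFin \o f) by exact/measurable_EFinP.
rewrite ge0_integral_measure_add//; last by move=> y _; rewrite lee_fin.
rewrite big_cons mI//; congr (_ + _)%E.
rewrite ge0_integral_mscale//; last by move=> y _; rewrite lee_fin.
by rewrite integral_dirac// diracT mul1e.
Qed.

Lemma weighted_ex (N : nat) (w : 'I_N -> R) (x : 'I_N -> T) :
  (forall i, 0 <= w i) -> \sum_i w i = 1 ->
  exists P : probability T R,
    (forall A, P A = \sum_i (w i)%:E * \d_(x i) A)%E /\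
    forall f, bounded_measurable f -> expect P f = \sum_i w i * f (x i).
Proof.
move=> w0 w1; have [m [mE mI]] := weighted_sum_ex (index_enum 'I_N) x w0.
have m1 : m setT = 1%E.
  by rewrite mE; under eq_bigr do rewrite diracT mule1; rewrite sumEFin w1.
have [P PE] := probability_of_measure m1.
exists P; split => [A|]; first by rewrite PE mE.
apply: expect_eqP => [f r bf|f [mf _] f0].
  rewrite mulr_sumr -sumrB; apply: eq_bigr => i _; ring.
by rewrite (eq_set_function_integral _ _ (fun A _ => PE A)) mI// sumEFin.
Qed.

End constructions.

Section mutation.
Context {R : realType}.

Definition mutate (rho sigma : R) (f : R -> R) (z : R) : R :=
  expect (gauss (rho * z) sigma) f.

(** After a translation the gaussian no longer depends on [z], so that Fubini-Tonelli applies to a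
    jointly measurable integrand; adding a constant reduces to nonnegative functions. *)
Lemma measurable_mutate rho sigma f : sigma != 0 -> bounded_measurable f ->
  measurable_fun setT (mutate rho sigma f).
Proof.
move=> s0; have mut_shift g : bounded_measurable g ->
    mutate rho sigma g = (fun z => expect (gauss 0 sigma) (fun x : R => g (x + rho * z))).
  by move=> bg; apply/funext => z; rewrite /mutate expect_gaussian_shift.
have key g : bounded_measurable g -> (forall x, 0 <= g x) ->
    measurable_fun setT (mutate rho sigma g).
  move=> bg g0; apply/measurable_EFinP; rewrite mut_shift//.
  rewrite (_ : _ \o _ = (fun z => \int[gauss 0 sigma]_x (g (x + rho * z))%:E)%E); last first.
    by apply/funext => z /=; rewrite expectE//; exact: bm_comp_shift.
  apply: (@measurable_fun_fubini_tonelli_F _ _ _ _ _ (gauss 0 sigma)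
    (fun zx : R * R => (g (zx.2 + rho * zx.1))%:E)).
  - apply/measurable_EFinP; apply: measurableT_comp; first by case: bg.
    apply: measurable_funD => //.
    by apply: measurable_funM.
  - by move=> zx; rewrite lee_fin.
move=> bf; have [_ [b fb]] := bf.
have bfb : bounded_measurable (fun x => f x + b) by apply: bmD => //; exact: bm_cst.
have -> : mutate rho sigma f = (fun z => mutate rho sigma (fun x => f x + b) z - b).
  apply/funext => z; rewrite /mutate expectD//; last exact: bm_cst.
  by rewrite expect_cst addrK.
apply: measurable_funB => //; apply: key => // x.
by have := fb x; rewrite ler_norml -lerBlDr sub0r => /andP[].
Qed.

Lemma bm_mutate rho sigma f : sigma != 0 -> bounded_measurable f ->
  bounded_measurable (mutate rho sigma f).
Proof.
move=> s0 bf; split; first exact: measurable_mutate.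
by have [_ [b fb]] := bf; exists b => z; exact: expect_norm_le.
Qed.

(** The measure is the bind of the Giry monad, applied to [mu] and the gaussian kernel. *)
Lemma mutated_ex rho sigma (mu : probability R R) : sigma != 0 ->
  exists nu : probability R R,
    (forall A, measurable A -> nu A = \int[mu]_x gauss (rho * x) sigma A)%E /\
    forall f, bounded_measurable f -> expect nu f = expect mu (mutate rho sigma f).
Proof.
move=> s0; pose k (z : R) : giry R R := gauss (rho * z) sigma.
have mk : measurable_fun setT k.
  apply: measurable_giry_codensity => // B mB.
  have := measurable_mutate rho s0 (bm_indic mB).
  move=> /measurable_EFinP; apply: eq_measurable_fun => z _ /=.
  by rewrite /mutate expect_indic// fineK// fin_num_measure.
pose m := giry_bind mu mk.
have mE A : measurable A -> m A = (\int[mu]_x gauss (rho * x) sigma A)%E.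
  move=> mA; have := giry_int_bind mu mk (h := fun x => (\1_A x)%:E).
  rewrite /giry_int integral_indic// setIT => ->.
  - by apply: eq_integral => z _; rewrite integral_indic// setIT.
  - by apply/measurable_EFinP; exact: measurable_indic.
  - by move=> x; rewrite lee_fin.
have m1 : m setT = 1%E.
  rewrite mE//; under eq_integral do rewrite probability_setT.
  by rewrite (expectE mu (bm_cst _ 1)) expect_cst.
have [P PE] := probability_of_measure m1.
exists P; split => [A mA|]; first by rewrite PE mE.
apply: expect_eqP => [f r bf|f bf f0].
  rewrite (_ : mutate _ _ (fun x => f x - r) = (fun z => mutate rho sigma f z - r)); last first.
    apply/funext => z; rewrite /mutate expectB//; last exact: bm_cst.
    by rewrite expect_cst.
  rewrite expectB; [|exact: bm_mutate|exact: bm_cst].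
  rewrite (_ : mutate _ _ (fun=> 1) = fun=> 1) ?expect_cst ?mulr1//.
  by apply/funext => z; rewrite /mutate expect_cst.
rewrite (eq_set_function_integral _ _ (fun A _ => PE A)).
have := giry_int_bind mu mk (h := fun x => (f x)%:E).
rewrite /giry_int => ->.
- rewrite -expectE; last exact: bm_mutate.
  by apply: eq_integral => z _; rewrite expectE.
- by apply/measurable_EFinP; case: bf.
- by move=> x; rewrite lee_fin.
Qed.

End mutation.

(** * Kolmogorov distance and bounded variation *)

Section kolmogorov.
Context {R : realType}.
Implicit Types (mu nu : probability R R) (f g h : R -> R) (D V W : R).

Definition cdf_close mu nu D :=
  forall a : R, `|fine (mu `]-oo, a]%classic) - fine (nu `]-oo, a]%classic)| <= D.

Lemma probability_fin mu (A : set R) : measurable A -> mu A = (fine (mu A))%:E.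
Proof. by move=> mA; rewrite fineK// fin_num_measure. Qed.

Lemma cvg_cdf_left mu (a : R) :
  fine (mu `]-oo, a - n.+1%:R^-1]%classic) @[n --> \oo] --> fine (mu `]-oo, a[%classic).
Proof.
apply: fine_cvg; rewrite -probability_fin//.
have -> : `]-oo, a[%classic = \bigcup_n `]-oo, a - n.+1%:R^-1]%classic.
  apply/seteqP; split => x /=; rewrite ?in_itv/=.
    move=> xa; have ax : 0 < a - x by rewrite subr_gt0.
    exists (Num.truncn (a - x)^-1) => //=; rewrite in_itv/= lerBrDr -lerBrDl.
    by rewrite invf_ple ?posrE// ltW// truncnS_gt.
  by move=> [n _ /=]; rewrite !in_itv/= => /le_lt_trans; apply; rewrite ltrBlDr ltrDl invr_gt0.
apply: nondecreasing_cvg_mu => //; first exact: bigcup_measurable.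
move=> n m nm; apply/subsetPset; apply: subset_itvl; rewrite bnd_simp.
by rewrite lerD2l lerN2 lef_pV2 ?posrE// ler_nat.
Qed.

Lemma cdf_close_left mu nu D a : cdf_close mu nu D ->
  `|fine (mu `]-oo, a[%classic) - fine (nu `]-oo, a[%classic)| <= D.
Proof.
move=> H.
have C : `|fine (mu `]-oo, a - n.+1%:R^-1]%classic) -
    fine (nu `]-oo, a - n.+1%:R^-1]%classic)| @[n --> \oo] -->
    `|fine (mu `]-oo, a[%classic) - fine (nu `]-oo, a[%classic)|.
  by apply: cvg_norm; apply: cvgB; exact: cvg_cdf_left.
rewrite -(cvg_lim _ C)//; apply: limr_le; first by apply/cvg_ex; eexists; exact: C.
by apply: nearW => n; exact: H.
Qed.

(** A set closed downwards is empty, the whole line, or a closed or open ray ending at its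
    supremum. *)
Lemma cdf_close_downset mu nu D (L : set R) : 0 <= D -> cdf_close mu nu D ->
  (forall x y, x <= y -> L y -> L x) ->
  `|fine (mu L) - fine (nu L)| <= D.
Proof.
move=> D0 H dL.
have [->|/set0P[x0 Lx0]] := eqVneq L set0; first by rewrite !measure0 subrr normr0.
have [bL|nbL] := pselect (has_ubound L); last first.
  have -> : L = setT.
    rewrite -subTset => x _; apply: contrapT => nLx; apply: nbL; exists x => y Ly.
    by rewrite leNgt; apply/negP => /ltW xy; apply: nLx; exact: dL Ly.
  by rewrite !probability_setT subrr normr0.
have hL : has_sup L by split => //; exists x0.
have [Ls|nLs] := pselect (L (sup L)).
  have -> : L = `]-oo, sup L]%classic.
    apply/seteqP; split => x /=; rewrite in_itv/=; first exact: ub_le_sup.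
    by move=> xs; exact: dL Ls.
  exact: H.
have -> : L = `]-oo, sup L[%classic.
  apply/seteqP; split => x /=; rewrite in_itv/=.
    move=> Lx; rewrite lt_neqAle ub_le_sup// andbT.
    by apply/eqP => xs; apply: nLs; rewrite -xs.
  move=> xs; have [e Le xe] := sup_gt (ex_intro _ x0 Lx0) xs.
  exact: dL (ltW xe) Le.
exact: cdf_close_left.
Qed.

(** Layer cake formula: the expectation integrates the probabilities of [f > r] over [r >= 0]. The
    sets where [f <= r] are closed downwards, so these probabilities differ by at most [D], and they
    vanish for [r > m]. *)
Lemma expect_monotone_le mu nu D f m : 0 <= D -> cdf_close mu nu D ->
  measurable_fun setT f -> {homo f : x y / x <= y} ->
  (forall x, 0 <= f x <= m) -> expect mu f <= expect nu f + m * D.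
Proof.
move=> D0 H mf hf fm.
have f0 x : 0 <= f x by have /andP[] := fm x.
have bf : bounded_measurable f.
  by split => //; exists m => x; rewrite ger0_norm//; have /andP[] := fm x.
have m0 : 0 <= m by have /andP[/le_trans h /h] := fm 0.
pose X : {mfun R >-> R} := HB.pack f (isMeasurableFun.Build _ _ _ _ f mf).
have layer (P : probability R R) : ((expect P f)%:E =
    \int[lebesgue_measure]_(r in `[0%R, +oo[) ccdf (X : {RV P >-> R}) r)%E.
  by rewrite -ge0_expectation_ccdf// -expectE// expectation_def.
have mccdf (P : probability R R) :
    measurable_fun (`[0%R, +oo[%classic : set (measurableTypeR R)) (fun r : measurableTypeR R => ccdf (X : {RV P >-> R}) r).
  by apply: measurable_funTS; exact: ccdf_measurable.
have ccdfE (P : probability R R) r : ccdf (X : {RV P >-> R}) r =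
    (1 - fine (P [set x | f x <= r]))%:E.
  rewrite ccdf_1_cdf EFinB; congr (_ - _)%E.
  rewrite /cdf /distribution /pushforward -probability_fin.
    by congr (P _); apply/seteqP; split => x /=; rewrite in_itv.
  rewrite -[X in measurable X]setTI (_ : [set x | _] = f @^-1` `]-oo, r]%classic); first exact: (mf measurableT).
  by apply/seteqP; split => x /=; rewrite in_itv.
have mind : measurable_fun (`[0%R, +oo[%classic : set (measurableTypeR R)) (fun r : measurableTypeR R => (D * \1_(`[0%R, m]%classic : set (measurableTypeR R)) r)%:E).
  apply/measurable_EFinP; apply: measurable_funTS.
  by apply: measurable_funM => //; exact: measurable_indic.
have ind0 (r : R) : (0 <= (D * \1_(`[0, m]%classic : set R) r)%:E)%E.
  by rewrite lee_fin mulr_ge0.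
rewrite -lee_fin EFinD !layer.
have -> : (m * D)%:E = (\int[lebesgue_measure]_(r in `[0%R, +oo[) (D * \1_(`[0%R, m]%classic : set (measurableTypeR R)) r)%:E)%E.
  under eq_integral do rewrite EFinM.
  rewrite ge0_integralZl//; last exact/measurable_EFinP/measurable_funTS/measurable_indic.
  rewrite integral_indic// setIidl; last by apply: subset_itvl; rewrite bnd_simp.
  rewrite /= lebesgue_measure_itv/= lte_fin; have [m_gt0|] := ltP 0 m; first by rewrite sube0 -EFinM mulrC.
  by move=> mle0; rewrite mule0 (_ : m = 0) ?mul0r//; apply/eqP; rewrite eq_le mle0.
rewrite -ge0_integralD//.
apply: ge0_le_integral => //.
- exact: emeasurable_funD.
move=> r; rewrite /= in_itv/= andbT => r0.
rewrite !ccdfE -EFinD lee_fin indicE.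
case: (boolP (r \in _)) => rm.
  rewrite mulr1 -lerBlDl opprD addrACA subrr add0r opprK addrC.
  apply: le_trans (ler_norm _) _; rewrite distrC; apply: cdf_close_downset => // x y xy /=.
  by apply: le_trans; exact: hf.
rewrite mulr0 addr0.
have -> : [set x | f x <= r] = setT.
  rewrite -subTset => x _ /=; move: rm; rewrite notin_setE/= in_itv/= r0/= => /negP.
  by rewrite -ltNge => /ltW; apply: le_trans; have /andP[] := fm x.
by rewrite !probability_setT.
Qed.

Lemma cdf_closeC mu nu D : cdf_close mu nu D -> cdf_close nu mu D.
Proof. by move=> H a; rewrite distrC. Qed.

Lemma expect_monotone_close mu nu D f m : 0 <= D -> cdf_close mu nu D ->
  measurable_fun setT f -> {homo f : x y / x <= y} ->
  (forall x, 0 <= f x <= m) -> `|expect mu f - expect nu f| <= m * D.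
Proof.
move=> D0 H mf hf fm; 
have H1 := expect_monotone_le D0 H mf hf fm.
have H2 := expect_monotone_le D0 (cdf_closeC H) mf hf fm.
by rewrite ler_norml; apply/andP; split; lra.
Qed.

(* [g] plays the role of the total variation of [f] on [-oo, x]. *)
Definition bounded_variation f V := exists g : R -> R,
  [/\ measurable_fun setT g,
      forall x y, x <= y -> `|f y - f x| <= g y - g x &
      forall x, 0 <= g x <= V].

(** Jordan decomposition [f = (f + g) - g] into nondecreasing functions. Up to a constant [f + g]
    has values in [[0, 3 V]], and [g] has values in [[0, V]], whence the factor 4. *)
Lemma expect_bv_close mu nu D f V : 0 <= D -> cdf_close mu nu D ->
  bounded_measurable f -> bounded_variation f V ->
  `|expect mu f - expect nu f| <= 4 * V * D.
Proof.
move=> D0 H bf [g [mg fg gV]].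
have [mf _] := bf.
have gm x y : x <= y -> g x <= g y.
  by move=> xy; rewrite -subr_ge0 (le_trans _ (fg x y xy)).
have bg : bounded_measurable g.
  by split => //; exists V => x; have /andP[g0 gl] := gV x; rewrite ger0_norm.
have fosc x : `|f x - f 0| <= V.
  have [x0|/ltW x0] := leP 0 x.
    apply: le_trans (fg _ _ x0) _; have := gV x; have := gV 0; lra.
  rewrite distrC; apply: le_trans (fg _ _ x0) _; have := gV x; have := gV 0; lra.
pose h x := f x + g x + (V - f 0).
have hE (P : probability R R) : expect P h = expect P f + expect P g + (V - f 0).
  rewrite /h expectD; [|exact: bmD|exact: bm_cst].
  by rewrite expectD// expect_cst.
have h1 : `|expect mu h - expect nu h| <= 3 * V * D.
  apply: expect_monotone_close => //.
  - by apply: measurable_funD => //; exact: measurable_funD.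
  - move=> x y xy; rewrite /h lerD2r; have := fg x y xy; rewrite ler_norml; lra.
  - move=> x; rewrite /h; have := fosc x; have := gV x; rewrite ler_norml; lra.
have h2 := expect_monotone_close D0 H mg gm gV.
rewrite (_ : expect mu f - expect nu f = (expect mu h - expect nu h) - (expect mu g - expect nu g)); last by rewrite !hE; ring.
apply: le_trans (ler_normB _ _) _.
rewrite (_ : 4 * V * D = 3 * V * D + V * D); last by ring.
exact: lerD.
Qed.

Lemma bounded_variationM f h a b V W : 0 <= a -> 0 <= b ->
  (forall x, `|f x| <= a) -> (forall x, `|h x| <= b) ->
  bounded_variation f V -> bounded_variation h W ->
  bounded_variation (fun x => f x * h x) (b * V + a * W).
Proof.
move=> a0 b0 fa hb [g [mg fg gV]] [k [mk hk kW]].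
exists (fun x => b * g x + a * k x); split.
- by apply: measurable_funD; apply: measurable_funM.
- move=> x y xy.
  rewrite (_ : _ - _ = h x * (f y - f x) + f y * (h y - h x)); last by ring.
  rewrite [leRHS](_ : _ = b * (g y - g x) + a * (k y - k x)); last by ring.
  by apply: le_trans (ler_normD _ _) _; rewrite !normrM lerD// ler_pM// ?fg ?hk.
- move=> x; have /andP[g0 gl] := gV x; have /andP[k0 kl] := kW x.
  by rewrite addr_ge0 ?mulr_ge0//= lerD// ler_wpM2l.
Qed.

Lemma bounded_variation_halfline (a : R) : bounded_variation \1_(`]-oo, a]%classic : set R) 1.
Proof.
exists (fun x => 1 - \1_(`]-oo, a]%classic : set R) x); split.
- by apply: measurable_funB => //; exact: measurable_indic.
- move=> x y xy; rewrite !indicE.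
  case: (boolP (y \in _)) => ya; case: (boolP (x \in _)) => xa; rewrite ?subrr ?normr0//=.
  + by move: xa ya; rewrite notin_setE inE/= !in_itv/= => xa /(le_trans xy).
  + by rewrite sub0r normrN1 !subr0.
- by move=> x; rewrite indicE; case: (_ \in _); rewrite ?subrr ?subr0 lexx ler01.
Qed.

Lemma gauss_potential_le t (x y : R) : 0 <= t -> `|x| <= `|y| ->
  gauss_potential t y <= gauss_potential t x.
Proof.
move=> t0 xy; rewrite ler_expR lerN2 ler_pM2r ?invr_gt0// ler_wpM2l//.
by rewrite -(real_normK (num_real x)) -(real_normK (num_real y)) lerXn2r// nnegrE.
Qed.

Lemma gauss_potential_le1 t (x : R) : 0 <= t -> gauss_potential t x <= 1.
Proof.
move=> t0; rewrite -[leRHS]expR0 ler_expR oppr_le0.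
by rewrite divr_ge0// mulr_ge0// sqr_ge0.
Qed.

(** The potential increases up to the value 1 at 0 and decreases afterwards; the witness accumulates
    the rise and then the fall. *)
Lemma bounded_variation_gauss_potential t : 0 <= t ->
  bounded_variation (gauss_potential t) 2.
Proof.
move=> t0.
have p0 x : 0 < gauss_potential t x by exact: expR_gt0.
have p1 x := gauss_potential_le1 x t0.
exists (fun x => if x <= 0 then gauss_potential t x else 2 - gauss_potential t x); split.
- apply: measurable_fun_if => //.
  + exact: measurable_fun_ler.
  + by apply: measurable_funTS; have [] := bm_gauss_potential t0.
  + by apply: measurable_funTS; apply: measurable_funB => //; have [] := bm_gauss_potential t0.
- move=> x y xy; case: (leP y 0) => y0; case: (leP x 0) => x0.
  + rewrite ger0_norm// subr_ge0 gauss_potential_le// !ler0_norm//; lra.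
  + by have := lt_le_trans x0 (le_trans xy y0); rewrite ltxx.
  + rewrite ler_norml; have := p1 x; have := p1 y; lra.
  + have : gauss_potential t y <= gauss_potential t x.
      by apply: gauss_potential_le => //; rewrite !gtr0_norm//.
    by rewrite distrC => h; rewrite ger0_norm ?subr_ge0//; lra.
- by move=> x; have := p0 x; have := p1 x; case: ifP => _; lra.
Qed.

(** The weight is chosen because [(1 + |x|) ^- 2] is the derivative of the bounded function
    [x / (1 + |x|)]: a Lipschitz function times the potential then has finite variation. It follows
    from [1 + u <= expR u]. *)
Lemma gauss_potential_decay t c (x : R) : 0 < c -> c <= t ->
  gauss_potential t x * (1 + `|x|) ^+ 2 <= 2 + 4 / c.
Proof.
move=> c0 ct.
have e1 : 1 + c * x ^+ 2 / 2 <= expR (t * x ^+ 2 / 2).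
  apply: le_trans (expR_ge1Dx _); by rewrite lerD2l ler_pM2r ?invr_gt0// ler_wpM2r// sqr_ge0.
have d0 : 0 < 1 + c * x ^+ 2 / 2.
  by rewrite ltr_wpDr// divr_ge0// mulr_ge0// ?sqr_ge0// ltW.
rewrite /gauss_potential expRN mulrC ler_pdivrMr ?expR_gt0//.
apply: le_trans (ler_wpM2l _ e1); last by rewrite addr_ge0// divr_ge0// ltW.
have -> : (2 + 4 / c) * (1 + c * x ^+ 2 / 2) = 2 + 2 * x ^+ 2 + c * x ^+ 2 + 4 / c.
  by field; exact: lt0r_neq0.
have : (1 + `|x|) ^+ 2 <= 2 + 2 * x ^+ 2.
  rewrite -(real_normK (num_real x)); have := sqr_ge0 (1 - `|x|); nra.
have h1 : 0 <= c * x ^+ 2 by rewrite mulr_ge0 ?sqr_ge0// ltW.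
have h2 : 0 <= 4 / c by rewrite divr_ge0// ltW.
by move=> h; lra.
Qed.

(* On [0 <= x <= y], writing [p] for the potential,
   [(p x - p y) x + p y (y - x) = 2 p y (y - x) - (y p y - x p x)],
   and [p y (y - x)] is at most [K (y / (1 + y) - x / (1 + x))]. *)
Lemma bounded_variation_gauss_lipschitz t c (psi : R -> R) (L : R) :
  0 < c -> c <= t -> 0 <= L -> measurable_fun setT psi ->
  (forall x y, `|psi y - psi x| <= L * `|y - x|) ->
  bounded_variation (fun x => gauss_potential t x * (psi x - psi 0))
    (6 * (2 + 4 / c) * L).
Proof.
move=> c0 ct L0 mpsi psiL; set K := 2 + 4 / c.
set p := gauss_potential t.
have t0 : 0 <= t by apply: le_trans ct; exact: ltW.
have K0 : 0 <= K by rewrite addr_ge0// divr_ge0// ltW.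
have pK x : p x * (1 + `|x|) ^+ 2 <= K by exact: gauss_potential_decay.
have p0 x : 0 <= p x by exact: expR_ge0.
have xp x : `|x * p x| <= K.
  apply: le_trans (pK x); rewrite normrM (ger0_norm (p0 x)) mulrC ler_wpM2l//.
  have := normr_ge0 x; nra.
pose u (x : R) := x / (1 + `|x|).
have d0 (x : R) : 0 < 1 + `|x| by rewrite ltr_wpDr.
have u1 x : `|u x| <= 1.
  by rewrite normrM normfV (gtr0_norm (d0 x)) ler_pdivrMr// mul1r lerDr.
have mp : measurable_fun setT p by have [] := bm_gauss_potential t0.
(* [u] and [x * p x] are bounded by 1 and [K], so the shift by [3 * K] puts [g] between 0 and
   [6 * K * L]. *)
pose g x := L * (2 * K * u x - x * p x + 3 * K).
have pN x : p (- x) = p x by rewrite /p /gauss_potential sqrrN.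
have core x y : 0 <= x -> x <= y ->
    L * ((p x - p y) * x + p y * (y - x)) <= g y - g x.
  move=> x0 xy; have y0 := le_trans x0 xy.
  rewrite /g -mulrBr ler_wpM2l//.
  rewrite (_ : _ + p y * (y - x) = 2 * (p y * (y - x)) - (y * p y - x * p x)); last by ring.
  rewrite [leRHS](_ : _ = 2 * (K * (u y - u x)) - (y * p y - x * p x)); last by ring.
  rewrite lerD2r ler_wpM2l//.
  have dx : 0 < 1 + x by rewrite ltr_wpDr.
  have dy : 0 < 1 + y by rewrite ltr_wpDr.
  have -> : u y - u x = (y - x) / ((1 + x) * (1 + y)).
    rewrite /u !ger0_norm//; field.
    by rewrite !lt0r_neq0.
  rewrite [leRHS]mulrA (mulrC K) -mulrA [p y * _]mulrC ler_wpM2l ?subr_ge0//.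
  rewrite ler_pdivlMr ?mulr_gt0//; apply: le_trans (pK y).
  rewrite ler_wpM2l// (ger0_norm y0) expr2 ler_pM2r// lerD2l//.
(* This reflection transfers the estimate from the positive half-line to the negative one. *)
have gN x : g (- x) = - g x + 6 * K * L.
  by rewrite /g pN /u normrN; field; exact: lt0r_neq0.
have psi0 x : `|psi x - psi 0| <= L * `|x| by have := psiL 0 x; rewrite subr0.
have pos x y : 0 <= x -> x <= y ->
   `|p y * (psi y - psi 0) - p x * (psi x - psi 0)| <= g y - g x.
  move=> x0 xy; apply: le_trans (core _ _ x0 xy).
  have pxy : 0 <= p x - p y.
    by rewrite subr_ge0 gauss_potential_le// !ger0_norm//; apply: le_trans xy.
  rewrite (_ : _ - _ = p y * (psi y - psi x) - (p x - p y) * (psi x - psi 0)); last by ring.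
  apply: le_trans (ler_normB _ _) _; rewrite !normrM (ger0_norm (p0 y)) (ger0_norm pxy).
  rewrite mulrDr addrC lerD// mulrCA ler_wpM2l//.
    by apply: le_trans (psi0 x) _; rewrite ger0_norm.
  by apply: le_trans (psiL _ _) _; rewrite ger0_norm ?subr_ge0.
have neg x y : y <= 0 -> x <= y ->
   `|p y * (psi y - psi 0) - p x * (psi x - psi 0)| <= g y - g x.
  move=> y0 xy; have H : g y - g x = g (- x) - g (- y) by rewrite !gN; ring.
  rewrite H; apply: le_trans (core (- y) (- x) _ _); rewrite ?oppr_ge0 ?lerN2// !pN.
  have pxy : 0 <= p y - p x.
    by rewrite subr_ge0 gauss_potential_le// !ler0_norm ?lerN2//; apply: le_trans xy _.
  rewrite (_ : _ - _ = p x * (psi y - psi x) + (p y - p x) * (psi y - psi 0)); last by ring.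
  apply: le_trans (ler_normD _ _) _; rewrite !normrM (ger0_norm (p0 x)) (ger0_norm pxy).
  rewrite mulrDr addrC lerD// mulrCA ler_wpM2l//.
    by apply: le_trans (psi0 y) _; rewrite ler0_norm.
  by apply: le_trans (psiL _ _) _; rewrite ger0_norm ?subr_ge0// opprK addrC.
exists g; split.
- apply: measurable_funM => //; apply: measurable_funD => //; apply: measurable_funB.
    apply: measurable_funM => //; apply: continuous_measurable_fun => x.
    apply: cvgM; first exact: cvg_id.
    apply: cvgV; first by rewrite lt0r_neq0.
    by apply: cvgD; [exact: cvg_cst|exact: cvg_norm].
  by apply: measurable_funM.
- move=> x y xy; have [x0|x0] := leP 0 x; first exact: pos.
  have [y0|y0] := leP y 0; first exact: neg.
  have := pos 0 y (lexx _) (ltW y0); have := neg x 0 (lexx _) (ltW x0).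
  rewrite subrr mulr0 sub0r subr0 normrN => h1 h2.
  apply: le_trans (ler_normB _ _) _.
  by rewrite (_ : g y - g x = (g y - g 0) + (g 0 - g x)) ?lerD//; ring.
- move=> x; rewrite /g; have := u1 x; have := xp x; rewrite !ler_norml.
  move=> /andP[a1 a2] /andP[b1 b2]; rewrite mulr_ge0//=; last by nra.
  by rewrite [leRHS]mulrC ler_wpM2l//; nra.
Qed.

End kolmogorov.

(** * Stability of the Feynman-Kac flow *)

Section lipschitz_smoothing.
Context {R : realType}.

Definition lipschitz_le (psi : R -> R) (L : R) :=
  forall x y, `|psi y - psi x| <= L * `|y - x|.

(** Synchronous coupling: the gaussians of means [r * x] and [r * y] are translates of the same
    one. *)
Lemma lipschitz_le_mutate r v (psi : R -> R) (L : R) : v != 0 ->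
  bounded_measurable psi -> lipschitz_le psi L ->
  lipschitz_le (mutate r v psi) (L * `|r|).
Proof.
move=> v0 bpsi psiL x y; rewrite /mutate !(expect_gaussian_shift _ v0 bpsi).
rewrite -expectB; [|exact: bm_comp_shift|exact: bm_comp_shift].
apply: expect_norm_le; first by apply: bmB; exact: bm_comp_shift.
move=> z; apply: le_trans (psiL _ _) _.
by rewrite opprD addrACA subrr add0r -mulrBr normrM mulrA.
Qed.

Lemma expect_gaussian_halfline m v (a : R) : v != 0 ->
  expect (gauss m v) \1_(`]-oo, a]%classic : set R) =
  fine (gauss 0 v `]-oo, a - m]%classic).
Proof.
move=> v0; rewrite expect_gaussian_shift//; last exact: bm_indic.
rewrite -expect_indic//; congr expect; apply/funext => x; rewrite !indicE.
by congr (nat_of_bool _)%:R; apply/idP/idP; rewrite !inE/= !in_itv/= lerBrDr.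
Qed.

(** The indicator is not Lipschitz, but one gaussian smoothing makes it so: moving the mean changes
    the mass of a ray by that of an interval, where the density is at most its peak. *)
Lemma lipschitz_le_mutate_halfline r v (a : R) : 0 < v ->
  lipschitz_le (mutate r v \1_(`]-oo, a]%classic : set R)) (normal_peak v * `|r|).
Proof.
move=> v0; have vn : v != 0 by rewrite gt_eqF.
have H m m' : m <= m' -> `|expect (gauss m' v) \1_(`]-oo, a]%classic : set R) -
    expect (gauss m v) \1_(`]-oo, a]%classic : set R)| <= normal_peak v * (m' - m).
  move=> mm'; rewrite !expect_gaussian_halfline// distrC.
  have -> : `]-oo, a - m]%classic = `]-oo, a - m'] `|` `]a - m', a - m] :> set R.
    by rewrite -itv_bndbnd_setU// bnd_simp lerD2l lerN2.
  rewrite measureU//; last first.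
    rewrite -subset0 => x /= []; rewrite !in_itv/= => h1 /andP[h2 _].
    by have := lt_le_trans h2 h1; rewrite ltxx.
  rewrite fineD ?fin_num_measure// addrAC subrr add0r ger0_norm ?fine_ge0//.
  rewrite -lee_fin -probability_fin//.
  apply: le_trans (gaussian_itv_le _ _ _) _ => //; first by rewrite lerD2l lerN2.
  by rewrite lee_fin ler_wpM2l ?normal_peak_ge0//; lra.
move=> x y; rewrite /mutate -mulrA -normrM mulrBr.
have [xy|/ltW xy] := leP (r * x) (r * y).
  by rewrite [X in _ <= _ * X]ger0_norm ?subr_ge0//; exact: H.
by rewrite distrC [X in _ <= _ * X]distrC [X in _ <= _ * X]ger0_norm ?subr_ge0//; exact: H.
Qed.

End lipschitz_smoothing.

(** * Gaussian form of the unnormalised semigroup *)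

Section semigroup.
Context {R : realType}.
Variables (rho sigma c : R).
Hypotheses (sigma_gt0 : 0 < sigma) (c_gt0 : 0 < c).
Let c_ge0 : 0 <= c. Proof. exact: ltW. Qed.
Implicit Types (f : R -> R) (k : nat).

Local Notation G := (gauss_potential c).
Local Notation M := (mutate rho sigma).

(* [T_ k f = (G M)^k (G f)], so that [mu T_ k] is the unnormalised flow of the
   filter started from the predictive distribution [mu]. *)
Fixpoint semigroup k f : R -> R :=
  match k with
  | 0 => fun x => G x * f x
  | k'.+1 => fun x => G x * M (semigroup k' f) x
  end.

(** The Riccati recursion of the Kalman filter in information form: [semigroup k] maps the constant
    1 to a multiple of [gauss_potential (precision k)]. *)
Fixpoint precision k : R :=
  match k with
  | 0 => c
  | k'.+1 => c + precision k' * rho ^+ 2 / (1 + precision k' * sigma ^+ 2)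
  end.

(** With [spread], the slope of the mean and the standard deviation of the mutation kernel after
    tilting by [gauss_potential (precision k)] and normalising. *)
Definition gain k : R := rho / (1 + precision k * sigma ^+ 2).

Definition spread k : R := sigma / Num.sqrt (1 + precision k * sigma ^+ 2).

Fixpoint mass k : R :=
  match k with
  | 0 => 1
  | k'.+1 => mass k' / Num.sqrt (1 + precision k' * sigma ^+ 2)
  end.

Fixpoint smoother k f : R -> R :=
  match k with
  | 0 => f
  | k'.+1 => mutate (gain k') (spread k') (smoother k' f)
  end.

Fixpoint gain_prod k : R :=
  match k with
  | 0 => 1
  | k'.+1 => gain_prod k' * `|gain k'|
  end.

(** The limit of the right-hand side of the recursion when the previous precision tends to
    infinity. *)
Definition precision_max : R := c + rho ^+ 2 / sigma ^+ 2.

Local Notation s_ := precision.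

Lemma precision_ge k : c <= s_ k.
Proof.
elim: k => //= k IH; rewrite lerDl.
have s0 : 0 <= s_ k by apply: le_trans IH.
have d0 : 0 <= 1 + s_ k * sigma ^+ 2 by rewrite addr_ge0// mulr_ge0// sqr_ge0.
by rewrite divr_ge0// mulr_ge0// sqr_ge0.
Qed.

Lemma precision_gt0 k : 0 < s_ k.
Proof. exact: lt_le_trans (precision_ge k). Qed.

Lemma precision_ge0 k : 0 <= s_ k. Proof. exact/ltW/precision_gt0. Qed.

Lemma precision_den k : 0 < 1 + s_ k * sigma ^+ 2.
Proof. by rewrite ltr_wpDr// mulr_ge0 ?sqr_ge0 ?precision_ge0. Qed.

Lemma precision_le k : s_ k <= precision_max.
Proof.
case: k => /= [|k]; first by rewrite lerDl divr_ge0// sqr_ge0.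
rewrite lerD2l ler_pdivrMr ?precision_den//.
have s2 : sigma ^+ 2 != 0 by rewrite expf_neq0// gt_eqF.
have -> : rho ^+ 2 / sigma ^+ 2 * (1 + s_ k * sigma ^+ 2) = rho ^+ 2 / sigma ^+ 2 + s_ k * rho ^+ 2.
  by field; rewrite gt_eqF.
by rewrite lerDr divr_ge0// sqr_ge0.
Qed.

Lemma spread_gt0 k : 0 < spread k.
Proof. by rewrite divr_gt0// sqrtr_gt0 precision_den. Qed.

Lemma spread_neq0 k : spread k != 0. Proof. by rewrite gt_eqF// spread_gt0. Qed.

Lemma spread_sq_le k : spread k ^+ 2 <= sigma ^+ 2.
Proof.
have D0 := precision_den k.
rewrite exprMn exprVn sqr_sqrtr; last exact: ltW.
by rewrite ler_pdivrMr// ler_peMr ?sqr_ge0// lerDl mulr_ge0 ?sqr_ge0 ?precision_ge0.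
Qed.

Lemma mass_gt0 k : 0 < mass k.
Proof. by elim: k => //= k IH; rewrite divr_gt0// sqrtr_gt0 precision_den. Qed.

Lemma bm_smoother k f : bounded_measurable f -> bounded_measurable (smoother k f).
Proof. by move=> bf; elim: k => //= k IH; apply: bm_mutate => //; exact: spread_neq0. Qed.

Lemma bm_semigroup k f : bounded_measurable f -> bounded_measurable (semigroup k f).
Proof.
have bG : bounded_measurable G by apply: bm_gauss_potential; exact: ltW.
move=> bf; elim: k => [|k IH] /=; first exact: bmM.
by apply: bmM => //; apply: bm_mutate => //; rewrite gt_eqF.
Qed.

Lemma smoother1 k : smoother k (fun=> 1) = fun=> 1.
Proof. by elim: k => //= k ->; apply/funext => z; rewrite /mutate expect_cst. Qed.

(** By induction, each mutation of a gaussian potential times a function is computed by completing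
    the square: it yields a new potential, a constant collected in [mass], and a normalised kernel
    collected in [smoother]. *)
Lemma semigroupE k f : bounded_measurable f ->
  semigroup k f = fun x => mass k * (gauss_potential (s_ k) x * smoother k f x).
Proof.
move=> bf; elim: k => [|k IH]; apply/funext => z; first by rewrite /= mul1r.
rewrite /= IH /mutate expectZ; last first.
  by apply: bmM; [apply: bm_gauss_potential; exact/ltW/precision_gt0|exact: bm_smoother].
rewrite expect_gaussian_tilt//; [|exact/ltW/precision_gt0|exact: bm_smoother].
have -> : gauss_potential (c + s_ k * rho ^+ 2 / (1 + s_ k * sigma ^+ 2)) z =
    G z * gauss_potential (s_ k / (1 + s_ k * sigma ^+ 2)) (rho * z).
  by rewrite /gauss_potential -expRD; congr expR; field; rewrite gt_eqF// precision_den.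
rewrite (_ : gain k * z = rho * z / (1 + s_ k * sigma ^+ 2)); last by rewrite mulrAC.
by rewrite -/(spread k); ring.
Qed.

(** An upper bound, from [precision k >= c], of the factor by which each step shrinks the squared
    gain product once the precisions have telescoped. *)
Definition rate : R := (1 + c * sigma ^+ 2)^-1.

Lemma rate_gt0 : 0 < rate.
Proof. by rewrite invr_gt0 ltr_wpDr// mulr_ge0 ?sqr_ge0. Qed.

Lemma rate_ge0 : 0 <= rate. Proof. exact/ltW/rate_gt0. Qed.

Lemma rate_lt1 : rate < 1.
Proof. have h : 0 < c * sigma ^+ 2 by rewrite mulr_gt0// exprn_gt0.
by rewrite invf_lt1 ?ltrDl// addr_gt0. Qed.

(* The product telescopes because
   [gain k ^+ 2 = (s_ k.+1 - c) / (s_ k * (1 + s_ k * sigma ^+ 2))]. *)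
Lemma gain_prod_sq_le k : gain_prod k ^+ 2 <= s_ k / c * rate ^+ k.
Proof.
elim: k => [|k IH]; first by rewrite /= expr1n expr0 mulr1 divff// gt_eqF.
rewrite [gain_prod _]/= exprMn real_normK ?num_real// exprS.
apply: le_trans (ler_wpM2r (sqr_ge0 _) IH) _.
have sk := precision_gt0 k; have dk := precision_den k.
have -> : gain k ^+ 2 = (s_ k.+1 - c) / s_ k / (1 + s_ k * sigma ^+ 2).
  by rewrite /gain /=; field; rewrite !gt_eqF.
have -> : s_ k / c * rate ^+ k * ((s_ k.+1 - c) / s_ k / (1 + s_ k * sigma ^+ 2)) =
    ((s_ k.+1 - c) / c * rate ^+ k) * (1 + s_ k * sigma ^+ 2)^-1.
  by field; rewrite !gt_eqF.
rewrite [leRHS](_ : _ = s_ k.+1 / c * rate ^+ k * rate); last by rewrite exprSr mulrA.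
rewrite ler_pM//.
- by rewrite mulr_ge0 ?exprn_ge0 ?rate_ge0// divr_ge0 ?subr_ge0 ?precision_ge.
- by rewrite invr_ge0 ltW.
- rewrite ler_wpM2r ?exprn_ge0 ?rate_ge0//.
  by rewrite ler_pM2r ?invr_gt0// lerBlDr lerDl.
- rewrite lef_pV2 ?posrE//; last by rewrite ltr_wpDr// mulr_ge0 ?sqr_ge0.
  by rewrite lerD2l ler_wpM2r ?sqr_ge0// precision_ge.
Qed.

Lemma gain_prod_ge0 k : 0 <= gain_prod k.
Proof. by elim: k => //= k IH; rewrite mulr_ge0. Qed.

Definition gain_bound : R := precision_max / c.

Lemma gain_bound_ge1 : 1 <= gain_bound.
Proof. by rewrite ler_pdivlMr// mul1r (precision_le 0). Qed.

Lemma gain_prod_sq_bound k : gain_prod k ^+ 2 <= gain_bound * rate ^+ k.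
Proof.
apply: le_trans (gain_prod_sq_le k) _; rewrite ler_wpM2r ?exprn_ge0 ?rate_ge0//.
by rewrite ler_pM2r ?invr_gt0// precision_le.
Qed.

Lemma gain_prod_le k : gain_prod k <= Num.sqrt gain_bound * Num.sqrt rate ^+ k.
Proof.
have b0 : 0 <= gain_bound by apply: le_trans gain_bound_ge1.
rewrite -(@ler_pXn2r _ 2) ?nnegrE ?gain_prod_ge0 ?mulr_ge0 ?exprn_ge0 ?sqrtr_ge0//.
rewrite exprMn sqr_sqrtr// -exprM mulnC exprM sqr_sqrtr ?rate_ge0//.
exact: gain_prod_sq_bound.
Qed.

(** The innermost kernel, of index 0, turns the indicator into a Lipschitz function; every later
    kernel multiplies the constant by its gain. *)
Lemma smoother_halfline_lipschitz k (a : R) :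
  lipschitz_le (smoother k.+1 \1_(`]-oo, a]%classic : set R))
    (normal_peak (spread 0) * gain_prod k.+1).
Proof.
have b1 : bounded_measurable (\1_(`]-oo, a]%classic : set R) : R -> R) by exact: bm_indic.
elim: k => [|k IH].
  by rewrite /= mul1r; apply: lipschitz_le_mutate_halfline; exact: spread_gt0.
rewrite [gain_prod _]/= mulrA; apply: (@lipschitz_le_mutate _ _ _ (smoother k.+1 _)) => //.
- exact: spread_neq0.
- exact: bm_smoother.
Qed.

(** The variance of the composed gaussian kernel [smoother k], whose mean at [z] is
    [gain_prod k * z] up to sign. *)
Fixpoint spread_sum k : R :=
  match k with
  | 0 => 0
  | k'.+1 => spread_sum k' + gain_prod k' ^+ 2 * spread k' ^+ 2
  end.

Definition spread_bound : R := gain_bound * sigma ^+ 2 / (1 - rate).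

Lemma spread_sum_le k : spread_sum k <= spread_bound.
Proof.
suff H : spread_sum k <= spread_bound * (1 - rate ^+ k).
  apply: le_trans H _; rewrite ler_piMr//.
    by rewrite divr_ge0 ?subr_ge0 ?(ltW rate_lt1)// mulr_ge0 ?sqr_ge0//; apply: le_trans gain_bound_ge1.
  by rewrite gerBl exprn_ge0// rate_ge0.
elim: k => [|k IH] /=; first by rewrite expr0 subrr mulr0.
have -> : spread_bound * (1 - rate ^+ k.+1) =
    spread_bound * (1 - rate ^+ k) + gain_bound * rate ^+ k * sigma ^+ 2.
  rewrite /spread_bound (exprS rate); set q := rate ^+ k; have := rate_lt1.
    by move: rate => r r1; field; rewrite gt_eqF// subr_gt0.
by rewrite lerD// ler_pM ?sqr_ge0// ?gain_prod_sq_bound// spread_sq_le.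
Qed.

(** It turns the normalising factors of successive tiltings into exponentials, whose exponents add
    up to a convergent series. *)
Lemma inv_sqrt_expR (x : R) : 0 <= x -> expR (- (x / 2)) <= (Num.sqrt (1 + x))^-1.
Proof.
move=> x0; rewrite expRN lef_pV2 ?posrE ?expR_gt0 ?sqrtr_gt0 ?ltr_wpDr//.
rewrite -(@ler_pXn2r _ 2) ?nnegrE ?expR_ge0 ?sqrtr_ge0//.
rewrite sqr_sqrtr ?addr_ge0// expr2 -expRD (_ : x / 2 + x / 2 = x) ?expR_ge1Dx//.
by field.
Qed.

(** Each kernel is integrated exactly by tilting; the denominator of the resulting exponent is
    dropped and the normalising factor is replaced by its exponential bound. *)
Lemma smoother_gauss_potential_ge k g z : 0 <= g ->
  expR (- (g * spread_sum k / 2)) * gauss_potential (g * gain_prod k ^+ 2) z <=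
  smoother k (gauss_potential g) z.
Proof.
move=> g0; elim: k z => [|k IH] z /=.
  by rewrite mulr0 mul0r oppr0 expR0 mul1r expr1n mulr1.
set B := gain_prod k in IH *; set v := spread k; set r := gain k.
have gB0 : 0 <= g * B ^+ 2 by rewrite mulr_ge0 ?sqr_ge0.
have bgB := bm_gauss_potential gB0.
rewrite /mutate.
apply: le_trans (le_expect (gauss (r * z) v) _ (bm_smoother k (bm_gauss_potential g0)) IH); last first.
  by apply: bmM => //; exact: bm_cst.
rewrite expectZ//.
have -> : expect (gauss (r * z) v) (gauss_potential (g * B ^+ 2)) =
   (Num.sqrt (1 + g * B ^+ 2 * v ^+ 2))^-1 *
   gauss_potential (g * B ^+ 2 / (1 + g * B ^+ 2 * v ^+ 2)) (r * z).
  have := expect_gaussian_tilt (r * z) (spread_gt0 k) gB0 (bm_cst R 1).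
  rewrite expect_cst mulr1 => <-; congr expect.
  by apply/funext => x; rewrite mulr1.
have x0 : 0 <= g * B ^+ 2 * v ^+ 2 by rewrite mulr_ge0 ?sqr_ge0.
rewrite (_ : expR (- (g * (spread_sum k + B ^+ 2 * v ^+ 2) / 2)) =
   expR (- (g * spread_sum k / 2)) * expR (- (g * B ^+ 2 * v ^+ 2 / 2))); last first.
  by rewrite -expRD; congr expR; ring.
rewrite -mulrA ler_wpM2l ?expR_ge0// ler_pM ?expR_ge0// ?inv_sqrt_expR//.
rewrite ler_expR lerN2 ler_pM2r ?invr_gt0//.
rewrite [leRHS](_ : _ = g * B ^+ 2 * (r * z) ^+ 2); last first.
  by rewrite [in LHS]exprMn real_normK ?num_real//; ring.
rewrite ler_wpM2r ?sqr_ge0//.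
by rewrite ler_pdivrMr ?ltr_wpDr// ler_peMr// lerDl.
Qed.

Definition smoother_floor (g : R) : R := expR (- (g * spread_bound / 2)).

(** The form uniform in [k], since the variances and the squared gain products are bounded. *)
Lemma smoother_gauss_potential_bound k g z : 0 <= g ->
  smoother_floor g * gauss_potential (g * gain_bound) z <= smoother k (gauss_potential g) z.
Proof.
move=> g0; apply: le_trans (smoother_gauss_potential_ge k z g0).
rewrite ler_pM ?expR_ge0// ler_expR lerN2 ler_pM2r ?invr_gt0//.
  by rewrite ler_wpM2l// spread_sum_le.
rewrite ler_wpM2r ?sqr_ge0// ler_wpM2l//.
apply: le_trans (gain_prod_sq_bound k) _; rewrite ler_piMr//.
  by apply: le_trans gain_bound_ge1.
by rewrite exprn_ile1 ?rate_ge0 ?(ltW rate_lt1).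
Qed.

End semigroup.

Section ratio.
Context {R : realType}.
Implicit Types (mu nu : probability R R) (p psi : R -> R).

(* Centring [psi] at [b] makes the error proportional to the oscillation of
   [p * (psi - b)] instead of that of [p * psi]. *)
Lemma expect_ratio_close mu nu p psi (b B V W D delta : R) :
  0 <= D -> cdf_close mu nu D -> bounded_measurable p -> bounded_measurable psi ->
  bounded_variation (fun x => p x * (psi x - b)) V -> bounded_variation p W ->
  (forall x, `|p x * (psi x - b)| <= B) ->
  0 < delta -> delta <= expect mu p -> delta <= expect nu p ->
  `|expect mu (fun x => p x * psi x) / expect mu p -
    expect nu (fun x => p x * psi x) / expect nu p| <=
  4 * V * D / delta + B * (4 * W * D) / delta ^+ 2.
Proof.
move=> D0 H bp bpsi bvf bvp fB d0 dmu dnu.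
set f := fun x => p x * (psi x - b) in bvf fB *.
have bf : bounded_measurable f by apply: bmM => //; apply: bmB => //; exact: bm_cst.
have fE (P : probability R R) : expect P (fun x => p x * psi x) = expect P f + b * expect P p.
  rewrite -expectZ// -expectD//; last by apply: bmM => //; exact: bm_cst.
  by congr expect; apply/funext => x; rewrite /f; ring.
have m0 : 0 < expect mu p by exact: lt_le_trans dmu.
have n0 : 0 < expect nu p by exact: lt_le_trans dnu.
have Hf := expect_bv_close D0 H bf bvf.
have Hp := expect_bv_close D0 H bp bvp.
have HB := expect_norm_le nu bf fB.
rewrite !fE.
(* The two copies of [b] cancel, and what remains separates the error of the numerators from that of
   the denominators. *)
have -> : (expect mu f + b * expect mu p) / expect mu p -
          (expect nu f + b * expect nu p) / expect nu p =
  (expect mu f - expect nu f) / expect mu p -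
  expect nu f * (expect mu p - expect nu p) / (expect mu p * expect nu p).
  by field; rewrite !gt_eqF.
apply: le_trans (ler_normB _ _) _; apply: lerD.
  rewrite normrM normfV (gtr0_norm m0) ler_pM// ?invr_ge0; [exact: ltW|by rewrite lef_pV2 ?posrE].
rewrite normrM normfV normrM (gtr0_norm (mulr_gt0 m0 n0)) ler_pM ?mulr_ge0 ?invr_ge0//.
- exact/ltW/mulr_gt0.
- exact: ler_pM.
- by rewrite lef_pV2 ?posrE ?mulr_gt0 ?exprn_gt0// expr2 ler_pM// ltW.
Qed.

End ratio.

(** * One-step errors and their accumulation in time *)

Section stability.
Context {R : realType}.
Variables (rho sigma c : R).
Hypotheses (sigma_gt0 : 0 < sigma) (c_gt0 : 0 < c).

Let c_ge0 : 0 <= c. Proof. exact: ltW. Qed.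

Local Notation G := (gauss_potential c).
Local Notation M := (mutate rho sigma).
Local Notation T := (semigroup rho sigma c).
Local Notation s_ := (precision rho sigma c).
Local Notation halfline a := (\1_(`]-oo, a]%classic : set R) : R -> R).
Local Notation floor_pot := (gauss_potential (precision_max rho sigma c)).

(** The filter reached from the prediction [mu] after its update and [k] further steps. *)
Definition flow (mu : probability R R) k (f : R -> R) : R :=
  expect mu (T k f) / expect mu (T k (fun=> 1)).

Lemma flowE mu k f : bounded_measurable f ->
  flow mu k f =
  expect mu (fun x => gauss_potential (s_ k) x * smoother rho sigma c k f x) /
  expect mu (gauss_potential (s_ k)).
Proof.
move=> bf; have b1 := bm_cst R (1 : R).
have bs := bm_gauss_potential (precision_ge0 rho sigma c_gt0 k).
rewrite /flow !semigroupE// smoother1.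
have -> : (fun x => mass rho sigma c k * (gauss_potential (s_ k) x * 1)) =
    (fun x => mass rho sigma c k * gauss_potential (s_ k) x).
  by apply/funext => x; rewrite mulr1.
rewrite !expectZ//; last by apply: bmM => //; exact: bm_smoother.
have m0 := mass_gt0 rho sigma c_gt0 k.
have e0 : 0 < expect mu (gauss_potential (s_ k)) by apply: expect_gt0 => // x; exact: expR_gt0.
by field; rewrite !gt_eqF.
Qed.

Let K := 2 + 4 / c.
Let K_ge0 : 0 <= K. Proof. by rewrite addr_ge0// divr_ge0. Qed.

(** For [k = 0] the estimate of [flow_close] is [12 / delta + 8 / delta ^+ 2], and for [k > 0] it is
    [24 / delta + 8 / delta ^+ 2] times [K] and a Lipschitz constant; as [delta <= 1], the sum
    covers both. *)
Definition step_const (delta : R) : R :=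
  (20 + 32 * K * (normal_peak (spread rho sigma c 0) * Num.sqrt (gain_bound rho sigma c))) /
  delta ^+ 2.

Lemma flow_close mu nu (D delta a : R) k : 0 <= D -> cdf_close mu nu D ->
  0 < delta <= 1 ->
  delta <= expect mu (gauss_potential (s_ k)) ->
  delta <= expect nu (gauss_potential (s_ k)) ->
  `|flow mu k (halfline a) - flow nu k (halfline a)| <=
  step_const delta * Num.sqrt (rate sigma c) ^+ k * D.
Proof.
move=> D0 H /andP[d0 d1] dmu dnu.
have b1 : bounded_measurable (halfline a) by exact: bm_indic.
rewrite !flowE//.
have sk0 := precision_ge0 rho sigma c_gt0 k.
have bp := bm_gauss_potential sk0.
have p1 x : `|gauss_potential (s_ k) x| <= 1.
  by rewrite ger0_norm ?expR_ge0// gauss_potential_le1.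
have h1 x : `|halfline a x| <= 1 by rewrite indicE ger0_norm// lern1 leq_b1.
set q := Num.sqrt (rate sigma c).
set E := normal_peak (spread rho sigma c 0) * Num.sqrt (gain_bound rho sigma c).
have E0 : 0 <= E by rewrite mulr_ge0 ?normal_peak_ge0 ?sqrtr_ge0.
have q0 : 0 <= q by exact: sqrtr_ge0.
have dV : delta^-1 <= (delta ^+ 2)^-1.
  by rewrite lef_pV2 ?posrE ?exprn_gt0// expr2 ler_piMr// ltW.
(* With [k = 0] the indicator has not been smoothed: its variation 1 and that of the potential, 2,
   give 3, without any decay. *)
case: k sk0 bp p1 dmu dnu => [|k] sk0 bp p1 dmu dnu.
  apply: le_trans (expect_ratio_close (b := 0) (B := 1) (V := 1 * 2 + 1 * 1) (W := 2) D0 H bp _ _ _ _ d0 dmu dnu) _ => //.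
  - under eq_fun do rewrite subr0.
    apply: (@bounded_variationM R _ _ 1 1) => //.
      exact: bounded_variation_gauss_potential.
    exact: bounded_variation_halfline.
  - exact: bounded_variation_gauss_potential.
  - by move=> x; rewrite subr0 normrM -[leRHS]mulr1; apply: ler_pM => //; exact: h1.
  rewrite expr0 (mulr1 (step_const _)) /step_const -/E.
  apply: (@le_trans _ _ (20 / delta ^+ 2 * D)).
    rewrite (_ : _ + _ = (12 / delta + 8 / delta ^+ 2) * D); last by ring.
    by rewrite ler_wpM2r//; lra.
  rewrite ler_wpM2r// ler_pM2r ?invr_gt0 ?exprn_gt0// lerDl.
  by rewrite mulr_ge0// mulr_ge0.
set psi := smoother rho sigma c k.+1 (halfline a).
set L := normal_peak (spread rho sigma c 0) * gain_prod rho sigma c k.+1.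
have bpsi : bounded_measurable psi by exact: bm_smoother.
have psiL : lipschitz_le psi L by exact: smoother_halfline_lipschitz.
have L0 : 0 <= L by rewrite mulr_ge0 ?normal_peak_ge0 ?gain_prod_ge0.
have sc := precision_ge rho sigma c_gt0 k.+1.
(* Centring at [psi 0] leaves only the Lipschitz constant of [psi], which decays, instead of its
   supremum, which does not. *)
apply: le_trans (expect_ratio_close (b := psi 0) (B := L * K) (V := 6 * K * L) (W := 2) D0 H bp bpsi _ _ _ d0 dmu dnu) _.
- by apply: bounded_variation_gauss_lipschitz => //; case: bpsi.
- exact: bounded_variation_gauss_potential.
- move=> x; rewrite normrM ger0_norm ?expR_ge0// mulrC.
  apply: le_trans (ler_wpM2r (expR_ge0 _) (psiL 0 x)) _.
  rewrite subr0 -/(gauss_potential (s_ k.+1) x) -[leLHS]mulrA ler_wpM2l// mulrC.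
  apply: le_trans (gauss_potential_decay x c_gt0 sc).
  by rewrite ler_wpM2l ?expR_ge0//; have := normr_ge0 x; nra.
have LE : L <= E * q ^+ k.+1.
  by rewrite /L /E -mulrA ler_wpM2l ?normal_peak_ge0// gain_prod_le.
rewrite (_ : _ + _ = (24 / delta + 8 / delta ^+ 2) * K * L * D); last by ring.
apply: (@le_trans _ _ (32 / delta ^+ 2 * K * (E * q ^+ k.+1) * D)).
  rewrite ler_wpM2r// ler_pM//.
    apply: mulr_ge0 => //; apply: addr_ge0; apply: divr_ge0 => //; first exact: ltW.
    by rewrite exprn_ge0// ltW.
  by rewrite ler_wpM2r//; lra.
rewrite /step_const -/E -/q ler_wpM2r//.
rewrite (_ : _ * (E * q ^+ k.+1) = 32 * K * E / delta ^+ 2 * q ^+ k.+1); last by ring.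
by rewrite ler_wpM2r ?exprn_ge0// ler_wpM2r ?invr_ge0 ?exprn_ge0// ?lerDr// ltW.
Qed.

Section particle_flow.
Variable eta1 : probability R R.

(* One time step later than the notation suggests: index [s] is time [s + 1].
   [muN] and [hN] are the particle approximations of the predictive laws [e]
   and of the filters [h], and [nu] is the exact prediction from [hN]. *)
Variables (muN nu hN h e : nat -> probability R R).
Hypothesis hN_def : forall s f, bounded_measurable f ->
  expect (hN s) f = expect (muN s) (fun x => G x * f x) / expect (muN s) G.
Hypothesis nu0_def : forall f, bounded_measurable f -> expect (nu 0%N) f = expect eta1 f.
Hypothesis nuS_def : forall s f, bounded_measurable f ->
  expect (nu s.+1) f = expect (hN s) (M f).
Hypothesis h_def : forall s f, bounded_measurable f -> expect (h s) f = flow eta1 s f.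
Hypothesis e0_def : forall f, bounded_measurable f -> expect (e 0%N) f = expect eta1 f.
Hypothesis eS_def : forall s f, bounded_measurable f ->
  expect (e s.+1) f = expect (h s) (M f).

Let bm_G : bounded_measurable G. Proof. exact: bm_gauss_potential. Qed.
Let sigma_neq0 : sigma != 0. Proof. by rewrite gt_eqF. Qed.

(** No sampling takes place between [muN s] and [nu s.+1], and the normaliser of the update cancels
    in the ratio. This is the link of the telescoping sum. *)
Lemma flow_shift s k f : bounded_measurable f -> flow (nu s.+1) k f = flow (muN s) k.+1 f.
Proof.
move=> bf.
have E g : bounded_measurable g -> expect (nu s.+1) (T k g) = expect (muN s) (T k.+1 g) / expect (muN s) G.
  move=> bg; have bT := bm_semigroup rho sigma_gt0 c_gt0 k bg.
  by rewrite nuS_def// hN_def//; exact: bm_mutate.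
have b1 := bm_cst R (1 : R).
have Tpos k' (mu : probability R R) : 0 < expect mu (T k' (fun=> 1)).
  rewrite semigroupE// smoother1; apply: expect_gt0 => [|x].
    apply: bmM; first exact: bm_cst.
    by apply: bmM => //; apply: bm_gauss_potential; exact: precision_ge0.
  by rewrite mulr1 mulr_gt0 ?expR_gt0// mass_gt0.
have g0 : 0 < expect (muN s) G by apply: expect_gt0 => // x; exact: expR_gt0.
rewrite /flow !E//; have := Tpos k.+1 (muN s); set X := expect _ _; set Y := expect _ (T _ _).
by move=> Y0; field; rewrite !gt_eqF.
Qed.

(** A time-uniform lower bound for integrals of [floor_pot] under the exact filters. In the
    exponent, one term comes from smoothing [floor_pot] and the other from the potential
    [gauss_potential (s_ k)], itself at least [floor_pot]. *)
Definition floor_const : R :=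
  smoother_floor rho sigma c (precision_max rho sigma c) *
  expect eta1 (gauss_potential (precision_max rho sigma c * gain_bound rho sigma c + precision_max rho sigma c)).

Definition floor_ratio : R := (Num.sqrt (1 + precision_max rho sigma c * sigma ^+ 2))^-1.

Let smax_ge0 : 0 <= precision_max rho sigma c.
Proof. by rewrite addr_ge0// divr_ge0// sqr_ge0. Qed.

Let gain_bound_ge0 : 0 <= gain_bound rho sigma c.
Proof. by rewrite divr_ge0. Qed.

Lemma floor_const_gt0 : 0 < floor_const.
Proof.
rewrite mulr_gt0 ?expR_gt0// expect_gt0// => [|x]; last exact: expR_gt0.
by apply: bm_gauss_potential; rewrite addr_ge0// mulr_ge0.
Qed.

Lemma floor_ratio_gt0 : 0 < floor_ratio.
Proof. by rewrite invr_gt0 sqrtr_gt0 ltr_wpDr// mulr_ge0// sqr_ge0. Qed.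

Lemma floor_ratio_le1 : floor_ratio <= 1.
Proof.
have x0 : 0 <= precision_max rho sigma c * sigma ^+ 2 by rewrite mulr_ge0// sqr_ge0.
by rewrite invf_le1 ?sqrtr_gt0 ?ltr_wpDr// -[leLHS]sqrtr1 ler_wsqrtr// lerDl.
Qed.

Lemma floor_pot_le k x : floor_pot x <= gauss_potential (s_ k) x.
Proof.
rewrite ler_expR lerN2 ler_pM2r ?invr_gt0// ler_wpM2r ?sqr_ge0//.
exact: precision_le.
Qed.

(** The filter is a quotient whose denominator is at most 1 and whose numerator is bounded below
    through the gaussian minorant of the smoother. *)
Lemma expect_filter_floor s : floor_const <= expect (h s) floor_pot.
Proof.
have bf := bm_gauss_potential smax_ge0.
have sk0 := precision_ge0 rho sigma c_gt0 s.
have bs := bm_gauss_potential sk0.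
rewrite h_def// flowE//.
have e0 : 0 < expect eta1 (gauss_potential (s_ s)).
  by apply: expect_gt0 => // x; exact: expR_gt0.
have e1 : expect eta1 (gauss_potential (s_ s)) <= 1.
  rewrite -[leRHS](expect_cst eta1 1); apply: le_expect => //; first exact: bm_cst.
  by move=> x; exact: gauss_potential_le1.
have bg : bounded_measurable (gauss_potential (precision_max rho sigma c * gain_bound rho sigma c + precision_max rho sigma c)).
  by apply: bm_gauss_potential; rewrite addr_ge0// mulr_ge0.
rewrite ler_pdivlMr//; apply: (@le_trans _ _ floor_const).
  by rewrite ler_piMr// ltW// floor_const_gt0.
rewrite /floor_const -expectZ//; apply: le_expect.
- by apply: bmM => //; exact: bm_cst.
- by apply: bmM => //; exact: bm_smoother.
move=> x; rewrite (_ : gauss_potential (_ + _) x = gauss_potential (precision_max rho sigma c * gain_bound rho sigma c) x * floor_pot x); last first.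
  by rewrite /gauss_potential -expRD; congr expR; ring.
rewrite mulrA mulrC ler_pM ?expR_ge0// ?mulr_ge0 ?expR_ge0//; first exact: floor_pot_le.
exact: smoother_gauss_potential_bound.
Qed.

Lemma expect_init_floor k : floor_const <= expect eta1 (gauss_potential (s_ k)).
Proof.
have bg : bounded_measurable (gauss_potential (precision_max rho sigma c * gain_bound rho sigma c + precision_max rho sigma c)).
  by apply: bm_gauss_potential; rewrite addr_ge0// mulr_ge0.
apply: (@le_trans _ _ (expect eta1 (gauss_potential (precision_max rho sigma c * gain_bound rho sigma c + precision_max rho sigma c)))).
  rewrite ler_piMl ?expect_ge0// => [x|]; first exact: expR_ge0.
  rewrite -[leRHS]expR0 ler_expR oppr_le0 divr_ge0// mulr_ge0//.
  apply: divr_ge0; first by rewrite mulr_ge0// sqr_ge0.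
  by rewrite subr_ge0; apply/ltW/rate_lt1.
apply: le_expect => //.
  by apply: bm_gauss_potential; exact: precision_ge0.
move=> x; apply: le_trans (floor_pot_le k x).
rewrite ler_expR lerN2 ler_pM2r ?invr_gt0// ler_wpM2r ?sqr_ge0//.
by rewrite lerDr mulr_ge0.
Qed.

(** One mutation maps [floor_pot] above [floor_ratio * floor_pot]: the new exponent multiplies the
    old one by [rho ^+ 2 / (1 + c * sigma ^+ 2 + rho ^+ 2)], which is at most 1. *)
Lemma expect_prediction_floor s k :
  floor_ratio * expect (hN s) floor_pot <= expect (nu s.+1) (gauss_potential (s_ k)).
Proof.
have bf := bm_gauss_potential smax_ge0.
have sk0 := precision_ge0 rho sigma c_gt0 k.
have bs := bm_gauss_potential sk0.
rewrite nuS_def// -expectZ//; apply: le_expect.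
- by apply: bmM => //; exact: bm_cst.
- exact: bm_mutate.
move=> x; rewrite /mutate.
apply: le_trans (le_expect _ bf bs (floor_pot_le k)).
have := expect_gaussian_tilt (rho * x) sigma_gt0 smax_ge0 (bm_cst R (1 : R)).
rewrite expect_cst mulr1 => E.
rewrite [leRHS](_ : _ = expect (gauss (rho * x) sigma) (fun y => floor_pot y * 1)); last first.
  by congr expect; apply/funext => y; rewrite mulr1.
rewrite E -/floor_ratio ler_wpM2l ?(ltW floor_ratio_gt0)//.
rewrite ler_expR lerN2 ler_pM2r ?invr_gt0// exprMn mulrA ler_wpM2r ?sqr_ge0//.
have D0 : 0 < 1 + precision_max rho sigma c * sigma ^+ 2.
  by rewrite ltr_wpDr// mulr_ge0// sqr_ge0.
rewrite mulrAC ler_pdivrMr//.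
have s2 : 0 < sigma ^+ 2 by rewrite exprn_gt0.
have sE : precision_max rho sigma c * sigma ^+ 2 = c * sigma ^+ 2 + rho ^+ 2.
  by rewrite /precision_max mulrDl divfK// gt_eqF.
by rewrite sE !mulrDr mulr1 addrA lerDr addr_ge0// mulr_ge0// mulr_ge0// sqr_ge0.
Qed.

(** Filters close to the exact ones integrate [floor_pot] to at least [floor_const / 2], so their
    predictions have denominators of at least [2 * delta]. *)
Let delta : R := Num.min 1 (floor_ratio * floor_const / 4).

Let delta_gt0 : 0 < delta.
Proof. by rewrite lt_min ltr01 divr_gt0// mulr_gt0 ?floor_ratio_gt0 ?floor_const_gt0. Qed.

Let delta_le1 : delta <= 1. Proof. by rewrite ge_min lexx. Qed.

Let delta_le : delta <= floor_ratio * floor_const / 4.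
Proof. by rewrite ge_min lexx orbT. Qed.

Definition stability_const : R := step_const delta / (1 - Num.sqrt (rate sigma c)).

Let q := Num.sqrt (rate sigma c).
Let q_ge0 : 0 <= q. Proof. exact: sqrtr_ge0. Qed.
Let q_lt1 : q < 1.
Proof. by rewrite -[ltRHS]sqrtr1 ltr_sqrt ?rate_lt1. Qed.

Let step_const_ge0 : 0 <= step_const delta.
Proof.
apply: divr_ge0; last by rewrite exprn_ge0// ltW.
apply: addr_ge0 => //; apply: mulr_ge0; first exact: mulr_ge0.
by apply: mulr_ge0; [exact: normal_peak_ge0|exact: sqrtr_ge0].
Qed.

Lemma stability_const_ge0 : 0 <= stability_const.
Proof. by rewrite divr_ge0// subr_ge0; exact: ltW. Qed.

(** A gaussian potential has variation 2, so an error [D] moves its integral by at most [8 * D]: the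
    first term keeps this below [delta], the second keeps the effect of the filter error below
    [floor_const / 2]. *)
Definition stability_radius : R :=
  Num.min (delta / 8) (floor_const / 16 / (1 + stability_const)).

Lemma stability_radius_gt0 : 0 < stability_radius.
Proof.
rewrite lt_min divr_gt0//= divr_gt0 ?divr_gt0 ?floor_const_gt0//.
by rewrite ltr_wpDr// stability_const_ge0.
Qed.

Variables (S : nat) (D : R).
Hypotheses (D_ge0 : 0 <= D) (D_le : D <= stability_radius).
Hypothesis muN_close : forall s, (s < S)%N -> cdf_close (muN s) (nu s) D.

Let cdf_expect (P : probability R R) a : fine (P `]-oo, a]%classic) = expect P (halfline a).
Proof. by rewrite expect_indic. Qed.

(** Strong induction, but the induction hypothesis serves only to bound denominators below. The
    error itself is a telescoping sum over the times of sampling, dominated by a geometric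
    series. *)
Lemma filter_close s : (s < S)%N -> cdf_close (hN s) (h s) (stability_const * D).
Proof.
elim/ltn_ind: s => s IH sS.
have D1 : D <= delta / 8 by apply: le_trans D_le _; rewrite ge_min lexx.
have D2 : stability_const * D <= floor_const / 16.
  apply: (@le_trans _ _ ((1 + stability_const) * D)).
    by rewrite ler_wpM2r// lerDr.
  rewrite mulrC -ler_pdivlMr ?ltr_wpDr ?stability_const_ge0//.
  by apply: le_trans D_le _; rewrite ge_min lexx orbT.
have CD0 : 0 <= stability_const * D by rewrite mulr_ge0 ?stability_const_ge0.
have bf := bm_gauss_potential smax_ge0.
have fc0 := floor_const_gt0.
have fr0 := floor_ratio_gt0.
have fr1 := floor_ratio_le1.
(* Twice [delta] is claimed, because passing from [nu j] to its empirical version loses up to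
   [delta]. *)
have nu_floor j k : (j <= s)%N -> 2 * delta <= expect (nu j) (gauss_potential (s_ k)).
  case: j => [_|j js].
    rewrite nu0_def; last by apply: bm_gauss_potential; exact: precision_ge0.
    apply: le_trans (expect_init_floor k).
    have : floor_ratio * floor_const <= floor_const by rewrite ler_piMl// ltW.
    by move: delta_le => h1 h2; lra.
  apply: le_trans (expect_prediction_floor j k).
  have := expect_bv_close CD0 (IH j js (ltn_trans js sS)) bf (bounded_variation_gauss_potential smax_ge0).
  rewrite ler_norml => /andP[h1 _]; have h2 := expect_filter_floor j.
  apply: (@le_trans _ _ (floor_ratio * (floor_const / 2))); last first.
    by rewrite ler_pM2l//; lra.
  by move: delta_le => h3; lra.
have mu_floor j k : (j <= s)%N -> delta <= expect (muN j) (gauss_potential (s_ k)).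
  move=> js; have := nu_floor j k js.
  have sk0 := precision_ge0 rho sigma c_gt0 k.
  have := expect_bv_close D_ge0 (muN_close (leq_ltn_trans js sS)) (bm_gauss_potential sk0) (bounded_variation_gauss_potential sk0).
  by rewrite ler_norml => /andP[h1 _] h2; move: delta_gt0 => h3; lra.
have nu_floor' j k : (j <= s)%N -> delta <= expect (nu j) (gauss_potential (s_ k)).
  by move=> js; apply: le_trans (nu_floor j k js); move: delta_gt0 => h3; lra.
move=> a; rewrite !cdf_expect.
have bh : bounded_measurable (halfline a) by exact: bm_indic.
have hN0 : expect (hN s) (halfline a) = flow (muN s) 0 (halfline a).
  rewrite hN_def// /flow /=; congr (_ / expect _ _).
  by apply/funext => x; rewrite mulr1.
rewrite hN0 h_def//.
have step j k : (j <= s)%N ->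
  `|flow (muN j) k (halfline a) - flow (nu j) k (halfline a)| <= step_const delta * q ^+ k * D.
  move=> js; apply: flow_close => //; rewrite ?delta_gt0//.
  - by apply: muN_close; exact: leq_ltn_trans sS.
  - exact: mu_floor.
  - exact: nu_floor'.
(* Going back one time step replaces [nu (s - k)] by the update and mutation of the previous
   particles, an equality, and then these particles by their own exact prediction. *)
have tele k : (k <= s)%N ->
  `|flow (muN s) 0 (halfline a) - flow (nu (s - k)%N) k (halfline a)| <=
  step_const delta * D * \sum_(i < k.+1) q ^+ i.
  elim: k => [_|k IHk ks].
    rewrite subn0 big_ord_recl big_ord0 addr0 expr0 mulr1.
    by have := step s 0%N (leqnn _); rewrite expr0 mulr1.
  have E : (s - k = (s - k.+1).+1)%N by rewrite subnSK.
  have := IHk (ltnW ks); rewrite E flow_shift// => h1.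
  have h2 := step (s - k.+1)%N k.+1 (leq_subr _ _).
  rewrite big_ord_recr/= mulrDr.
  apply: le_trans (ler_distD (flow (muN (s - k.+1)%N) k.+1 (halfline a)) _ _) _.
  by apply: lerD => //; rewrite mulrAC.
have nuE : flow (nu 0%N) s (halfline a) = flow eta1 s (halfline a).
  by rewrite /flow !nu0_def//; apply: bm_semigroup => //; exact: bm_cst.
have := tele s (leqnn _); rewrite subnn nuE => h1; apply: le_trans h1 _.
rewrite /stability_const -/q; move: (step_const delta) step_const_ge0 => A A0.
rewrite [leRHS](_ : _ = A * D * (1 - q)^-1); last by ring.
rewrite ler_wpM2l ?mulr_ge0//.
have q1 : 0 < 1 - q by rewrite subr_gt0.
rewrite -[leRHS]mul1r ler_pdivlMr// mulrC.
have -> : (1 - q) * (\sum_(i < s.+1) q ^+ i) = 1 - q ^+ s.+1.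
  by rewrite -[1 in RHS](expr1n _ s.+1) subrXX; congr (_ * _); apply: eq_bigr => i _; rewrite expr1n mul1r.
by rewrite gerBl exprn_ge0.
Qed.

(** To the sampling error is added the filter error carried through one mutation. The mutated
    indicator is monotone with values in [[0, 1]], so that mutation does not amplify the error. *)
Lemma prediction_close s : (s < S)%N -> cdf_close (muN s) (e s) ((1 + stability_const) * D).
Proof.
case: s => [|s] sS a.
  have := muN_close sS a; rewrite !cdf_expect nu0_def; last exact: bm_indic.
  rewrite e0_def; last exact: bm_indic.
  by move=> h1; apply: le_trans h1 _; rewrite ler_peMl// lerDl stability_const_ge0.
have bh : bounded_measurable (halfline a) by exact: bm_indic.
have := muN_close sS a; rewrite !cdf_expect => h1.
apply: le_trans (ler_distD (expect (nu s.+1) (halfline a)) _ _) _.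
rewrite mulrDl mul1r; apply: lerD => //.
rewrite nuS_def// eS_def//.
have CD0 : 0 <= stability_const * D by rewrite mulr_ge0 ?stability_const_ge0.
have H := filter_close (ltnW sS).
have bM := bm_mutate rho sigma_neq0 bh; have [mM _] := bM.
have M01 x : 0 <= M (halfline a) x <= 1.
  rewrite /mutate expect_gaussian_halfline// fine_ge0//=.
  by rewrite -lee_fin -probability_fin// probability_le1.
have Mmono x y : rho * x <= rho * y -> M (halfline a) y <= M (halfline a) x.
  move=> xy; rewrite /mutate !expect_gaussian_halfline//.
  apply: fine_le; rewrite ?fin_num_measure//.
  by apply: le_measure; rewrite ?inE//; apply: subset_itvl; rewrite bnd_simp lerD2l lerN2.
rewrite -[leRHS]mul1r.
(* The mutated indicator increases for [rho <= 0]; otherwise its complement to 1 does. *)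
have [r0|/ltW r0] := leP 0 rho; last first.
  apply: expect_monotone_close => // x y xy; apply: Mmono.
  by rewrite ler_wnM2l.
have E (P : probability R R) : expect P (M (halfline a)) = 1 - expect P (fun x => 1 - M (halfline a) x).
  rewrite expectB//; last exact: bm_cst.
  by rewrite expect_cst opprB addrC subrK.
rewrite !E opprD opprK addrACA subrr add0r addrC distrC.
apply: expect_monotone_close => //.
- exact: measurable_funB.
- by move=> x y xy; rewrite lerD2l lerN2; apply: Mmono; rewrite ler_wpM2l.
- by move=> x; have /andP[h2 h3] := M01 x; rewrite subr_ge0 h3 gerBl.
Qed.

End particle_flow.
End stability.

(** * Quantiles and empirical distribution functions *)

Section quantile.
Context {R : realType}.
Implicit Types (mu : probability R R) (u a : R).

Let idR : {mfun R >-> R} :=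
  HB.pack (fun x : R => x) (isMeasurableFun.Build _ _ _ _ _ (@measurable_id _ R setT)).

Lemma cdf_le mu a b : a <= b -> (mu `]-oo, a]%classic <= mu `]-oo, b]%classic)%E.
Proof. exact: (cdf_nondecreasing (idR : {RV mu >-> R})). Qed.

Lemma cvg_cdf_right mu a :
  fine (mu `]-oo, x]%classic) @[x --> a^'+] --> fine (mu `]-oo, a]%classic).
Proof.
apply: fine_cvg; rewrite -probability_fin//.
exact: (@cdf_right_continuous _ _ _ mu (idR : {RV mu >-> R})).
Qed.

Lemma quantile_level_nonempty mu u : u < 1 -> exists a, (u%:E <= mu `]-oo, a]%classic)%E.
Proof.
move=> u1; have := cvg_cdfy1 (idR : {RV mu >-> R}).
move=> /fine_cvg /(cvgr_gt 1) /(_ _ u1) [a [_ H]]; exists (a + 1).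
by rewrite probability_fin// lee_fin; apply/ltW/H; rewrite ltrDl.
Qed.

Lemma quantile_level_bounded mu u : 0 < u -> exists a, (mu `]-oo, a]%classic < u%:E)%E.
Proof.
move=> u0; have := cvg_cdfNy0 (idR : {RV mu >-> R}).
move=> /fine_cvg /(cvgr_lt 0) /(_ _ u0) [a [_ H]]; exists (a - 1).
by rewrite probability_fin// lte_fin; apply: H; rewrite gtrBl.
Qed.

(** The Galois connection between a distribution function and its generalised inverse. It is an
    equality of booleans because the infimum is attained. *)
Lemma quantile_le (pi : set R -> \bar R) mu u a :
  (forall b, pi `]-oo, b]%classic = mu `]-oo, b]%classic) -> 0 < u < 1 ->
  (measure_quantile pi u <= a) = (u%:E <= mu `]-oo, a]%classic)%E.
Proof.
move=> piE /andP[u0 u1]; rewrite /measure_quantile.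
set S := [set _ | _].
have SE b : S b = (u%:E <= mu `]-oo, b]%classic)%E :> Prop.
  by rewrite /S/= /measure_cdf piE.
have S0 : S !=set0 by have [b Hb] := quantile_level_nonempty mu u1; exists b; rewrite SE.
have Slb : has_lbound S.
  have [b Hb] := quantile_level_bounded mu u0; exists b => x; rewrite SE => Hx.
  rewrite leNgt; apply/negP => /ltW xb.
  by have := lt_le_trans Hb (le_trans Hx (cdf_le mu xb)); rewrite ltxx.
(* Right continuity of the distribution function, along the sequence [inf S + 1 / n.+1]. *)
have Si : S (inf S).
  rewrite SE.
  have C : mu `]-oo, inf S + n.+1%:R^-1]%classic @[n --> \oo] --> mu `]-oo, inf S]%classic.
    rewrite (itvNycEbigcap false); apply: nonincreasing_cvg_mu => //.
    - exact: le_lt_trans (probability_le1 mu _) (ltry 1).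
    - exact: bigcap_measurable.
    - move=> m n mn; apply/subsetPset/subset_itvl.
      by rewrite bnd_simp lerD2l lef_pV2 ?posrE// ler_nat.
  rewrite -(cvg_lim _ C)//; apply: lime_ge; first by apply/cvg_ex; eexists; exact: C.
  apply: nearW => n.
  have [b Sb bi] := @inf_adherent _ S n.+1%:R^-1 ltac:(by rewrite invr_gt0) (conj S0 Slb).
  by move: Sb; rewrite SE => /le_trans; apply; apply: cdf_le; exact: ltW.
apply/idP/idP => [ia|Ha]; last by apply: ge_inf => //; rewrite SE.
by move: Si; rewrite SE => /le_trans; apply; exact: cdf_le.
Qed.

End quantile.

(** * Exponential tail bounds for sums of independent indicators *)

Section hoeffding.
Context d (Omega : measurableType d) {R : realType} (P : probability Omega R).

Lemma bm_sum (I : Type) (s : seq I) (F : I -> Omega -> R) :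
  (forall i, bounded_measurable (F i)) -> bounded_measurable (fun w => \sum_(i <- s) F i w).
Proof.
move=> bF; elim: s => [|i s IH].
  by under eq_fun do rewrite big_nil; exact: bm_cst.
by under eq_fun do rewrite big_cons; exact: bmD.
Qed.

Lemma expect_sum (I : Type) (s : seq I) (F : I -> Omega -> R) :
  (forall i, bounded_measurable (F i)) ->
  expect P (fun w => \sum_(i <- s) F i w) = \sum_(i <- s) expect P (F i).
Proof.
move=> bF; elim: s => [|i s IH].
  by under eq_fun do rewrite big_nil; rewrite expect_cst big_nil.
under eq_fun do rewrite big_cons.
by rewrite expectD ?IH ?big_cons//; exact: bm_sum.
Qed.

(** From [expR x <= (1 - x)^-1]. It stands in for the convexity argument in Hoeffding's lemma, at
    the price of a worse constant. *)
Lemma expR_quadratic_le (x : R) : x <= 1 / 2 -> expR x <= 1 + x + 2 * x ^+ 2.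
Proof.
move=> x2; have h : 0 < 1 - x by lra.
have H : expR x <= (1 - x)^-1.
  rewrite -[x in expR x]opprK expRN lef_pV2 ?posrE ?expR_gt0//.
  exact: expR_ge1Dx.
apply: le_trans H _; rewrite -[leLHS]mul1r ler_pdivrMr//.
have h3 : 0 <= x ^+ 2 * (1 - 2 * x) by rewrite mulr_ge0 ?sqr_ge0//; lra.
rewrite [leRHS](_ : _ = 1 + x ^+ 2 * (1 - 2 * x)); last by ring.
by rewrite lerDl.
Qed.

Variables (N : nat) (B : 'I_N -> set Omega) (p : R).
Hypothesis mB : forall i, measurable (B i).
Hypothesis indep : forall J : {set 'I_N},
  P (\bigcap_(i in [set` J]) B i) = (p ^+ #|J|)%:E.
Hypothesis p01 : 0 <= p <= 1.

(* Expanding the product over subsets of indices uses the independence only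
   through the probabilities of intersections. *)
Lemma expect_prod_indep (alpha beta : R) :
  expect P (fun w => \prod_(i < N) (alpha + beta * \1_(B i) w)) = (alpha + beta * p) ^+ N.
Proof.
have mJ (J : {set 'I_N}) : measurable (\bigcap_(i in [set` J]) B i).
  by apply: fin_bigcap_measurable => //; exact: finite_finset.
pose cst_ (J : {set 'I_N}) := \prod_(i < N) (if i \in J then beta else alpha).
have E w : \prod_(i < N) (alpha + beta * \1_(B i) w) =
    \sum_(J in {set 'I_N}) cst_ J * \1_(\bigcap_(i in [set` J]) B i) w.
  under eq_bigr do rewrite addrC.
  rewrite bigA_distr; apply: eq_bigr => J _.
  rewrite /cst_ indicE.
  have [wJ|wJ] := boolP (w \in _).
    rewrite mulr1; apply: eq_bigr => i _; case: ifPn => // iJ.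
    by move: wJ; rewrite inE => /(_ i iJ) wi; rewrite indicE mem_set// mulr1.
  rewrite mulr0; move: wJ; rewrite notin_setE => /existsNP[i /not_implyP[iJ wi]].
  by rewrite (bigD1 i)//= (_ : i \in J)// indicE memNset// mulr0 mul0r.
rewrite (_ : (fun w => _) = (fun w => \sum_(J in {set 'I_N}) cst_ J * \1_(\bigcap_(i in [set` J]) B i) w)); last exact/funext.
rewrite expect_sum; last by move=> J; apply: bmM; [exact: bm_cst|exact: bm_indic].
rewrite -[RHS]/((alpha + beta * p) ^+ N) -[in RHS](card_ord N) -prodr_const addrC.
rewrite bigA_distr; apply: eq_bigr => J _.
rewrite expectZ; last exact: bm_indic.
rewrite expect_indic// indep/= /cst_ -prodr_const [X in _ * X]big_mkcond/= -big_split/=.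
by apply: eq_bigr => i _; case: ifP; rewrite ?mulr1.
Qed.

Let count (w : Omega) : R := \sum_(i < N) \1_(B i) w.

Lemma expect_exp_count (t : R) : `|t| <= 1 / 2 ->
  expect P (fun w => expR (t * (count w - N%:R * p))) <= expR (2 * N%:R * t ^+ 2).
Proof.
move=> t2; have /andP[p0 p1] := p01.
(* An exponential of an indicator is affine in that indicator, so the exponential of the count is a
   product to which [expect_prod_indep] applies. *)
pose alpha := expR (- (t * p)); pose beta := expR (t * (1 - p)) - expR (- (t * p)).
have -> : (fun w => expR (t * (count w - N%:R * p))) =
    (fun w => \prod_(i < N) (alpha + beta * \1_(B i) w)).
  apply/funext => w; rewrite (_ : t * _ = \sum_(i < N) t * (\1_(B i) w - p)); last first.
    by rewrite -mulr_sumr sumrB sumr_const card_ord mulr_natl.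
  rewrite expR_sum; apply: eq_bigr => i _; rewrite /alpha /beta indicE.
  case: (w \in B i); first by rewrite mulr1 addrCA subrr addr0.
  by rewrite mulr0 addr0 sub0r mulrN.
rewrite expect_prod_indep.
have -> : expR (2 * N%:R * t ^+ 2) = expR (2 * t ^+ 2) ^+ N.
  by rewrite -expRM_natl; congr expR; ring.
move: t2; rewrite ler_norml => /andP[t2 t2'].
have e1 : expR (t * (1 - p)) <= 1 + t * (1 - p) + 2 * (t * (1 - p)) ^+ 2.
  by apply: expR_quadratic_le; nra.
have e2 : expR (- (t * p)) <= 1 + - (t * p) + 2 * (- (t * p)) ^+ 2.
  by apply: expR_quadratic_le; nra.
have base : alpha + beta * p = (1 - p) * expR (- (t * p)) + p * expR (t * (1 - p)).
  by rewrite /alpha /beta; ring.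
have b0 : 0 <= alpha + beta * p.
  by rewrite base addr_ge0// mulr_ge0 ?expR_ge0// subr_ge0.
apply: lerXn2r; rewrite ?nnegrE ?expR_ge0//.
apply: le_trans (expR_ge1Dx _); rewrite base.
have q0 : 0 <= 1 - p by rewrite subr_ge0.
have h1 := ler_wpM2l q0 e2; have h2 := ler_wpM2l p0 e1.
apply: le_trans (lerD h1 h2) _.
rewrite [leLHS](_ : _ = 1 + 2 * t ^+ 2 * (p * (1 - p))); last by ring.
rewrite lerD2l ler_piMr//; first by rewrite mulr_ge0 ?sqr_ge0.
nra.
Qed.

(** Markov's inequality for the exponential moment; the sign of [t] selects the upper or the lower
    tail. *)
Lemma count_tail (t e : R) (S : set Omega) : `|t| <= 1 / 2 -> measurable S ->
  (forall w, S w -> e <= t * (count w - N%:R * p)) ->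
  (P S <= (expR (2 * N%:R * t ^+ 2 - e))%:E)%E.
Proof.
move=> t2 mS He.
have mcount : measurable_fun setT count.
  by have [] := @bm_sum _ (index_enum 'I_N) (fun i => \1_(B i)) (fun i => bm_indic (mB i)).
have bcount w : `|t * (count w - N%:R * p)| <= `|t| * (N%:R + `|N%:R * p|).
  rewrite normrM ler_wpM2l// (le_trans (ler_normB _ _))// lerD2r.
  rewrite ger0_norm; last by apply: sumr_ge0 => i _.
  rewrite -[X in X%:R](card_ord N) -sumr_const; apply: ler_sum => i _.
  by rewrite indicE lern1 leq_b1.
have bE : bounded_measurable (fun w => expR (t * (count w - N%:R * p))).
  split.
    by apply: measurableT_comp => //; apply: measurable_funM => //; apply: measurable_funB.
  exists (expR (`|t| * (N%:R + `|N%:R * p|))) => w.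
  by rewrite ger0_norm ?expR_ge0// ler_expR (le_trans (ler_norm _)).
rewrite -[P S]fineK ?fin_num_measure// lee_fin -expect_indic//.
rewrite expRD -[leRHS](mulrC (expR (- e))).
apply: le_trans (ler_wpM2l (expR_ge0 _) (expect_exp_count t2)).
rewrite -expectZ//; apply: le_expect; first exact: bm_indic.
  by apply: bmM => //; exact: bm_cst.
move=> w; rewrite indicE -expRD; case: (boolP (w \in _)) => [|_]; last exact: expR_ge0.
by rewrite inE/= => /He h; rewrite -[leLHS]expR0 ler_expR addrC subr_ge0.
Qed.

Lemma hoeffding_upper (e : R) (S : set Omega) : 0 <= e <= 2 -> measurable S ->
  (forall w, S w -> N%:R * (p + e) <= count w) ->
  (P S <= (expR (- (N%:R * e ^+ 2 / 8)))%:E)%E.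
Proof.
move=> /andP[e0 e2] mS He.
(* The value [t = e / 4] minimises [2 * N * t ^+ 2 - t * N * e]. *)
have t2 : `|e / 4| <= 1 / 2 by rewrite ger0_norm ?divr_ge0//; lra.
apply: (@le_trans _ _ (expR (2 * N%:R * (e / 4) ^+ 2 - N%:R * e ^+ 2 / 4))%:E).
  apply: (count_tail t2 mS) => w /He h.
  rewrite (_ : N%:R * e ^+ 2 / 4 = e / 4 * (N%:R * e)); last by ring.
  by rewrite ler_wpM2l ?divr_ge0// lerBrDl -mulrDr.
by rewrite lee_fin ler_expR le_eqVlt; apply/orP; left; apply/eqP; field.
Qed.

Lemma hoeffding_lower (e : R) (S : set Omega) : 0 <= e <= 2 -> measurable S ->
  (forall w, S w -> count w <= N%:R * (p - e)) ->
  (P S <= (expR (- (N%:R * e ^+ 2 / 8)))%:E)%E.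
Proof.
move=> /andP[e0 e2] mS He.
have t2 : `|- (e / 4)| <= 1 / 2 by rewrite normrN ger0_norm ?divr_ge0//; lra.
apply: (@le_trans _ _ (expR (2 * N%:R * (- (e / 4)) ^+ 2 - N%:R * e ^+ 2 / 4))%:E).
  apply: (count_tail t2 mS) => w /He h.
  rewrite (_ : N%:R * e ^+ 2 / 4 = e / 4 * (N%:R * e)); last by ring.
  rewrite mulNr -mulrN ler_wpM2l ?divr_ge0// opprB lerBrDl.
  by rewrite -lerBrDr -mulrBr.
by rewrite lee_fin ler_expR le_eqVlt; apply/orP; left; apply/eqP; field.
Qed.

End hoeffding.

(** * Uniform deviation of an empirical distribution function *)

Section dkw.
Context d (Omega : measurableType d) {R : realType} (P : probability Omega R).
Variables (N : nat) (X : 'I_N -> Omega -> R) (mu : probability R R).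
Hypothesis N_gt0 : (0 < N)%N.
Hypothesis mX : forall i, measurable_fun setT (X i).
Hypothesis X_iid : forall (J : {set 'I_N}) (B : set R), measurable B ->
  P (\bigcap_(i in [set` J]) (X i @^-1` B)) = ((fine (mu B)) ^+ #|J|)%:E.

Definition empirical_freq (x : 'I_N -> R) (B : set R) : R :=
  N%:R^-1 * \sum_(i < N) \1_B (x i).

(** Rational abscissae make the event a countable union, hence measurable; by right continuity they
    control all real ones. *)
Definition deviation (e : R) : set Omega := \bigcup_(q : rat)
  [set w | e < `|empirical_freq (fun i => X i w) `]-oo, ratr q]%classic -
               fine (mu `]-oo, ratr q]%classic)|].

Let F a := fine (mu `]-oo, a]%classic).
Let Fl a := fine (mu `]-oo, a[%classic).
Let E w (B : set R) := empirical_freq (fun i => X i w) B.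

Let mXB i B : measurable B -> measurable (X i @^-1` B).
Proof. by move=> mB; rewrite -[X in measurable X]setTI; exact: mX. Qed.

Let mE B : measurable B -> measurable_fun setT (fun w => E w B).
Proof.
move=> mB; apply: measurable_funM => //.
apply: (@measurable_sum _ _ _ _ _ (index_enum 'I_N) (fun i w => \1_B (X i w))) => i.
exact: measurable_indic (mXB i mB).
Qed.

Lemma measurable_deviation e : measurable (deviation e).
Proof.
apply: bigcupT_measurable_rat => q.
rewrite -[X in measurable X]setTI.
rewrite (_ : [set w | _] = (fun w => `|E w `]-oo, ratr q]%classic - F (ratr q)|) @^-1` `]e, +oo[%classic); last first.
  by apply/seteqP; split => w /=; rewrite in_itv/= andbT.
apply: (_ : measurable_fun setT _) => //.
by apply: measurableT_comp => //; apply: measurable_funB => //; exact: mE.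
Qed.

Lemma empirical_freq_le x (A B : set R) : A `<=` B -> empirical_freq x A <= empirical_freq x B.
Proof.
move=> AB; rewrite ler_wpM2l ?invr_ge0// ler_sum// => i _.
rewrite !indicE ler_nat; case: (boolP (x i \in A)) => // /set_mem /AB xB.
by rewrite mem_set.
Qed.

Lemma empirical_freq_ge0 x A : 0 <= empirical_freq x A.
Proof. by rewrite mulr_ge0 ?invr_ge0//; apply: sumr_ge0. Qed.

Lemma empirical_freq_le1 x A : empirical_freq x A <= 1.
Proof.
rewrite /empirical_freq mulrC ler_pdivrMr ?ltr0n// mul1r.
rewrite -[X in _ <= X%:R](card_ord N) -sumr_const; apply: ler_sum => i _.
by rewrite indicE lern1 leq_b1.
Qed.

Let tail_upper (e : R) B : 0 <= e <= 2 -> measurable B ->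
  (P [set w | (fine (mu B) + e <= E w B)%R] <= (expR (- (N%:R * e ^+ 2 / 8)))%:E)%E.
Proof.
move=> e02 mB; apply: (@hoeffding_upper _ _ _ _ _ (fun i => X i @^-1` B) (fine (mu B))) => //.
- by move=> i; exact: mXB.
- by move=> J; rewrite X_iid.
- rewrite fine_ge0//= -lee_fin -probability_fin//; exact: probability_le1.
- rewrite -[X in measurable X]setTI.
  rewrite (_ : [set w | _] = (fun w => E w B) @^-1` `[fine (mu B) + e, +oo[%classic); last first.
    by apply/seteqP; split => w /=; rewrite in_itv/= andbT.
  by apply: (mE mB).
- by move=> w /=; rewrite /E /empirical_freq mulrC ler_pdivlMr ?ltr0n// mulrC.
Qed.

Let tail_lower (e : R) B : 0 <= e <= 2 -> measurable B ->
  (P [set w | (E w B <= fine (mu B) - e)%R] <= (expR (- (N%:R * e ^+ 2 / 8)))%:E)%E.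
Proof.
move=> e02 mB; apply: (@hoeffding_lower _ _ _ _ _ (fun i => X i @^-1` B) (fine (mu B))) => //.
- by move=> i; exact: mXB.
- by move=> J; rewrite X_iid.
- rewrite fine_ge0//= -lee_fin -probability_fin//; exact: probability_le1.
- rewrite -[X in measurable X]setTI.
  rewrite (_ : [set w | _] = (fun w => E w B) @^-1` `]-oo, fine (mu B) - e]%classic); last first.
    by apply/seteqP; split => w /=; rewrite in_itv/=.
  by apply: (mE mB).
- by move=> w /=; rewrite /E /empirical_freq mulrC ler_pdivrMr ?ltr0n// mulrC.
Qed.

(* The events of the union bound involve the distribution function and its left
   limit at the quantiles [j / K], so that atoms of [mu] do no harm. *)
Lemma deviation_le (e : R) (K : nat) : 0 < e <= 1 -> (0 < K)%N -> K%:R^-1 <= e / 2 ->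
  (P (deviation e) <= (2 * K%:R * expR (- (N%:R * e ^+ 2 / 32)))%:E)%E.
Proof.
move=> /andP[e0 e1] K0 Ke.
(* At [j = 0] the level is not in []0, 1[] and [a_ 0] is a default value of [inf]; quantiles are
   compared with [F] for [0 < j < K] only. *)
pose a_ (j : nat) : R := measure_quantile mu (j%:R / K%:R).
pose Lo j := [set w | (E w `]-oo, a_ j]%classic <= F (a_ j) - e / 2)%R].
pose Up j := [set w | (Fl (a_ j) + e / 2 <= E w `]-oo, a_ j[%classic)%R].
have e2 : 0 <= e / 2 <= 2 by rewrite divr_ge0 ?(ltW e0)//=; lra.
have mLo j : measurable (Lo j).
  rewrite -[X in measurable X]setTI.
  rewrite (_ : Lo j = (fun w => E w `]-oo, a_ j]%classic) @^-1` `]-oo, F (a_ j) - e / 2]%classic); last first.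
    by apply/seteqP; split => w /=; rewrite in_itv/=.
  by apply: mE.
have mUp j : measurable (Up j).
  rewrite -[X in measurable X]setTI.
  rewrite (_ : Up j = (fun w => E w `]-oo, a_ j[%classic) @^-1` `[Fl (a_ j) + e / 2, +oo[%classic); last first.
    by apply/seteqP; split => w /=; rewrite in_itv/= andbT.
  by apply: mE.
have Kr : 0 < K%:R :> R by rewrite ltr0n.
have incl : deviation e `<=` \big[setU/set0]_(j < K) (Lo j `|` Up j).
  move=> w [q _] /=; set a := ratr q => dev; apply: contrapT => nbad.
  have good j : (j < K)%N -> F (a_ j) - e / 2 < E w `]-oo, a_ j]%classic /\
      E w `]-oo, a_ j[%classic < Fl (a_ j) + e / 2.
    move=> jK; have nj : ~ (Lo j `|` Up j) w.
      by move=> H; apply: nbad; rewrite (bigD1 (Ordinal jK))//=; left.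
    by split; rewrite ltNge; apply/negP => h; apply: nj; [left|right].
  have F0 : 0 <= F a by rewrite fine_ge0.
  have F1 : F a <= 1 by rewrite -lee_fin -probability_fin//; exact: probability_le1.
  have Ea0 : 0 <= E w `]-oo, a]%classic by exact: empirical_freq_ge0.
  have Ea1 : E w `]-oo, a]%classic <= 1 by exact: empirical_freq_le1.
  (* The cell of the grid of mesh [1 / K] that contains [F a]; the value [F a = 1] is put in the
     last cell. *)
  have [j [jK jF Fj Fjs]] : exists j : nat, [/\ (j < K)%N, j%:R / K%:R <= F a,
      F a <= j.+1%:R / K%:R & (j.+1 < K)%N -> F a < j.+1%:R / K%:R].
    pose m := Num.truncn (K%:R * F a).
    have KF0 : 0 <= K%:R * F a by rewrite mulr_ge0// ltW.
    have mle : m%:R <= K%:R * F a by rewrite truncn_le.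
    have mgt : K%:R * F a < m.+1%:R by exact: truncnS_gt.
    have [mK|Km] := ltnP m K.
      exists m; split => //.
      - by rewrite ler_pdivrMr// mulrC.
      - by rewrite ler_pdivlMr// mulrC ltW.
      - by move=> _; rewrite ltr_pdivlMr// mulrC.
    exists K.-1; rewrite prednK//; split => //; last by rewrite ltnn.
      rewrite ler_pdivrMr// mulrC; apply: le_trans mle.
      by rewrite ler_nat (leq_trans (leq_pred _)).
    by rewrite divff// gt_eqF.
  have Fj' : F a <= j%:R / K%:R + e / 2.
    by apply: le_trans Fj _; rewrite -natr1 mulrDl mul1r lerD2l.
  have quantE i b : (0 < i < K)%N -> (a_ i <= b) = (i%:R / K%:R <= F b).
    move=> /andP[i0 iK]; rewrite (@quantile_le _ mu mu)//; last first.
      by rewrite divr_gt0 ?ltr0n//= ltr_pdivrMr// mul1r ltr_nat.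
    by rewrite probability_fin// lee_fin.
  (* The quantile of level [j / K] lies to the left of [a]: half of [e] pays for the deviation
     there, the other half for the mesh. *)
  have lower : F a - e <= E w `]-oo, a]%classic.
    case: j jK jF Fj Fjs Fj' => [|j] jK jF _ _ Fj'; first by move: Fj'; rewrite mul0r; lra.
    have [gl _] := good _ jK.
    have ja : a_ j.+1 <= a by rewrite quantE.
    have Faj : j.+1%:R / K%:R <= F (a_ j.+1) by rewrite -quantE.
    have : E w `]-oo, a_ j.+1]%classic <= E w `]-oo, a]%classic.
      by apply: empirical_freq_le; apply: subset_itvl; rewrite bnd_simp.
    by lra.
  (* Symmetrically, the next quantile lies strictly to the right of [a], and the left limit of [F]
     there is at most its level. In the last cell the bound 1 suffices. *)
  have upper : E w `]-oo, a]%classic <= F a + e.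
    have [jK'|] := ltnP j.+1 K; last first.
      move=> Kj; have jE : K = j.+1 by apply/eqP; rewrite eqn_leq Kj.
      have : j%:R / K%:R = 1 - K%:R^-1 :> R.
        by rewrite jE -natr1; field; rewrite natr1 pnatr_eq0.
      by lra.
    have [_ gu] := good _ jK'.
    have aj : a < a_ j.+1 by rewrite ltNge quantE// -ltNge Fjs.
    have Flj : Fl (a_ j.+1) <= j.+1%:R / K%:R.
      rewrite /Fl -(cvg_lim _ (@cvg_cdf_left _ mu (a_ j.+1)))//.
      apply: limr_le; first by apply/cvg_ex; eexists; exact: (@cvg_cdf_left _ mu (a_ j.+1)).
      apply: nearW => n; apply/ltW; rewrite ltNge -quantE// -ltNge.
      by rewrite gtrBl invr_gt0.
    have : E w `]-oo, a]%classic <= E w `]-oo, a_ j.+1[%classic.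
      by apply: empirical_freq_le; apply: subset_itvl; rewrite bnd_simp.
    have : j.+1%:R / K%:R = j%:R / K%:R + K%:R^-1 :> R by rewrite -natr1 mulrDl mul1r.
    by lra.
  by move: dev; rewrite ltNge => /negP; apply; rewrite ler_distl; apply/andP.
apply: (@le_trans _ _ (P (\big[setU/set0]_(j < K) (Lo j `|` Up j)))).
  apply: le_measure => //; rewrite inE; first exact: measurable_deviation.
  by apply: bigsetU_measurable => j _; exact: measurableU.
have := @Boole_inequality _ _ _ P (fun j => Lo j `|` Up j) K (fun j _ => measurableU _ _ (mLo j) (mUp j)).
move=> /le_trans; apply.
apply: (@le_trans _ _ (\sum_(j < K) (2 * expR (- (N%:R * e ^+ 2 / 32)))%:E)%E).
  apply: lee_sum => j _; apply: le_trans (measureU2 _ _ _) _ => //.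
  rewrite mulr_natl mulr2n EFinD.
  have -> : N%:R * e ^+ 2 / 32 = N%:R * (e / 2) ^+ 2 / 8 by field.
  by apply: leeD; [exact: tail_lower|exact: tail_upper].
by rewrite sumEFin lee_fin sumr_const card_ord -[leLHS]mulr_natr mulrAC.
Qed.

End dkw.

(** * Inverse transform sampling *)

Section uniform.
Context {R : realType}.

Definition uniform01 : set R -> \bar R := uniform_prob (@ltr01 R).

HB.instance Definition _ := isMeasure.Build _ R R uniform01
  (@measure0 _ (measurableTypeR R) R (uniform_prob (@ltr01 R)))
  (@measure_ge0 _ (measurableTypeR R) R (uniform_prob (@ltr01 R)))
  (@measure_semi_sigma_additive _ (measurableTypeR R) R (uniform_prob (@ltr01 R))).

HB.instance Definition _ :=
  @Measure_isProbability.Build _ R R uniform01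
    (@probability_setT _ (measurableTypeR R) R (uniform_prob (@ltr01 R))).

Lemma uniform01_itvNyc (p : R) : 0 <= p <= 1 -> uniform01 `]-oo, p]%classic = p%:E.
Proof.
move=> /andP[p0 p1].
rewrite /uniform01 /uniform_prob integral_uniform_pdf.
have -> : `]-oo, p]%classic `&` `[0, 1]%classic = `[0, p]%classic :> set R.
  apply/seteqP; split => x /=; rewrite !in_itv/=.
    by move=> [xp /andP[-> _]].
  by move=> /andP[-> xp]; rewrite xp (le_trans xp).
rewrite (eq_integral (fun=> 1%:E)); last first.
  move=> x; rewrite inE/= in_itv/= => /andP[x0 xp].
  by rewrite /uniform_pdf x0 (le_trans xp p1) subr0 invr1.
rewrite integral_cst//= mul1e lebesgue_measure_itv/= lte_fin.
by case: ltgtP p0 => // [_ _|<- _]; rewrite ?sube0.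
Qed.

Lemma uniform_squareE (A : set (R * R)) : measurable A ->
  uniform_square A = (\int[uniform01]_x uniform01 (xsection A x))%E.
Proof.
move=> mA; rewrite /uniform_square /product_measure1.
have := @ge0_integral_measurableTypeR R (uniform_prob (@ltr01 R)) (fun x => uniform01 (xsection A x)).
move=> H; apply/esym; apply: H => [|x]; last exact: measure_ge0.
exact: (@measurable_fun_xsection _ _ R R R uniform01).
Qed.

(* Only the values of a quantile function on ]0, 1[ are meaningful. *)
Definition clip01 (u : R) : R := if 0 < u < 1 then u else 1 / 2.

Lemma clip01_itv u : 0 < clip01 u < 1.
Proof. by rewrite /clip01; case: ifPn => // _; lra. Qed.

Lemma clip01_id u : 0 < u < 1 -> clip01 u = u.
Proof. by rewrite /clip01 => ->. Qed.

Lemma measurable_clip01 : measurable_fun setT clip01.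
Proof.
apply: measurable_fun_ifT => //.
by apply: measurable_and; exact: measurable_fun_ltr.
Qed.

Lemma measurable_set_le d (T : measurableType d) (f g : T -> R) :
  measurable_fun setT f -> measurable_fun setT g -> measurable [set x | f x <= g x].
Proof.
move=> mf mg; rewrite -[X in measurable X]setTI.
exact: (measurable_fun_ler mf mg measurableT (_ : measurable [set true])).
Qed.

(** Clipping changes only the points outside []0, 1[], which form a null set. *)
Lemma uniform01_clip (p : R) : 0 <= p <= 1 -> uniform01 [set u | clip01 u <= p] = p%:E.
Proof.
move=> p01; have /andP[p0 p1] := p01.
have mI (q : R) : measurable `]-oo, q]%classic by exact: measurable_itv.
have mC : measurable [set u : R | clip01 u <= p].
  by apply: measurable_set_le => //; exact: measurable_clip01.
have U0 : uniform01 `]-oo, 0]%classic = 0%E by rewrite uniform01_itvNyc// lexx ler01.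
have U1 : uniform01 `[1, +oo[%classic = 0%E.
  rewrite /uniform01 /uniform_prob integral_uniform_pdf.
  rewrite (_ : _ `&` _ = [set 1]) ?integral_set1//.
  apply/seteqP; split => x /=; rewrite !in_itv/= ?andbT.
    by move=> [x1 /andP[_ x1']]; apply/eqP; rewrite eq_le x1 x1'.
  by move=> ->; rewrite lexx ler01.
have U : (uniform01 (`]-oo, 0%R]%classic `|` `[1%R, +oo[%classic) <= 0)%E.
  by rewrite -[leRHS]adde0 -[X in (_ <= X + _)%E]U0 -U1; exact: measureU2.
apply/eqP; rewrite eq_le; apply/andP; split.
  rewrite -uniform01_itvNyc//.
  apply: (@le_trans _ _ (uniform01 (`]-oo, p]%classic `|` (`]-oo, 0]%classic `|` `[1, +oo[%classic)))).
    apply: le_measure; rewrite ?inE//; first by repeat apply: measurableU.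
    move=> u /=; rewrite /clip01 !in_itv/= andbT.
    by case: ifPn => [_ ->|]; [left|rewrite negb_and -!leNgt => /orP[] h _; right; [left|right]].
  apply: (le_trans (measureU2 _ _ _)) => //; first exact: measurableU.
  rewrite -[leRHS]adde0; apply: leeD2l.
  exact: U.
rewrite -uniform01_itvNyc//.
apply: (@le_trans _ _ (uniform01 ([set u | clip01 u <= p] `|` (`]-oo, 0]%classic `|` `[1, +oo[%classic)))).
  apply: le_measure; rewrite ?inE//; first by repeat apply: measurableU.
  move=> u /=; rewrite /clip01 !in_itv/= andbT => up.
  by case: ifPn => [_|]; [left|rewrite negb_and -!leNgt => /orP[] h; right; [left|right]].
apply: (le_trans (measureU2 _ _ _)) => //; first exact: measurableU.
rewrite -[leRHS]adde0; apply: leeD2l.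
exact: U.
Qed.

Lemma probability_cdf_unique (mu nu : probability R R) :
  (forall a, mu `]-oo, a]%classic = nu `]-oo, a]%classic) ->
  forall A, measurable A -> mu A = nu A.
Proof.
move=> munu A mA.
have rayE (m : probability R R) x : m `]x, +oo[%classic = (1 - m `]-oo, x]%classic)%E.
  by rewrite -setCitvl probability_setC.
have GA : <<s (@RGenOInfty.G R)>> A.
  by have := mA; rewrite -[X in _ -> X]/((@measurable _ (g_sigma_algebraType (@RGenOInfty.G R))) A) -RGenOInfty.measurableE.
apply: (@g_sigma_algebra_measure_unique _ R R (@RGenOInfty.G R) _ (fun n => `](- n%:R : R), +oo[%classic) _ _ mu nu _ _ _ _ GA).
- by move=> _ [x ->]; exact: measurable_itv.
- by move=> n; exists (- n%:R).
- apply/seteqP; split => // x _; exists (Num.truncn `|x|).+1 => //=.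
  rewrite in_itv/= andbT ltrNl; apply: le_lt_trans (truncnS_gt _).
  by rewrite -normrN ler_norm.
- move=> _ _ [x ->] [y ->]; exists (Num.max x y).
  by apply/seteqP; split => z /=; rewrite !in_itv/= !andbT gt_max; [case=> -> ->|move=> /andP[]].
- move=> _ [x ->]; apply: etrans (rayE mu x) (etrans _ (esym (rayE nu x))).
  by rewrite munu.
- by move=> k; exact: le_lt_trans (probability_le1 mu _) (ltry 1).
Qed.

Lemma measurable_fun_rays d (T : measurableType d) (f : T -> R) :
  (forall a, measurable [set x | f x <= a]) -> measurable_fun setT f.
Proof.
move=> H; apply: (measurability _ (RGenOInfty.measurableE R)) => //= _ [_ [x ->] <-].
rewrite setTI (_ : _ @^-1` _ = ~` [set y | f y <= x]); first exact: measurableC.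
by apply/seteqP; split => y /=; rewrite in_itv/= andbT ltNge => /negP.
Qed.

(** By [quantile_le], the sublevel sets compare the measurable level with the measurable value of
    the distribution function. *)
Lemma measurable_quantile d (T : measurableType d) (pi : T -> set R -> \bar R) (u : T -> R) :
  (forall x, exists mu : probability R R, forall b, pi x `]-oo, b]%classic = mu `]-oo, b]%classic) ->
  (forall a, measurable_fun setT (fun x => fine (pi x `]-oo, a]%classic))) ->
  measurable_fun setT u ->
  measurable_fun setT (fun x => measure_quantile (pi x) (clip01 (u x))).
Proof.
move=> piP mpi mu; apply: measurable_fun_rays => a.
rewrite (_ : [set x | _] = [set x | clip01 (u x) <= fine (pi x `]-oo, a]%classic)]).
  by apply: measurable_set_le => //; apply: measurableT_comp => //; exact: measurable_clip01.
apply/seteqP; split => x /=; have [nu nuE] := piP x;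
  by rewrite (@quantile_le _ _ nu) ?clip01_itv// probability_fin// lee_fin nuE.
Qed.

Lemma quantile_law (pi : set R -> \bar R) (mu : probability R R) :
  (forall b, pi `]-oo, b]%classic = mu `]-oo, b]%classic) ->
  forall A, measurable A -> uniform01 ((fun u => measure_quantile pi (clip01 u)) @^-1` A) = mu A.
Proof.
move=> piE; pose f (u : R) := measure_quantile pi (clip01 u).
have mf : measurable_fun setT f.
  apply: (@measurable_quantile _ _ (fun=> pi)) => //; by move=> _; exists mu.
pose nu0 := measure_function_pushforward__canonical__measure_function_Measure uniform01 mf.
have nu01 : nu0 setT = 1%E by rewrite /nu0/= /pushforward preimage_setT probability_setT.
have [nu nuE] := probability_of_measure nu01.
move=> A mA; rewrite -[LHS]nuE; move: A mA; apply: probability_cdf_unique => a.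
rewrite nuE /= /pushforward.
rewrite (_ : _ @^-1` _ = [set u : R | clip01 u <= fine (mu `]-oo, a]%classic)]).
  rewrite uniform01_clip -?probability_fin// fine_ge0//= -lee_fin -probability_fin//.
  exact: probability_le1.
apply/seteqP; split => u /=; rewrite in_itv/=;
  by rewrite (@quantile_le _ _ mu) ?clip01_itv// probability_fin// lee_fin.
Qed.

End uniform.

(** * Law of a particle given the previous ones *)

Section transition.
Context {R : realType}.
Variables (rho sigma c : R) (eta1 : probability R R).
Hypothesis sigma_gt0 : 0 < sigma.
Variable N : nat.
Hypothesis N_gt0 : (0 < N)%N.
Implicit Types (x : 'I_N -> R) (past : option ('I_N -> R)).

Definition clip2 (z : R * R) : R * R := (clip01 z.1, clip01 z.2).

Lemma gaussE m A : gauss m sigma A = normal_prob m sigma A.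
Proof. by rewrite gauss.unlock. Qed.

Lemma sum_potential_gt0 x : 0 < \sum_(m < N) potential c (x m).
Proof.
case: N N_gt0 x => // n _ x.
by rewrite big_ord_recl ltr_pwDl ?expR_gt0// sumr_ge0// => i _; exact: expR_ge0.
Qed.

Lemma weight_ge0 x n : 0 <= weight c x n.
Proof. by rewrite divr_ge0 ?expR_ge0// ltW// sum_potential_gt0. Qed.

Lemma sum_weight x : \sum_n weight c x n = 1.
Proof. by rewrite -mulr_suml divff// gt_eqF// sum_potential_gt0. Qed.

Lemma weighted_empirical_ex x : exists P : probability R R,
  (forall A, P A = weighted_empirical c x A) /\
  forall f, bounded_measurable f -> expect P f = \sum_i weight c x i * f (x i).
Proof. by apply: weighted_ex; [exact: weight_ge0|exact: sum_weight]. Qed.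

Definition ray_mass (a z : R) : R := mutate rho sigma \1_(`]-oo, a]%classic) z.

Lemma ray_massE a z : mutation rho sigma z `]-oo, a]%classic = (ray_mass a z)%:E.
Proof.
by rewrite /ray_mass /mutate expect_indic// -probability_fin// gaussE.
Qed.

Lemma bm_ray_mass a : bounded_measurable (ray_mass a).
Proof. by apply: bm_mutate; [rewrite gt_eqF|exact: bm_indic]. Qed.

Lemma ray_mass01 a z : 0 <= ray_mass a z <= 1.
Proof.
rewrite /ray_mass /mutate expect_indic// fine_ge0//= -lee_fin -probability_fin//.
exact: probability_le1.
Qed.

(* [None] stands for the initial time, where there is no past particle. *)
Definition transition past (z : R * R) : R :=
  if past is Some x then
    measure_quantile (mutation rho sigma (measure_quantile (weighted_empirical c x) z.1)) z.2
  else measure_quantile eta1 z.1.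

(** The distribution function of a new particle given the past ones, as an explicit real
    expression. *)
Definition predicted_freq past (a : R) : R :=
  if past is Some x then \sum_(m < N) weight c x m * ray_mass a (x m)
  else fine (eta1 `]-oo, a]%classic).

Lemma mutation_ex z : exists mu : probability R R,
  forall b, mutation rho sigma z `]-oo, b]%classic = mu `]-oo, b]%classic.
Proof. by exists (gauss (rho * z) sigma) => b; rewrite gaussE. Qed.

Lemma measurable_transition past : measurable_fun setT (transition past \o clip2).
Proof.
case: past => [x|].
  apply: (@measurable_quantile _ _ _ (fun z => mutation rho sigma (measure_quantile (weighted_empirical c x) (clip01 z.1))) snd) => //.
  - by move=> z; exact: mutation_ex.
  - move=> a; under eq_fun do rewrite ray_massE/=.
    apply: measurableT_comp; first by have [] := bm_ray_mass a.
    apply: (@measurable_quantile _ _ _ (fun=> weighted_empirical c x) fst) => //.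
    by move=> _; have [P [PE _]] := weighted_empirical_ex x; exists P => b; rewrite PE.
apply: (@measurable_quantile _ _ _ (fun=> eta1) fst) => //.
by move=> _; exists eta1.
Qed.

(** Fubini on the square: for a fixed ancestor the second coordinate samples the gaussian mutation,
    and the first one samples the ancestor from the weighted empirical measure. *)
Lemma transition_ray past a :
  uniform_square [set z | transition past (clip2 z) <= a] = (predicted_freq past a)%:E.
Proof.
have mA : measurable [set z | transition past (clip2 z) <= a].
  by apply: measurable_set_le => //; exact: (measurable_transition past).
rewrite uniform_squareE//; case: past mA => [x|] mA.
  pose q (u : R) := measure_quantile (weighted_empirical c x) (clip01 u).
  have [P [PE PX]] := weighted_empirical_ex x.
  have PE' b : weighted_empirical c x `]-oo, b]%classic = P `]-oo, b]%classic by rewrite PE.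
  have mq : measurable_fun setT q.
    by apply: (@measurable_quantile _ _ _ (fun=> weighted_empirical c x) id) => // _; exists P.
  rewrite (eq_integral (fun u => (ray_mass a (q u))%:E)); last first.
    move=> u _; rewrite (_ : xsection _ _ = [set y : R | clip01 y <= ray_mass a (q u)]) ?uniform01_clip ?ray_mass01//.
    rewrite xsectionE; apply/seteqP; split => y /=;
      rewrite (@quantile_le _ _ (gauss (rho * q u) sigma)) ?clip01_itv//=; try (by move=> b; rewrite gaussE);
      by rewrite gaussE -/(mutation rho sigma (q u) _) ray_massE lee_fin.
  have bG := bm_ray_mass a; have [mG _] := bG.
  rewrite /predicted_freq -PX// -expectE//.
  rewrite -(eq_set_function_integral _ _ (quantile_law PE')).
  rewrite ge0_integral_pushforward//.
  - by apply/measurable_EFinP.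
  - by move=> y _; rewrite lee_fin; case/andP: (ray_mass01 a y).
rewrite (eq_integral (fun u => (\1_[set u | measure_quantile eta1 (clip01 u) <= a] u)%:E)); last first.
  move=> u _; rewrite xsectionE indicE; case: (boolP (u \in _)) => [|].
    rewrite inE /= => ua; rewrite (_ : _ @^-1` _ = setT) ?probability_setT//.
    by apply/seteqP; split => y.
  rewrite notin_setE/= => ua; rewrite (_ : _ @^-1` _ = set0) ?measure0//.
  by apply/seteqP; split => y.
have mS : measurable [set u : R | measure_quantile eta1 (clip01 u) <= a].
  apply: measurable_set_le => //.
  by apply: (@measurable_quantile _ _ _ (fun=> eta1) id) => // _; exists eta1.
rewrite integral_indic// setIT -probability_fin//.
rewrite -(@quantile_law _ eta1 eta1)//; congr (uniform01 _).
Qed.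

End transition.

(** * Independence of the point sets *)

Section cylinders.
Context {R : realType}.
Variables (N t : nat).

Definition cylinder (A : nat -> 'I_N -> set (R * R)) : set (nat -> 'I_N -> R * R) :=
  [set u | forall s n, (0 < s <= t)%N -> A s n (u s n)].

(** A class stable under intersection: laws that agree on it agree on the generated
    sigma-algebra. *)
Definition cylinders : set (set (nat -> 'I_N -> R * R)) :=
  [set cylinder A | A in [set A | forall s n, measurable (A s n)]].

Lemma cylinderE A : cylinder A =
  \bigcap_(p in [set p : 'I_t.+1 * 'I_N | (0 < p.1)%N]) [set u | A p.1 p.2 (u p.1 p.2)].
Proof.
apply/seteqP; split => u /= H.
  by move=> [s n] /= s0; apply: H; rewrite s0 -ltnS ltn_ord.
move=> s n /andP[s0 st]; rewrite -ltnS in st.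
exact: (H (Ordinal st, n)).
Qed.

Context d (Omega : measurableType d).
Implicit Types (V : Omega -> nat -> 'I_N -> R * R).

Definition measurable_points V := forall s n, (0 < s <= t)%N -> measurable_fun setT (fun w => V w s n).

Lemma measurable_cylinder V A : measurable_points V -> (forall s n, measurable (A s n)) ->
  measurable (V @^-1` cylinder A).
Proof.
move=> mV mA; rewrite cylinderE preimage_bigcap; apply: fin_bigcap_measurable.
  exact: finite_finset.
move=> [s n] /= s0; rewrite -[X in measurable X]setTI.
have mVs : measurable_fun setT (fun w => V w s n) by apply: mV; rewrite s0 -ltnS ltn_ord.
exact: (mVs measurableT _ (mA s n)).
Qed.

Lemma measurable_points_fun V : measurable_points V ->
  measurable_fun setT (V : Omega -> g_sigma_algebraType cylinders).
Proof.
move=> mV; apply: (@measurability _ _ _ (g_sigma_algebraType cylinders) _ _ cylinders) => // _ [_ [A mA <-] <-].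
by rewrite setTI; exact: measurable_cylinder.
Qed.

(** Independence and uniformity up to time [t] in a single product formula on cylinders, a form that
    depends on no fixed probability space. *)
Definition iid_points (P : set Omega -> \bar R) V := measurable_points V /\
  forall A, (forall s n, measurable (A s n)) ->
    P (V @^-1` cylinder A) = (\prod_(1 <= s < t.+1) \prod_(n < N) fine (uniform_square (A s n)))%:E.

End cylinders.
Arguments iid_points {R N} t {d Omega} P V.

Section uniform_square.
Context {R : realType}.

Lemma uniform_squareT : uniform_square [set: R * R] = 1%E.
Proof.
rewrite uniform_squareE// (eq_integral (fun=> 1%E)); last first.
  by move=> x _; rewrite xsectionE preimage_setT probability_setT.
by rewrite integral_cst// mul1e; exact: (@probability_setT _ _ R (uniform01 : probability R R)).
Qed.

Lemma uniform_square_prod (A : set (R * R)) : measurable A ->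
  uniform_square A = (uniform01 \x uniform01)%E A.
Proof. exact: uniform_squareE. Qed.

End uniform_square.

(** * Resampling the last points *)

Section same_law.
Context {R : realType} (N t : nat).
Context d (Omega : measurableType d) d' (Omega' : measurableType d').

Lemma iid_points_law (P : probability Omega R) (P' : probability Omega' R) V V' :
  iid_points t P V -> iid_points t P' V' ->
  forall B : set (nat -> 'I_N -> R * R), <<s @cylinders R N t >> B ->
  P (V @^-1` B) = P' (V' @^-1` B).
Proof.
move=> [mV PV] [mV' PV'] B mB.
have f1 := measurable_points_fun mV; have f2 := measurable_points_fun mV'.
pose m1 := measure_function_pushforward__canonical__measure_function_Measure P f1.
pose m2 := measure_function_pushforward__canonical__measure_function_Measure P' f2.
rewrite -[LHS]/(m1 B) -[RHS]/(m2 B).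
have K := (@g_sigma_algebra_measure_unique _ R (g_sigma_algebraType (@cylinders R N t)) (@cylinders R N t) _ (fun=> setT) _ _ m1 m2 _ _ _ _ mB).
apply: K.
- exact: sub_sigma_algebra.
- move=> _; exists (fun _ _ => setT) => //.
  by apply/seteqP; split.
- by rewrite bigcup_const.
- move=> _ _ [A mA <-] [A' mA' <-]; exists (fun s n => A s n `&` A' s n).
    by move=> s n; exact: measurableI.
  apply/seteqP; split => u /= H; last by move=> s n sn; split; apply H.
  by split => s n sn; have [] := H s n sn.
- by move=> _ [A mA <-]; apply: etrans (PV _ mA) (esym (PV' _ mA)).
- by move=> _; rewrite /m1/= /pushforward preimage_setT probability_setT ltry.
Qed.

End same_law.

Section splice.
Context {R : realType} (N t : nat).
Context d (Omega : measurableType d) (P : probability Omega R).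
Variable V : Omega -> nat -> 'I_N -> R * R.
Hypothesis VP : iid_points t P V.

Definition splice (u v : nat -> 'I_N -> R * R) s n := if (s < t)%N then u s n else v s n.

(** The preimage of a cylinder is a rectangle: the constraints before [t] bear on the first copy,
    those at [t] on the second one. *)
Lemma iid_points_splice :
  iid_points t (P \x P)%E (fun w : Omega * Omega => splice (V w.1) (V w.2)).
Proof.
have [mV PV] := VP.
split => [s n st|A mA].
  rewrite /splice; case: (s < t)%N.
    exact: (measurableT_comp (mV _ _ st) measurable_fst).
  exact: (measurableT_comp (mV _ _ st) measurable_snd).
pose A1 s n := if (s < t)%N then A s n else setT.
pose A2 s n := if (s < t)%N then setT else A s n.
have mA1 s n : measurable (A1 s n) by rewrite /A1; case: ifP.
have mA2 s n : measurable (A2 s n) by rewrite /A2; case: ifP.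
have -> : (fun w : Omega * Omega => splice (V w.1) (V w.2)) @^-1` cylinder t A =
    (V @^-1` cylinder t A1) `*` (V @^-1` cylinder t A2).
  apply/seteqP; split => -[w w'] /=.
    by move=> H; split => s n st; have := H s n st; rewrite /A1 /A2 /splice; case: ifP.
  by move=> [H1 H2] s n st; have := H1 s n st; have := H2 s n st;
     rewrite /A1 /A2 /splice; case: ifP.
rewrite product_measure1E; [|exact: measurable_cylinder..].
rewrite [X in (X * _)%E](PV _ mA1) [X in (_ * X)%E](PV _ mA2) -EFinM -big_split/=; congr EFin.
apply: eq_bigr => s _; rewrite -big_split/=; apply: eq_bigr => n _.
by rewrite /A1 /A2; case: ifP; rewrite uniform_squareT /= ?mul1r ?mulr1.
Qed.

End splice.

(** * Particles as measurable functions of the points *)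

Section particle_measurability.
Context {R : realType}.
Variables (rho sigma c : R) (eta1 : probability R R).
Hypothesis sigma_gt0 : 0 < sigma.
Variable N : nat.
Hypothesis N_gt0 : (0 < N)%N.

Local Notation particles := (particles rho sigma c eta1).
Local Notation transition := (transition rho sigma c eta1).
Local Notation predicted_freq := (predicted_freq rho sigma c eta1).
Implicit Types (u v : nat -> 'I_N -> R * R).

Definition past_of u (t : nat) : option ('I_N -> R) :=
  if t is t'.+2 then Some (particles u t'.+1) else None.

Lemma particlesE u t n : (0 < t)%N -> particles u t n = transition (past_of u t) (u t n).
Proof. by case: t => [|[]]. Qed.

(** Causality: later points have no influence, so splicing new points at [t] leaves the earlier
    particles unchanged. *)
Lemma eq_particles u v t : (forall s n, (0 < s <= t)%N -> u s n = v s n) ->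
  particles u t = particles v t.
Proof.
elim: t => [//|t IH] uv; apply/funext => n; rewrite !particlesE// uv; last by rewrite leqnn.
have -> : past_of u t.+1 = past_of v t.+1; last by [].
case: t IH uv => [|t] IH uv; first exact: erefl.
have uv' s m : (0 < s <= t.+1)%N -> u s m = v s m.
  move=> /andP[s0 st]; apply: uv; apply/andP; split; [exact: s0|exact: leqW st].
exact: (f_equal (@Some _) (IH uv')).
Qed.

Definition clipped u : nat -> 'I_N -> R * R := fun s n => clip2 (u s n).

Context d (Omega : measurableType d) (t : nat) (V : Omega -> nat -> 'I_N -> R * R).
Hypothesis mV : measurable_points t V.

Lemma measurable_potential : measurable_fun setT (potential c).
Proof.
apply: measurableT_comp => //; apply: measurableT_comp => //; apply: measurable_funM => //.
by apply: measurable_funM => //; apply: measurable_funX.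
Qed.

Lemma measurable_weight (x : Omega -> 'I_N -> R) n :
  (forall m, measurable_fun setT (fun w => x w m)) ->
  measurable_fun setT (fun w => weight c (x w) n).
Proof.
move=> mx; rewrite /weight.
have mp m : measurable_fun setT (fun w => potential c (x w m)).
  exact: measurableT_comp measurable_potential (mx m).
apply: measurable_funM => //.
(* The sum is positive, so its inverse is [expR (- ln _)], a composition of measurable functions. *)
rewrite (_ : (fun w => _) = (fun w => expR (- ln (\sum_(m < N) potential c (x w m))))).
  apply: measurableT_comp => //; apply: measurableT_comp => //.
  apply: measurableT_comp; first exact: measurable_ln.
  exact: (@measurable_sum _ _ _ _ _ (index_enum 'I_N) (fun m w => potential c (x w m))).
apply/funext => w; rewrite expRN lnK// posrE; exact: sum_potential_gt0.
Qed.

Lemma measurable_particles s n : (0 < s <= t)%N ->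
  measurable_fun setT (fun w => particles (clipped (V w)) s n).
Proof.
elim: s n => [//|s IH] n /andP[_ st].
have mVs : measurable_fun setT (fun w => V w s.+1 n) by apply: mV.
case: s IH st mVs => [|s] IH st mVs.
  apply: (@measurable_quantile _ _ _ (fun=> eta1) (fun w => (V w 1%N n).1)) => //.
    by move=> _; exists eta1.
  exact: measurableT_comp mVs.
have mx m : measurable_fun setT (fun w => particles (clipped (V w)) s.+1 m).
  by apply: IH; rewrite /= ltnW.
pose q w := measure_quantile (weighted_empirical c (particles (clipped (V w)) s.+1))
  (clip01 (V w s.+2 n).1).
apply: (@measurable_quantile _ _ _ (fun w => mutation rho sigma (q w)) (fun w => (V w s.+2 n).2)) => //.
- by move=> w; exact: mutation_ex.
- move=> a; under eq_fun do rewrite ray_massE//=.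
  apply: measurableT_comp; first by have [] := bm_ray_mass rho sigma_gt0 a.
  apply: (@measurable_quantile _ _ _ (fun w => weighted_empirical c (particles (clipped (V w)) s.+1)) (fun w => (V w s.+2 n).1)).
  + move=> w; have [P [PE _]] := weighted_empirical_ex c N_gt0 (particles (clipped (V w)) s.+1).
    by exists P => b; rewrite PE.
  + move=> b.
    rewrite (_ : (fun w => _) = (fun w => \sum_(m < N) weight c (particles (clipped (V w)) s.+1) m *
        \1_(`]-oo, b]%classic) (particles (clipped (V w)) s.+1 m))); last first.
      apply/funext => w; rewrite /weighted_empirical.
      by under eq_bigr do rewrite diracE -EFinM; rewrite sumEFin.
    apply: (@measurable_sum _ _ _ _ _ (index_enum 'I_N) (fun m w => weight c (particles (clipped (V w)) s.+1) m *
        \1_(`]-oo, b]%classic) (particles (clipped (V w)) s.+1 m))) => m.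
    apply: measurable_funM; first exact: measurable_weight.
    exact: measurableT_comp (mx m).
  + exact: measurableT_comp mVs.
- exact: measurableT_comp mVs.
Qed.

(** A property of a realisation of the points rather than an event, so that it can be moved from one
    probability space to another. *)
Definition deviating u (e : R) : Prop := exists q : rat,
  e < `|empirical_freq (particles (clipped u) t) `]-oo, ratr q]%classic -
        predicted_freq (past_of (clipped u) t) (ratr q)|.

Hypothesis t_gt0 : (0 < t)%N.

Lemma measurable_deviating e : measurable [set w | deviating (V w) e].
Proof.
rewrite (_ : [set w | _] = \bigcup_(q : rat) [set w | e <
  `|empirical_freq (particles (clipped (V w)) t) `]-oo, ratr q]%classic -
        predicted_freq (past_of (clipped (V w)) t) (ratr q)|]); last first.
  by apply/seteqP; split => [w [q H]|w [q _ H]]; exists q.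
apply: bigcupT_measurable_rat => q.
rewrite (_ : [set w | _] = ~` [set w |
  `|empirical_freq (particles (clipped (V w)) t) `]-oo, ratr q]%classic -
        predicted_freq (past_of (clipped (V w)) t) (ratr q)| <= e]); last first.
  by apply/seteqP; split => w /=; rewrite ltNge => /negP.
apply: measurableC; apply: measurable_set_le => //.
apply: measurableT_comp => //; apply: measurable_funB.
  apply: measurable_funM => //.
  apply: (@measurable_sum _ _ _ _ _ (index_enum 'I_N) (fun m w => \1_(`]-oo, ratr q]%classic) (particles (clipped (V w)) t m))) => m.
  by apply: measurableT_comp => //; apply: measurable_particles; rewrite t_gt0 leqnn.
move: t_gt0 measurable_particles; case: t => [//|[|s]] _ mp; first exact: measurable_cst.
have mx m : measurable_fun setT (fun w => particles (clipped (V w)) s.+1 m).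
  by apply: mp; rewrite /= leqnSn.
apply: (@measurable_sum _ _ _ _ _ (index_enum 'I_N) (fun m w =>
  weight c (particles (clipped (V w)) s.+1) m * ray_mass rho sigma (ratr q) (particles (clipped (V w)) s.+1 m))) => m.
apply: measurable_funM; first exact: measurable_weight.
by apply: measurableT_comp => //; have [] := bm_ray_mass rho sigma_gt0 (ratr q).
Qed.

End particle_measurability.

Section iid_uniform.
Context {R : realType} d (Omega : measurableType d) (P : probability Omega R).
Variables (N : nat) (U : nat -> 'I_N -> {RV P >-> (R * R)%type}).

Lemma iid_uniform_pointsP t : iid_uniform_points U ->
  iid_points t P (fun w s n => U s n w).
Proof.
move=> [_ dU iU]; split => [s n _|A mA]; first exact: measurable_funP.
pose s0 := [seq (s, n) | s <- index_iota 1 t.+1, n <- index_enum 'I_N].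
have us0 : uniq s0.
  by rewrite allpairs_uniq ?iota_uniq ?index_enum_uniq// => -[? ?] [? ?].
pose J := seq_fset tt s0.
have inJ p : (p \in J) = (0 < p.1 <= t)%N.
  rewrite seq_fsetE; apply/allpairsP/idP.
    by move=> [[s n] [/= + _ ->]]; rewrite mem_index_iota.
  move=> pt; exists p; split; rewrite ?mem_index_enum ?mem_index_iota ?ltnS//.
  by case: p pt.
have := iU J (fun p => A p.1 p.2).
move=> /(_ _ (fun p _ => mA p.1 p.2)) => H.
rewrite [LHS](_ : _ = P (\bigcap_(i in [set` J]) (U i.1 i.2 @^-1` A i.1 i.2))).
  rewrite H; last by move=> p /=; rewrite inJ => /andP[].
  rewrite (perm_big _ (seq_fset_perm tt s0)) undup_id//=.
  rewrite (eq_big_seq (fun p => (fine (uniform_square (A p.1 p.2)))%:E)); last first.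
    move=> p ps0.
    have pt : (0 < p.1 <= t)%N by rewrite -inJ seq_fsetE.
    rewrite -(dU p.1 p.2)//; last by case/andP: pt.
    by rewrite fineK// fin_num_measure.
  by rewrite prodEFin big_allpairs.
congr (P _); apply/seteqP; split => w /= Hw.
  by move=> [s n]/=; rewrite inJ => st; exact: Hw.
by move=> s n st; apply: (Hw (s, n)); rewrite /= inJ.
Qed.

End iid_uniform.

(** On the canonical space the coordinates are measurable, so that [deviating] defines a set of the
    sigma-algebra generated by cylinders. *)
Lemma measurable_points_id {R : realType} (N t : nat) :
  measurable_points t (id : g_sigma_algebraType (@cylinders R N t) -> nat -> 'I_N -> R * R).
Proof.
move=> s n st _ B mB; rewrite setTI; apply: sub_sigma_algebra.
exists (fun s' n' => if (s' == s) && (n' == n) then B else setT).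
  by move=> s' n'; case: ifP.
apply/seteqP; split => u /=.
  by move=> /(_ s n st); rewrite !eqxx.
by move=> Bu s' n' _; case: ifP => // /andP[/eqP -> /eqP ->].
Qed.

Section deviating.
Context {R : realType}.
Variables (rho sigma c : R) (eta1 : probability R R).
Hypothesis sigma_gt0 : 0 < sigma.
Variable N : nat.
Hypothesis N_gt0 : (0 < N)%N.

Local Notation particles := (particles rho sigma c eta1).
Local Notation transition := (transition rho sigma c eta1).
Local Notation predicted_freq := (predicted_freq rho sigma c eta1).
Local Notation past_of := (past_of rho sigma c eta1).
Implicit Types (past : option ('I_N -> R)).

Lemma predicted_ex past : exists nu : probability R R,
  forall a, nu `]-oo, a]%classic = (predicted_freq past a)%:E.
Proof.
case: past => [x|]; last by exists eta1 => a; rewrite -probability_fin.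
have [mu [_ muE]] := weighted_empirical_ex c N_gt0 x.
have [nu [_ nuE]] := mutated_ex rho mu (lt0r_neq0 sigma_gt0).
exists nu => a; rewrite probability_fin// -expect_indic// nuE; last exact: bm_indic.
by rewrite [expect _ _]muE//; exact: (bm_ray_mass rho sigma_gt0).
Qed.

Lemma transition_law past (nu : probability R R) :
  (forall a, nu `]-oo, a]%classic = (predicted_freq past a)%:E) ->
  forall B, measurable B -> uniform_square ((transition past \o @clip2 R) @^-1` B) = nu B.
Proof.
move=> nuE B mB; have mT := measurable_transition rho c eta1 sigma_gt0 N_gt0 past.
have mTB A : measurable A -> measurable ((transition past \o @clip2 R) @^-1` A).
  by move=> mA; rewrite -[X in measurable X]setTI; exact: mT.
pose m := measure_function_pushforward__canonical__measure_function_Measure (uniform01 \x uniform01)%E mT.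
have m1 : m setT = 1%E.
  by rewrite /m/= /pushforward preimage_setT -uniform_square_prod ?uniform_squareT.
have [Q QE] := probability_of_measure m1.
rewrite uniform_square_prod; last exact: mTB.
rewrite -[LHS]/(m B) -QE; move: B mB; apply: probability_cdf_unique => a.
rewrite QE nuE -[LHS]/((uniform01 \x uniform01)%E ((transition past \o @clip2 R) @^-1` `]-oo, a]%classic)).
by rewrite -uniform_square_prod ?transition_ray//; exact: mTB.
Qed.

Context d (Omega : measurableType d) (P : probability Omega R) (t : nat).
Variable V : Omega -> nat -> 'I_N -> R * R.
Hypothesis VP : iid_points t P V.
Hypothesis t_gt0 : (0 < t)%N.
Variables (e : R) (K : nat).
Hypotheses (e01 : 0 < e <= 1) (K_gt0 : (0 < K)%N) (Ke : K%:R^-1 <= e / 2).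

Let delta : R := 2 * K%:R * expR (- (N%:R * e ^+ 2 / 32)).

(** With [past] frozen, the new particles are independent draws from [nu]. *)
Lemma new_points_deviation past (nu : probability R R) :
  (forall a, nu `]-oo, a]%classic = (predicted_freq past a)%:E) ->
  (P (deviation (fun n w => transition past (clip2 (V w t n))) nu e) <= delta%:E)%E.
Proof.
move=> nuE; have [mV PV] := VP.
have mT := measurable_transition rho c eta1 sigma_gt0 N_gt0 past.
have mTB A : measurable A -> measurable ((transition past \o @clip2 R) @^-1` A).
  by move=> mA; rewrite -[X in measurable X]setTI; exact: mT.
apply: deviation_le => // [n|J B mB].
  by apply: (measurableT_comp mT); apply: mV; rewrite t_gt0 leqnn.
(* A cylinder that constrains only the points of time [t] with index in [J]; all other factors equal
   1. *)
pose A s n := if (s == t) && (n \in J) then (transition past \o @clip2 R) @^-1` B else setT.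
have mA s n : measurable (A s n) by rewrite /A; case: ifP => // _; exact: mTB.
have := PV A mA; rewrite (_ : V @^-1` _ =
  \bigcap_(i in [set` J]) ((fun w => transition past (clip2 (V w t i))) @^-1` B)).
  move=> ->; congr EFin.
  rewrite big_nat_recr//= big1_seq ?mul1r; last first.
    move=> s; rewrite mem_index_iota => /andP[_ /andP[_ st]].
    by apply: big1 => n _; rewrite /A ltn_eqF//= uniform_squareT.
  rewrite -prodr_const [RHS]big_mkcond/=; apply: eq_bigr => n _.
  by rewrite /A eqxx/=; case: ifP; rewrite ?uniform_squareT// (transition_law nuE).
apply/seteqP; split => w /= Hw.
  move=> n nJ; have := Hw t n; rewrite t_gt0 leqnn /A eqxx/= => /(_ isT).
  by rewrite (_ : n \in J).
by move=> s n _; rewrite /A; case: ifPn => // /andP[/eqP -> nJ]; exact: (Hw n).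
Qed.

(* The points of time [t] can be resampled independently of the past without
   changing the joint law, so that Fubini's theorem reduces the claim to points
   that are independent given a fixed past. *)
Lemma deviating_le :
  (P [set w | deviating rho sigma c eta1 t (V w) e] <= delta%:E)%E.
Proof.
have [mV _] := VP.
have VP2 := iid_points_splice VP.
have mB := @measurable_deviating _ rho sigma c eta1 sigma_gt0 N N_gt0 _ _ t _
  (@measurable_points_id R N t) t_gt0 e.
rewrite [X in (X <= _)%E](iid_points_law VP VP2 mB).
pose C := [set w : Omega * Omega | deviating rho sigma c eta1 t (splice t (V w.1) (V w.2)) e].
have [mV2 _] := VP2.
have mC : measurable C by exact: measurable_deviating.
rewrite [X in (X <= _)%E](_ : _ = \int[P]_w P (xsection C w))%E//.
apply: (@le_trans _ _ (\int[P]_w delta%:E)%E); last first.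
  rewrite integral_cst// [X in (_ * X)%E](@probability_setT _ _ R P) mule1//.
apply: ge0_le_integral => //.
- exact: (@measurable_fun_xsection _ _ _ _ R P).
- move=> w _; set past := past_of (clipped (V w)) t.
  have [nu nuE] := predicted_ex past.
  apply: le_trans (new_points_deviation nuE).
  rewrite le_eqVlt; apply/orP; left; apply/eqP; congr (P _).
  rewrite xsectionE; apply/seteqP.
  (* The past of the spliced points depends on the first copy only, hence is fixed inside the inner
     integral. *)
  have pastE w' : past_of (clipped (splice t (V w) (V w'))) t = past.
    rewrite /past; case: (t) t_gt0 => [//|[|s]] _; first by [].
    have E s' n : (0 < s' <= s.+1)%N -> clipped (splice s.+2 (V w) (V w')) s' n = clipped (V w) s' n.
      by move=> /andP[_ s't]; rewrite /clipped /splice ltnS s't.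
    exact: (f_equal (@Some _) (eq_particles _ _ _ _ E)).
  have partE w' : particles (clipped (splice t (V w) (V w'))) t =
      (fun n => transition past (clip2 (V w' t n))).
    apply/funext => n; rewrite particlesE// pastE /clipped /splice.
    by rewrite ltnn.
  split => w' /= [q]; [move=> H; exists q => //=|move=> _ /= H; exists q];
    by move: H; rewrite /= partE pastE nuE.
Qed.

End deviating.

(** * The particle filter *)

Section feynman_kac.
Context {R : realType}.
Variables (rho sigma c : R) (eta1 : probability R R).
Hypotheses (sigma_gt0 : 0 < sigma) (c_gt0 : 0 < c).

Local Notation G := (potential c).
Local Notation M := (mutate rho sigma).
Local Notation T := (semigroup rho sigma c).

Let bG : bounded_measurable G. Proof. exact: (bm_gauss_potential (ltW c_gt0)). Qed.
Let G_gt0 x : 0 < G x. Proof. exact: expR_gt0. Qed.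
Let bT k f : bounded_measurable f -> bounded_measurable (T k f).
Proof. exact: bm_semigroup. Qed.

Lemma integral_indicM d (X : measurableType d) (mu : probability X R) (A : set X) (f : X -> R) :
  measurable A -> bounded_measurable f ->
  (\int[mu]_(x in A) (f x)%:E = (expect mu (fun x => f x * \1_A x))%:E)%E.
Proof.
move=> mA bf; rewrite -expectE; last by apply: bmM => //; exact: bm_indic.
rewrite integral_mkcond; apply: eq_integral => x _.
by rewrite patchE indicE; case: ifPn; rewrite ?mulr1 ?mulr0.
Qed.

Lemma feynman_kacE z A : measurable A -> feynman_kac rho sigma c z A = (M (T 0 \1_A) z)%:E.
Proof.
move=> mA; rewrite /feynman_kac.
rewrite (@eq_set_function_integral _ _ _ _ (gauss (rho * z) sigma)); last first.
  by move=> B _; rewrite gaussE.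
by rewrite integral_indicM.
Qed.

(** The kernel is a bare set function; it agrees on measurable sets with a scaled tilted gaussian,
    against which the integral is computed. *)
Lemma integral_feynman_kac z f : bounded_measurable f -> (forall x, 0 <= f x) ->
  (\int[feynman_kac rho sigma c z]_x (f x)%:E = (M (T 0 f) z)%:E)%E.
Proof.
move=> bf f0; pose g := gauss (rho * z) sigma.
have g0 : 0 < expect g G by exact: expect_gt0.
have [Q [QE Qf]] := tilt_ex g bG G_gt0.
have [mf _] := bf.
pose r : {nonneg R} := NngNum (ltW g0).
rewrite (@eq_set_function_integral _ _ _ _ (mscale r Q)); last first.
  move=> A mA; rewrite /mscale/= QE// expectE// integral_indicM// inver gt_eqF// -!EFinM.
  rewrite feynman_kacE//; congr EFin.
  by rewrite mulrC divfK// gt_eqF.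
rewrite ge0_integral_mscale//; [|exact/measurable_EFinP|by move=> x _; rewrite lee_fin].
by rewrite (expectE Q bf) Qf// -EFinM /= mulrC divfK// gt_eqF.
Qed.

Lemma semigroup_ge0 k f x : (forall y, 0 <= f y) -> 0 <= T k f x.
Proof.
move=> f0; elim: k x => [|k IH] x /=; rewrite mulr_ge0 ?expR_ge0//.
exact: expect_ge0.
Qed.

Lemma semigroup1_gt0 k x : 0 < T k (fun=> 1) x.
Proof.
have b1 := bm_cst R (1 : R).
elim: k x => [|k IH] x /=; first by rewrite mulr1 expR_gt0.
by rewrite mulr_gt0 ?expR_gt0//; apply: expect_gt0 => //; exact: bT.
Qed.

(** The kernel starts with a mutation whereas [semigroup] starts with a potential: hence the outer
    mutation and the shift of the index. *)
Lemma feynman_kac_powE k z A : measurable A ->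
  feynman_kac_pow rho sigma c k.+1 z A = (M (T k \1_A) z)%:E.
Proof.
move=> mA; elim: k z => [|k IH] z; first exact: feynman_kacE.
apply: etrans (f_equal (fun g : R -> \bar R => \int[feynman_kac rho sigma c z]_y g y)%E (funext IH)) _.
apply: integral_feynman_kac.
- by apply: bm_mutate; [rewrite gt_eqF|apply: bT; exact: bm_indic].
- move=> y; apply: expect_ge0 => x; apply: semigroup_ge0 => w; exact: ltac:(rewrite indicE).
Qed.

Lemma filter_init : exists h : probability R R,
  (forall A, measurable A -> h A = hat_eta1 c eta1 A) /\
  forall f, bounded_measurable f -> expect h f = flow rho sigma c eta1 0 f.
Proof.
have [h [hE hf]] := tilt_ex eta1 bG G_gt0.
exists h; split => [A mA|f bf]; first by rewrite hE.
rewrite hf// /flow /=; congr (_ / expect _ _).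
by apply/funext => x; rewrite mulr1.
Qed.

Definition tilted (mu : probability R R) : probability R R := projT1 (cid (tilt_ex mu bG G_gt0)).

Lemma tiltedE mu f : bounded_measurable f ->
  expect (tilted mu) f = expect mu (fun x => G x * f x) / expect mu G.
Proof. by move=> bf; rewrite /tilted; case: cid => nu /= [_ ->]. Qed.

Definition mutated (mu : probability R R) : probability R R :=
  projT1 (cid (mutated_ex rho mu (lt0r_neq0 sigma_gt0))).

Lemma mutatedE mu f : bounded_measurable f -> expect (mutated mu) f = expect mu (M f).
Proof. by move=> bf; rewrite /mutated; case: cid => nu /= [_ ->]. Qed.

Lemma mutated_measure mu A : measurable A ->
  mutated mu A = (\int[mu]_x mutation rho sigma x A)%E.
Proof.
move=> mA; rewrite /mutated; case: cid => nu /= [-> // _].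
by apply: eq_integral => x _; rewrite gaussE.
Qed.

(* Index [s] stands for time [s + 1]. *)
Fixpoint predictive (s : nat) : probability R R :=
  if s is s'.+1 then mutated (tilted (predictive s')) else eta1.

Definition filtering (s : nat) : probability R R := tilted (predictive s).

(** The exact recursion is a particle flow without sampling error: [flow_shift] applies with
    [predictive] in both roles. *)
Lemma flow_predictive s k f : bounded_measurable f ->
  flow rho sigma c (predictive s) k f = flow rho sigma c eta1 (s + k) f.
Proof.
move=> bf; elim: s k => [//|s IH] k.
rewrite (@flow_shift _ rho sigma c sigma_gt0 c_gt0 predictive predictive filtering)//.
- by rewrite IH addnS.
- by move=> s' g bg; exact: tiltedE.
- by move=> s' g bg; exact: mutatedE.
Qed.

Lemma filteringE s f : bounded_measurable f ->
  expect (filtering s) f = flow rho sigma c eta1 s f.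
Proof.
move=> bf; rewrite tiltedE// -[s in RHS]addn0 -flow_predictive// /flow /=.
congr (_ / expect _ _); by apply/funext => x; rewrite mulr1.
Qed.

Lemma filtering_measure s A : measurable A -> filtering s A = hat_eta rho sigma c eta1 s.+1 A.
Proof.
move=> mA; rewrite probability_fin// -expect_indic// filteringE; last exact: bm_indic.
have [h [hE hf]] := filter_init.
case: s => [|s].
  by rewrite /hat_eta /= -hE// -hf ?expect_indic -?probability_fin//; exact: bm_indic.
(* The normaliser of [hat_eta1] divides both the numerator and the denominator of [hat_eta], and
   cancels. *)
have EB B : measurable B -> measure_kernel (hat_eta1 c eta1) (feynman_kac_pow rho sigma c s.+1) B =
    (expect eta1 (T s.+1 \1_B) / expect eta1 (T 0 (fun=> 1)))%:E.
  move=> mB; rewrite /measure_kernel.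
  rewrite -(eq_set_function_integral _ _ hE).
  rewrite (eq_integral (fun y => (M (T s \1_B) y)%:E)); last by move=> y _; exact: feynman_kac_powE.
  have bM : bounded_measurable (M (T s \1_B)).
    by apply: bm_mutate; [rewrite gt_eqF|apply: bT; exact: bm_indic].
  by rewrite (expectE h bM) hf.
rewrite /hat_eta/= !EB//.
have g0 : 0 < expect eta1 (T 0 (fun=> 1)).
  apply: expect_gt0; last exact: semigroup1_gt0.
  by apply: bT; exact: bm_cst.
have b0 : 0 < expect eta1 (T s.+1 (fun=> 1)).
  apply: expect_gt0; last exact: semigroup1_gt0.
  by apply: bT; exact: bm_cst.
have -> : \1_[set: R] = (fun=> 1) :> (R -> R) by apply/funext => x; rewrite indicT.
move: g0 b0; rewrite /flow.
generalize (expect eta1 (T 0 (fun=> 1))) (expect eta1 (T s.+1 (fun=> 1))) (expect eta1 (T s.+1 \1_A)).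
move=> g b a g0 b0; rewrite inver ifF; last by rewrite gt_eqF// divr_gt0.
by rewrite -EFinM; congr EFin; field; rewrite !gt_eqF.
Qed.

Lemma predictive_measure s A : measurable A -> predictive s A = eta rho sigma c eta1 s.+1 A.
Proof.
move=> mA; case: s => [//|s]; rewrite [LHS]mutated_measure//.
by apply: eq_set_function_integral => B mB; exact: filtering_measure.
Qed.

End feynman_kac.

(** * From the sample size to the failure probability *)

Section sample_size.
Context {R : realType}.

(** Here [kappa / L] is the one-step accuracy and [6 * L / kappa] bounds the number of events of the
    union bound per time step. The exponent must exceed the logarithm of [6 * L / kappa * (T / q)],
    a sum of three terms dominated by the product that defines [sample_size]. *)
Lemma sample_size_tail (L kappa q : R) (T N : nat) :
  1 <= L -> 0 < q < 1 -> 0 < kappa < 1 -> (1 <= T)%N ->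
  sample_size (32 * L ^+ 2 * (1 + ln (6 * L))) T kappa q <= N%:R ->
  T%:R * (6 * L / kappa) * expR (- (N%:R * (kappa / L) ^+ 2 / 32)) <= q.
Proof.
move=> L1 /andP[q0 q1] /andP[k0 k1] T1 HN.
have L0 : 0 < L by lra.
have T0 : 0 < T%:R :> R by rewrite ltr0n.
pose a := ln (6 * L); pose A := ln (1 + kappa^-1); pose B := ln (T%:R / q).
have Tq1 : 1 <= T%:R / q.
  by rewrite ler_pdivlMr// mul1r (le_trans (ltW q1))// ler1n.
have a0 : 0 <= a by apply: ln_ge0; lra.
have B0 : 0 <= B by exact: ln_ge0.
have k1' : 1 <= kappa^-1 by rewrite invf_ge1// ltW.
have A0 : 0 <= A by apply: ln_ge0; lra.
have lnk : ln (kappa^-1) <= A.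
  by rewrite ler_ln ?posrE ?invr_gt0//; lra.
have key : a + ln kappa^-1 + B <= N%:R * (kappa / L) ^+ 2 / 32.
  apply: (@le_trans _ _ ((1 + a) * (1 + A) ^+ 2 * (1 + B))).
    have h1 : 1 + A <= (1 + A) ^+ 2 by nra.
    have h2 : (1 + a) * (1 + A) * (1 + B) <= (1 + a) * (1 + A) ^+ 2 * (1 + B).
      by apply: ler_wpM2r; [lra|apply: ler_wpM2l; [lra|]].
    apply: le_trans h2; have := mulr_ge0 a0 A0; have := mulr_ge0 a0 B0; have := mulr_ge0 A0 B0.
    have := mulr_ge0 (mulr_ge0 a0 A0) B0; nra.
  have h0 : 0 <= (kappa / L) ^+ 2 / 32 by rewrite divr_ge0 ?sqr_ge0.
  rewrite -(mulrA N%:R); apply: le_trans (ler_wpM2r h0 HN).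
  rewrite /sample_size -/a -/A -/B le_eqVlt; apply/orP; left; apply/eqP.
  by field; rewrite !gt_eqF.
have E : expR (a + ln kappa^-1 + B) = 6 * L / kappa * (T%:R / q).
  by rewrite !expRD !lnK ?posrE ?invr_gt0 ?divr_gt0 ?mulr_gt0.
have : expR (- (N%:R * (kappa / L) ^+ 2 / 32)) <= (6 * L / kappa * (T%:R / q))^-1.
  by rewrite -E -expRN ler_expR lerN2.
move=> H; apply: le_trans (ler_wpM2l _ H) _; first by rewrite !mulr_ge0 ?invr_ge0// ltW.
by rewrite le_eqVlt; apply/orP; left; apply/eqP; field; rewrite !gt_eqF.
Qed.

End sample_size.

Section rationals.
Context {R : realType}.
Implicit Types (mu nu : probability R R).

(** By right continuity, a violation at [a] persists on an interval to its right, which contains a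
    rational. *)
Lemma cdf_close_rat mu nu (D : R) :
  (forall q : rat, `|fine (mu `]-oo, ratr q]%classic) - fine (nu `]-oo, ratr q]%classic)| <= D) ->
  cdf_close mu nu D.
Proof.
move=> H a; rewrite leNgt; apply/negP => Da.
have C : `|fine (mu `]-oo, x]%classic) - fine (nu `]-oo, x]%classic)| @[x --> a^'+] -->
    `|fine (mu `]-oo, a]%classic) - fine (nu `]-oo, a]%classic)|.
  by apply: cvg_norm; apply: cvgB; exact: cvg_cdf_right.
move: C => /(cvgr_gt _) /(_ _ Da) [d /= d0 Hd].
have /rat_in_itvoo[q] : a < a + d by rewrite ltrDl.
rewrite in_itv/= => /andP[aq qd].
have : D < `|fine (mu `]-oo, ratr q]%classic) - fine (nu `]-oo, ratr q]%classic)|.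
  apply: Hd => //=; rewrite ltr_norml; apply/andP; split; lra.
by rewrite ltNge H.
Qed.

Lemma kolmogorov_distP (pi1 pi2 : set R -> \bar R) mu nu (D : R) :
  (forall a, pi1 `]-oo, a]%classic = mu `]-oo, a]%classic) ->
  (forall a, pi2 `]-oo, a]%classic = nu `]-oo, a]%classic) ->
  (kolmogorov_dist pi1 pi2 <= D%:E)%E <-> cdf_close mu nu D.
Proof.
move=> pi1E pi2E.
have E a : `|measure_cdf pi1 a - measure_cdf pi2 a|%E =
    `|fine (mu `]-oo, a]%classic) - fine (nu `]-oo, a]%classic)|%:E.
  by rewrite /measure_cdf pi1E pi2E (probability_fin mu)// (probability_fin nu).
split => [/ereal_supP H a|H].
  by rewrite -lee_fin -E; apply: H; exists a.
by apply/ereal_supP => _ [a _ <-]; rewrite E lee_fin.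
Qed.

End rationals.

(** * Deterministic error bound and union over time *)

Section particle_filter.
Context {R : realType}.
Variables (rho sigma c : R) (eta1 : probability R R).
Hypotheses (sigma_gt0 : 0 < sigma) (c_gt0 : 0 < c).
Variable N : nat.
Hypothesis N_gt0 : (0 < N)%N.

Local Notation particles := (particles rho sigma c eta1).
Local Notation predictive := (predictive rho eta1 sigma_gt0 c_gt0).
Local Notation filtering := (filtering rho eta1 sigma_gt0 c_gt0).
Local Notation mutated := (mutated rho sigma_gt0).
Implicit Types (u : nat -> 'I_N -> R * R) (x : 'I_N -> R).

Lemma empirical_ex x : exists P : probability R R, (forall A, P A = empirical x A) /\
  forall f, bounded_measurable f -> expect P f = N%:R^-1 * \sum_i f (x i).
Proof.
have w0 (i : 'I_N) : 0 <= N%:R^-1 :> R by rewrite invr_ge0.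
have w1 : \sum_(i < N) N%:R^-1 = 1 :> R.
  by rewrite sumr_const card_ord -[LHS]mulr_natl divff// pnatr_eq0 -lt0n.
have [P [PA Pf]] := weighted_ex x w0 w1.
exists P; split => [A|f bf]; last by rewrite Pf// mulr_sumr.
by rewrite PA /empirical ge0_sume_distrr.
Qed.

Definition empirical_prob x : probability R R := projT1 (cid (empirical_ex x)).
Definition weighted_prob x : probability R R :=
  projT1 (cid (weighted_empirical_ex c N_gt0 x)).

Lemma empirical_probE x A : empirical_prob x A = empirical x A.
Proof. by rewrite /empirical_prob; case: cid => P /= []. Qed.

Lemma expect_empirical x f : bounded_measurable f ->
  expect (empirical_prob x) f = N%:R^-1 * \sum_i f (x i).
Proof. by rewrite /empirical_prob; case: cid => P /= [_]; exact. Qed.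

Lemma weighted_probE x A : weighted_prob x A = weighted_empirical c x A.
Proof. by rewrite /weighted_prob; case: cid => P /= []. Qed.

Lemma expect_weighted x f : bounded_measurable f ->
  expect (weighted_prob x) f = \sum_i weight c x i * f (x i).
Proof. by rewrite /weighted_prob; case: cid => P /= [_]; exact. Qed.

Lemma empirical_prob_freq x a : fine (empirical_prob x `]-oo, a]%classic) = empirical_freq x `]-oo, a]%classic.
Proof. by rewrite -expect_indic// expect_empirical//; exact: bm_indic. Qed.

Lemma weighted_prob_freq x a : fine (weighted_prob x `]-oo, a]%classic) =
  \sum_i weight c x i * \1_(`]-oo, a]%classic) (x i).
Proof. by rewrite -expect_indic// expect_weighted//; exact: bm_indic. Qed.

Lemma clippedE u t : (forall s n, (0 < s)%N -> 0 < (u s n).1 < 1 /\ 0 < (u s n).2 < 1) ->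
  particles (clipped u) t = particles u t.
Proof.
move=> u01; apply: eq_particles => s n /andP[s0 _].
have [h1 h2] := u01 s n s0.
by rewrite /clipped /clip2 !clip01_id//; case: (u s n).
Qed.

(** The deterministic half of the argument: absence of deviations at all times up to [T] gives the
    hypotheses of the stability lemmas. *)
Lemma filter_bound u (T : nat) (D : R) :
  0 <= D -> D <= stability_radius rho sigma c eta1 ->
  (forall s n, (0 < s)%N -> 0 < (u s n).1 < 1 /\ 0 < (u s n).2 < 1) ->
  (forall t, (0 < t <= T)%N -> ~ deviating rho sigma c eta1 t u D) ->
  forall s, (s < T)%N ->
    cdf_close (weighted_prob (particles u s.+1)) (filtering s) (stability_const rho sigma c eta1 * D) /\
    cdf_close (empirical_prob (particles u s.+1)) (predictive s) ((1 + stability_const rho sigma c eta1) * D).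
Proof.
move=> D0 Dr u01 ndev.
pose muN s := empirical_prob (particles u s.+1).
pose hN s := weighted_prob (particles u s.+1).
pose nu s := if s is s'.+1 then mutated (hN s') else eta1.
(* The normalised weights tilt the empirical measure; its factor [1 / N] cancels in the quotient. *)
have hN_def s f : bounded_measurable f -> expect (hN s) f =
    expect (muN s) (fun y => gauss_potential c y * f y) / expect (muN s) (gauss_potential c).
  move=> bf; have bG := bm_gauss_potential (ltW c_gt0).
  rewrite expect_weighted// !expect_empirical//; last exact: bmM.
  have s0 := sum_potential_gt0 c N_gt0 (particles u s.+1).
  rewrite invfM invrK mulrACA mulVf ?mul1r ?pnatr_eq0 -?lt0n//.
  rewrite mulr_suml; apply: eq_bigr => i _; rewrite /weight -/(gauss_potential c _).
  by rewrite mulrAC.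
have nuS_def s f : bounded_measurable f -> expect (nu s.+1) f = expect (hN s) (mutate rho sigma f).
  exact: mutatedE.
have muN_close s : (s < T)%N -> cdf_close (muN s) (nu s) D.
  move=> sT; apply: cdf_close_rat => q.
  rewrite empirical_prob_freq -(clippedE _ u01).
  have -> : fine (nu s `]-oo, ratr q]%classic) =
      predicted_freq rho sigma c eta1 (past_of rho sigma c eta1 (clipped u) s.+1) (ratr q).
    case: s sT => [//|s] sT.
    rewrite -expect_indic// nuS_def; last exact: bm_indic.
    rewrite expect_weighted; last exact: (bm_ray_mass rho sigma_gt0).
    by rewrite -(clippedE s.+1 u01).
  rewrite leNgt; apply/negP => H; apply: (ndev s.+1); first by [].
  by exists q.
move=> s sT; split.
  apply: (filter_close sigma_gt0 c_gt0 hN_def _ nuS_def _ D0 Dr muN_close sT) => // s' f bf.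
  exact: filteringE.
apply: (prediction_close sigma_gt0 c_gt0 hN_def _ nuS_def _ _ _ D0 Dr muN_close sT) => //.
  by move=> s' f bf; exact: filteringE.
by move=> s' f bf; exact: mutatedE.
Qed.

Definition accurate u (T : nat) (kappa : R) : Prop :=
  (ereal_sup [set kolmogorov_dist (hat_eta_N rho sigma c eta1 u t) (hat_eta rho sigma c eta1 t)
             | t in [set t : nat | (1 <= t <= T)%N]] <= kappa%:E)%E /\
  (ereal_sup [set kolmogorov_dist (eta_N rho sigma c eta1 u t) (eta rho sigma c eta1 t)
             | t in [set t : nat | (1 <= t <= T)%N]] <= kappa%:E)%E.

Lemma accurateP u T kappa : accurate u T kappa <->
  forall s, (s < T)%N ->
    cdf_close (weighted_prob (particles u s.+1)) (filtering s) kappa /\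
    cdf_close (empirical_prob (particles u s.+1)) (predictive s) kappa.
Proof.
have H1 s : (kolmogorov_dist (hat_eta_N rho sigma c eta1 u s.+1) (hat_eta rho sigma c eta1 s.+1) <= kappa%:E)%E <->
    cdf_close (weighted_prob (particles u s.+1)) (filtering s) kappa.
  by apply: kolmogorov_distP => a; rewrite ?weighted_probE ?filtering_measure.
have H2 s : (kolmogorov_dist (eta_N rho sigma c eta1 u s.+1) (eta rho sigma c eta1 s.+1) <= kappa%:E)%E <->
    cdf_close (empirical_prob (particles u s.+1)) (predictive s) kappa.
  by apply: kolmogorov_distP => a; rewrite ?empirical_probE ?predictive_measure.
split => [[/ereal_supP h1 /ereal_supP h2] s sT|H].
  by split; [apply/H1/h1|apply/H2/h2]; exists s.+1.
by split; apply/ereal_supP => _ [[//|s] /andP[_ sT] <-]; [apply/H1|apply/H2]; have [] := H s sT.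
Qed.

Context d (Omega : measurableType d) (P : probability Omega R).
Variable V : Omega -> nat -> 'I_N -> R * R.
Hypothesis V01 : forall w s n, (0 < s)%N -> 0 < (V w s n).1 < 1 /\ 0 < (V w s n).2 < 1.

Lemma measurable_accurate T kappa : measurable_points T V ->
  measurable [set w | accurate (V w) T kappa].
Proof.
move=> mV.
pose C s (q : rat) := [set w |
    `|fine (weighted_prob (particles (V w) s.+1) `]-oo, ratr q]%classic) -
      fine (filtering s `]-oo, ratr q]%classic)| <= kappa] `&`
  [set w | `|fine (empirical_prob (particles (V w) s.+1) `]-oo, ratr q]%classic) -
      fine (predictive s `]-oo, ratr q]%classic)| <= kappa].
rewrite (_ : [set w | _] = \bigcap_(s in [set s | (s < T)%N]) \bigcap_(q : rat) C s q); last first.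
  apply/seteqP; split => w /=.
    by move=> /accurateP H s sT q _; have [h1 h2] := H s sT; split; [exact: h1|exact: h2].
  by move=> H; apply/accurateP => s sT; split; apply: cdf_close_rat => q; have [] := H s sT q I.
apply: fin_bigcap_measurable => [|s sT]; first exact: finite_II.
 rewrite -[X in measurable X]setCK setC_bigcap; apply: measurableC.
apply: bigcupT_measurable_rat => q; apply: measurableC.
have mx n : measurable_fun setT (fun w => particles (V w) s.+1 n).
  rewrite (_ : (fun w => _) = (fun w => particles (clipped (V w)) s.+1 n)).
    exact: (measurable_particles rho c eta1 sigma_gt0 N_gt0 mV).
  by apply/funext => w; rewrite clippedE//; exact: V01.
have mI n : measurable_fun setT (fun w => \1_(`]-oo, ratr q]%classic) (particles (V w) s.+1 n) : R).
  exact: measurableT_comp (mx n).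
apply: measurableI; apply: measurable_set_le => //; apply: measurableT_comp => //; apply: measurable_funB => //.
  under eq_fun do rewrite weighted_prob_freq.
  apply: (@measurable_sum _ _ _ _ _ (index_enum 'I_N) (fun m w => weight c (particles (V w) s.+1) m *
        \1_(`]-oo, ratr q]%classic) (particles (V w) s.+1 m))) => m.
  by apply: measurable_funM => //; exact: measurable_weight.
under eq_fun do rewrite empirical_prob_freq.
apply: measurable_funM => //.
exact: (@measurable_sum _ _ _ _ _ (index_enum 'I_N) (fun m w => \1_(`]-oo, ratr q]%classic) (particles (V w) s.+1 m))).
Qed.

Lemma accurate_probability (T K : nat) (kappa e q : R) :
  (forall t, (0 < t <= T)%N -> iid_points t P V) -> measurable_points T V ->
  0 < e <= 1 -> (0 < K)%N -> K%:R^-1 <= e / 2 ->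
  e <= stability_radius rho sigma c eta1 ->
  (1 + stability_const rho sigma c eta1) * e <= kappa ->
  T%:R * (2 * K%:R * expR (- (N%:R * e ^+ 2 / 32))) <= q ->
  ((1 - q)%:E <= P [set w | accurate (V w) T kappa])%E.
Proof.
move=> iidV mV e01 K0 Ke er eT Tq; have /andP[e0 _] := e01.
pose bad s := [set w | deviating rho sigma c eta1 s.+1 (V w) e].
have mVs s : (s < T)%N -> measurable_points s.+1 V.
  by move=> sT; have [] := iidV s.+1 sT.
have mbad s : (s < T)%N -> measurable (bad s).
  by move=> sT; exact: (@measurable_deviating _ rho sigma c eta1 sigma_gt0 N N_gt0 _ _ s.+1 _ (mVs s sT) isT e).
have mA := @measurable_accurate T kappa mV.
pose B := \big[setU/set0]_(s < T) bad s.
have mB : measurable B by apply: bigsetU_measurable => s _; exact: mbad.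
have sub : ~` B `<=` [set w | accurate (V w) T kappa].
  move=> w nB; apply/accurateP => s sT.
  have nbad t : (0 < t <= T)%N -> ~ deviating rho sigma c eta1 t (V w) e.
    case: t => [//|t] /andP[_ tT] dev; apply: nB; rewrite /B (bigD1 (Ordinal tT))//=.
    by left.
  have [h1 h2] := filter_bound (ltW e0) er (V01 w) nbad sT.
  split => a; first apply: le_trans (h1 a) _; last exact: le_trans (h2 a) _.
  by apply: le_trans eT; rewrite ler_wpM2r ?(ltW e0)// lerDr.
have PB : (P B <= q%:E)%E.
  apply: (@le_trans _ _ (\sum_(s < T) P (bad s))%E).
    exact: (@Boole_inequality _ _ _ P bad T mbad).
  apply: (@le_trans _ _ (\sum_(s < T) (2 * K%:R * expR (- (N%:R * e ^+ 2 / 32)))%:E)%E).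
    apply: lee_sum => s _; exact: (deviating_le rho c eta1 sigma_gt0 N_gt0 (iidV s.+1 (ltn_ord s)) isT e01 K0 Ke).
  by rewrite sumEFin lee_fin sumr_const card_ord -[leLHS]mulr_natl.
apply: (@le_trans _ _ (P (~` B))); last first.
  by apply: le_measure => //; rewrite inE//; exact: measurableC.
by rewrite probability_setC// EFinB leeB.
Qed.

End particle_filter.

Theorem corollary1 (R : realType) (rho sigma c : R) (eta1 : probability R R)
    (sigma_gt0 : 0 < sigma) (c_gt0 : 0 < c) :
  exists2 C : R, 0 < C &
  forall (q kappa : R) (T : nat),
    0 < q < 1 -> 0 < kappa < 1 -> (1 <= T)%N ->
  forall N : nat, (1 <= N)%N -> sample_size C T kappa q <= N%:R ->
  forall (d : measure_display) (Omega : measurableType d)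
    (P : probability Omega R) (U : nat -> 'I_N -> {RV P >-> (R * R)%type}),
    iid_uniform_points U ->
  ((1 - q)%:E <=
   P [set w |
     ereal_sup [set kolmogorov_dist
                      (hat_eta_N rho sigma c eta1 (fun t n => U t n w) t)
                      (hat_eta rho sigma c eta1 t)
               | t in [set t : nat | (1 <= t <= T)%N]] <= kappa%:E /\
     ereal_sup [set kolmogorov_dist
                      (eta_N rho sigma c eta1 (fun t n => U t n w) t)
                      (eta rho sigma c eta1 t)
               | t in [set t : nat | (1 <= t <= T)%N]] <= kappa%:E])%E.
Proof.
have S0 := stability_const_ge0 rho sigma_gt0 c_gt0 eta1.
have r0 := stability_radius_gt0 rho sigma_gt0 c_gt0 eta1.
move: S0 r0; set S := stability_const _ _ _ _; set r := stability_radius _ _ _ _ => S0 r0.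
(* The term [r^-1] gives [kappa / L <= r], the terms [2 + S] give
   [(1 + S) * (kappa / L) <= kappa]. *)
pose L : R := 2 + S + r^-1.
have ri0 : 0 < r^-1 by rewrite invr_gt0.
have L2 : 2 <= L by rewrite /L -addrA lerDl addr_ge0// ltW.
have L0 : 0 < L by lra.
have rL : L^-1 <= r.
  by rewrite -[r]invrK lef_pV2 ?posrE// /L lerDr; lra.
have SL : (1 + S) * L^-1 <= 1.
  by rewrite ler_pdivrMr// mul1r /L; lra.
have lnL : 0 <= ln (6 * L) by apply: ln_ge0; lra.
exists (32 * L ^+ 2 * (1 + ln (6 * L))).
  by rewrite !mulr_gt0 ?exprn_gt0//; lra.
move=> q kappa T q01 k01 T1 N N1 HN d Omega P U iidU.
have /andP[k0 k1] := k01.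
have iL0 : 0 < L^-1 by rewrite invr_gt0.
pose e := kappa / L.
have e0 : 0 < e by rewrite divr_gt0.
have e1 : e <= 1 by rewrite /e ler_pdivrMr//; lra.
(* A grid with mesh at most [e / 2], and yet with at most [3 / e] cells because [e <= 1]. *)
pose K := (Num.truncn (2 / e)).+1.
have Klt : 2 / e < K%:R by exact: truncnS_gt.
have Kle : K%:R <= 3 / e.
  rewrite /K -natr1; have : (Num.truncn (2 / e))%:R <= 2 / e by rewrite truncn_le divr_ge0// ltW.
  have : 1 <= e^-1 by rewrite invf_ge1.
  lra.
have [U01 _ _] := iidU.
apply: (@accurate_probability _ rho sigma c eta1 sigma_gt0 c_gt0 N N1 _ _ P
  (fun w t n => U t n w) _ T K kappa e q).
- by move=> w s n s0; exact: U01.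
- by move=> t _; exact: iid_uniform_pointsP.
- by have [] := iid_uniform_pointsP T iidU.
- by rewrite e0.
- by [].
- by rewrite -[e / 2]invrK invf_div lef_pV2 ?posrE ?divr_gt0// ltW.
- apply: le_trans rL; rewrite /e ler_piMl//; exact: ltW.
- rewrite -/S /e mulrCA; apply: ler_piMr => //; exact: ltW.
- have := sample_size_tail (ltac:(lra) : 1 <= L) q01 k01 T1 HN.
  apply: le_trans; rewrite -/e mulrA; apply: ler_wpM2r; first exact: expR_ge0.
  apply: ler_wpM2l => //.
  have -> : 6 * L / kappa = 2 * (3 / e) by rewrite /e; field; rewrite !gt_eqF.
  by rewrite ler_wpM2l.
Qed.
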